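(* Suppose $H_0$ is a Jacobi operator in $\ell^2(\mathbb{Z})$ (with coefficients $a_0,b_0$) with purely discrete spectrum of finite convergence exponent $s>0$. Let $\phi_0(z,n)$ and $\chi_0(z,n)$ be real entire solutions of $\tau_0u=zu$ of growth order at most $s$, nontrivial for each $z\in\mathbb{C}$, which lie in the domain of $H_0$ near $-\infty$ and $+\infty$, respectively, and suppose there is an $\tilde n\in\mathbb{Z}$ such that $$\frac{\chi_0(z,\tilde n)}{\phi_0(z,\tilde n)}=o(1)$$ as $|z|\to\infty$ along some non-real rays dissecting the complex plane into sectors of opening angles less than $\pi/s$. Then every other isospectral Jacobi operator $H_1$ (with coefficients $a_1,b_1$, i.e. $\sigma(H_1)=\sigma(H_0)$) with $a_1(n)=a_0(n)$ for $n<\tilde n-1$, $b_1(n)=b_0(n)$ for $n<\tilde n$ and which is associated with the same boundary condition at $-\infty$ (if any) is equal to $H_0$.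
   Context: For $j=0,1$, $a_j,b_j$ are real sequences on $\mathbb{Z}$ with $a_j(n)>0$ for all $n$; $(\tau_jf)(n)=a_j(n)f(n+1)+a_j(n-1)f(n-1)+b_j(n)f(n)$ and $W_j(f,g)(n)=a_j(n)\big(f(n)g(n+1)-f(n+1)g(n)\big)$. $\tau_j$ is limit circle at $\pm\infty$ if for some (equivalently all) $z\in\mathbb{C}$ all solutions of $\tau_ju=zu$ are square summable near $\pm\infty$, and limit point otherwise. At each limit circle endpoint a boundary condition is fixed: $f$ satisfies it if $\lim_{n\to\pm\infty}W_j(v_\pm,f)(n)=0$, where $v_\pm$ is a fixed nontrivial real solution of $\tau_jv=\lambda_0v$ for some $\lambda_0\in\mathbb{R}$; at a limit point endpoint no condition is imposed. The Jacobi operator $H_j$ (with separated boundary conditions) is the self-adjoint operator $f\mapsto\tau_jf$ in $\ell^2(\mathbb{Z})$ with domain all $f\in\ell^2(\mathbb{Z})$ such that $\tau_jf\in\ell^2(\mathbb{Z})$ and $f$ satisfies the boundary conditions (if any). If the coefficients of $\tau_0,\tau_1$ agree near $-\infty$ and both are limit circle there, ''the same boundary condition at $-\infty$'' means that the same sequences satisfy the two conditions. A real entire solution $\phi(z,n)$ is a solution of $\tau_j\phi(z,\cdot)=z\phi(z,\cdot)$ for every $z\in\mathbb{C}$ such that for each $n$ the function $\phi(\cdot,n)$ is entire and real on $\mathbb{R}$. It is of growth order at most $s$ if the entire functions $\phi(\cdot,n)$ and $\phi(\cdot,n+1)$ are of growth order at most $s$ for one (and hence all) $n\in\mathbb{Z}$.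 It lies in the domain of $H_j$ near $\pm\infty$ if for each $z\in\mathbb{C}$ it is square summable near $\pm\infty$ and satisfies the boundary condition of $H_j$ at $\pm\infty$ (if any). The convergence exponent of a discrete set $S\subseteq\mathbb{C}$ is $\inf\{t\ge0:\sum_{\mu\in S}\frac{1}{1+|\mu|^t}<\infty\}$. A non-real ray is a ray from the origin not contained in the real axis. *)

(* Defs.v *)
From Stdlib Require Import Reals ZArith List.
From Coquelicot Require Import Coquelicot.

Local Open Scope R_scope.
Local Open Scope C_scope.

(** * Jacobi difference expressions *)

Definition tau (a b : Z -> R) (f : Z -> C) (n : Z) : C :=
  RtoC (a n) * f (n + 1)%Z + RtoC (a (n - 1)%Z) * f (n - 1)%Z
  + RtoC (b n) * f n.

Definition wronskian (a : Z -> R) (f g : Z -> C) (n : Z) : C :=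
  RtoC (a n) * (f n * g (n + 1)%Z - f (n + 1)%Z * g n).

Definition solution (a b : Z -> R) (z : C) (u : Z -> C) : Prop :=
  forall n, tau a b u n = z * u n.

(** * Square summability *)

Definition sqsum_minus (f : Z -> C) : Prop :=
  ex_series (fun k : nat => (Cmod (f (- Z.of_nat k)%Z) ^ 2)%R).

Definition sqsum_plus (f : Z -> C) : Prop :=
  ex_series (fun k : nat => (Cmod (f (Z.of_nat k)) ^ 2)%R).

Definition l2 (f : Z -> C) : Prop := sqsum_minus f /\ sqsum_plus f.

(* Meaningful only for [l2 f], since [Series] is total. *)
Definition l2norm (f : Z -> C) : R :=
  sqrt (Series (fun k : nat => (Cmod (f (- Z.of_nat (S k))%Z) ^ 2)%R)
        + Series (fun k : nat => (Cmod (f (Z.of_nat k)) ^ 2)%R)).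

Definition limit_circle_minus (a b : Z -> R) : Prop :=
  exists z : C, forall u, solution a b z u -> sqsum_minus u.

Definition limit_circle_plus (a b : Z -> R) : Prop :=
  exists z : C, forall u, solution a b z u -> sqsum_plus u.

(** * Jacobi operators with separated boundary conditions *)

Definition boundary_sequence (a b : Z -> R) (v : Z -> R) : Prop :=
  (exists lambda0 : R, solution a b (RtoC lambda0) (fun n => RtoC (v n)))
  /\ (exists n, v n <> 0%R).

(* [bv_minus] and [bv_plus] carry information only at limit circle endpoints:
   at a limit point endpoint they are arbitrary and never used.  Hence operators
   are compared with [same_operator], not with Leibniz equality of records. *)
Record jacobi := Jacobi {
  coef_a : Z -> R;
  coef_b : Z -> R;
  coef_a_pos : forall n, (0 < coef_a n)%R;
  bv_minus : Z -> R;
  bv_plus : Z -> R;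
  bv_minus_ok :
    limit_circle_minus coef_a coef_b -> boundary_sequence coef_a coef_b bv_minus;
  bv_plus_ok :
    limit_circle_plus coef_a coef_b -> boundary_sequence coef_a coef_b bv_plus
}.

Definition jtau (H : jacobi) : (Z -> C) -> Z -> C := tau (coef_a H) (coef_b H).

Definition bc_minus (H : jacobi) (f : Z -> C) : Prop :=
  limit_circle_minus (coef_a H) (coef_b H) ->
  filterlim
    (fun k : nat =>
       wronskian (coef_a H) (fun n => RtoC (bv_minus H n)) f (- Z.of_nat k)%Z)
    eventually (locally (RtoC 0)).

Definition bc_plus (H : jacobi) (f : Z -> C) : Prop :=
  limit_circle_plus (coef_a H) (coef_b H) ->
  filterlim
    (fun k : nat =>
       wronskian (coef_a H) (fun n => RtoC (bv_plus H n)) f (Z.of_nat k))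
    eventually (locally (RtoC 0)).

Definition domain (H : jacobi) (f : Z -> C) : Prop :=
  l2 f /\ l2 (jtau H f) /\ bc_minus H f /\ bc_plus H f.

Definition same_operator (H K : jacobi) : Prop :=
  (forall f, domain H f <-> domain K f)
  /\ (forall f, domain H f -> forall n, jtau H f n = jtau K f n).

(* Boundary conditions are compared on sequences which lie, together with their
   images, in l2 near -oo.  On arbitrary sequences, [bv_minus] solving the
   equation for two different real [lambda0] need not give the same limits even
   when they define the same self-adjoint operator. *)
Definition same_bc_minus (H K : jacobi) : Prop :=
  limit_circle_minus (coef_a H) (coef_b H) ->
  limit_circle_minus (coef_a K) (coef_b K) ->
  forall f, sqsum_minus f -> sqsum_minus (jtau H f) -> sqsum_minus (jtau K f) ->
  (bc_minus H f <-> bc_minus K f).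

(** * Spectrum *)

(* H - z maps the domain bijectively onto l2 and its inverse is bounded. *)
Definition resolvent_set (H : jacobi) (z : C) : Prop :=
  (forall g, l2 g ->
     exists f, (domain H f /\ forall n, jtau H f n - z * f n = g n)
       /\ (forall f', domain H f' -> (forall n, jtau H f' n - z * f' n = g n) ->
             forall n, f' n = f n))
  /\ (exists K : R, forall f, domain H f ->
        (l2norm f <= K * l2norm (fun n => jtau H f n - z * f n)%C)%R).

Definition spectrum (H : jacobi) (z : C) : Prop := ~ resolvent_set H z.

Definition eigenvector (H : jacobi) (z : C) (f : Z -> C) : Prop :=
  domain H f /\ forall n, jtau H f n = z * f n.

Definition isolated_point (S : C -> Prop) (z : C) : Prop :=
  S z /\ exists eps : R, (0 < eps)%R /\
    forall w, S w -> w <> z -> (eps <= Cmod (w - z))%R.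

Definition in_discrete_spectrum (H : jacobi) (z : C) : Prop :=
  isolated_point (spectrum H) z
  /\ (exists f, eigenvector H z f /\ exists n, f n <> 0)
  /\ (exists (k : nat) (e : nat -> Z -> C), forall f, eigenvector H z f ->
        exists c : nat -> C,
          forall n, f n = sum_n (fun i => c i * e i n) k).

Definition purely_discrete_spectrum (H : jacobi) : Prop :=
  forall z, spectrum H z -> in_discrete_spectrum H z.

(* The sum of nonnegative terms over a set is finite when its finite partial
   sums are bounded.  [Rpower 0 t] is 1, which affects the single term mu = 0
   and hence not the finiteness of the sum. *)
Definition finite_inverse_sum (S : C -> Prop) (t : R) : Prop :=
  exists M : R, forall l : list C, NoDup l -> (forall mu, In mu l -> S mu) ->
    (fold_right Rplus 0 (map (fun mu => 1 / (1 + Rpower (Cmod mu) t)) l) <= M)%R.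

Definition convergence_exponent (S : C -> Prop) : Rbar :=
  Glb_Rbar (fun t => (0 <= t)%R /\ finite_inverse_sum S t).

(** * Entire functions and real entire solutions *)

Definition entire (f : C -> C) : Prop :=
  forall z : C, ex_derive (K := C_AbsRing) (V := C_NormedModule) f z.

Definition growth_order (f : C -> C) : Rbar :=
  Glb_Rbar (fun rho => (0 <= rho)%R /\
    exists r0 : R, (0 < r0)%R /\ forall z : C, (r0 <= Cmod z)%R ->
      (Cmod (f z) <= exp (Rpower (Cmod z) rho))%R).

Definition real_entire_solution (H : jacobi) (phi : C -> Z -> C) : Prop :=
  (forall z, solution (coef_a H) (coef_b H) z (phi z))
  /\ (forall n, entire (fun z => phi z n)
        /\ forall x : R, Im (phi (RtoC x) n) = 0%R).

Definition solution_order_at_most (phi : C -> Z -> C) (s : R) : Prop :=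
  exists n : Z, Rbar_le (growth_order (fun z => phi z n)) s
    /\ Rbar_le (growth_order (fun z => phi z (n + 1)%Z)) s.

Definition nontrivial_solution (phi : C -> Z -> C) : Prop :=
  forall z : C, exists n : Z, phi z n <> 0.

Definition in_domain_near_minus (H : jacobi) (phi : C -> Z -> C) : Prop :=
  forall z : C, sqsum_minus (phi z) /\ bc_minus H (phi z).

Definition in_domain_near_plus (H : jacobi) (phi : C -> Z -> C) : Prop :=
  forall z : C, sqsum_plus (phi z) /\ bc_plus H (phi z).

(** * Rays *)

Definition ray_point (theta r : R) : C :=
  RtoC r * (cos theta, sin theta).

(* [theta 0 < ... < theta (m - 1)] are the arguments of m rays; the closing
   condition [theta m = theta 0 + 2 PI] makes the consecutive differences the
   opening angles of all m sectors, and forces m > 0. *)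
Definition nonreal_rays (m : nat) (theta : nat -> R) (alpha : R) : Prop :=
  theta m = (theta 0%nat + 2 * PI)%R
  /\ forall k, (k < m)%nat ->
       (theta k < theta (S k))%R
       /\ (theta (S k) - theta k < alpha)%R
       /\ sin (theta k) <> 0%R.

Definition tends_to_0_along_ray (F : C -> C) (theta : R) : Prop :=
  filterlim (fun r : R => F (ray_point theta r))
    (Rbar_locally p_infty) (locally (RtoC 0)).

(* Main.v *)
From Pilot Require Import Defs.
From Stdlib Require Import Reals ZArith Lra Lia ClassicalEpsilon.
From Stdlib Require Import FunctionalExtensionality ssreflect.
From Coquelicot Require Import Coquelicot.
(* [Reals] also declares a [domain]; the one of [Defs] is meant below. *)
Import Pilot.Defs.
Local Open Scope R_scope.
Local Open Scope general_if_scope.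

(** Let [G_j] be the diagonal Green's function of [H_j] at [N = n0], let
    [W = W_0(phi_0, chi_0)] and [c = a_1(N - 1) / a_0(N - 1)].  The spectrum is
    discrete and consists of eigenvalues, so [W] vanishes on it, while [G_1] has at
    most simple poles there because [|G_1(z)| <= 1 / |Im z|].  Hence
    [h_N = c^2 G_1 W - chi_0(N) phi_0(N)] is entire, and since the left solutions of
    both operators coincide on [n < N] and are proportional at [N], [h_N / phi_0(N)^2]
    equals the analogous quotient at [N - 1].  The two denominators have no common
    zero, so [F = h_N / phi_0(N)^2] is entire, and its growth order is at most [s].
    As [W G_0 = phi_0(N) chi_0(N)], one has
    [F = (chi_0 / phi_0)(N) (c^2 G_1 / G_0 - 1)], and [z G_j -> -1] along non-real
    rays, so [F] tends to 0 along the given rays.  By Phragmen-Lindelof and Liouville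
    [F = 0], that is [a_1(N - 1)^2 G_1 = a_0(N - 1)^2 G_0].  The asymptotics of Green's
    functions then give [a_1(N - 1) = a_0(N - 1)], [b_1(N) = b_0(N)] and the same
    identity at [N + 1], so that induction determines all coefficients; finally both
    operators share a solution satisfying the boundary condition at [+oo]. *)

(** * Holomorphic functions *)

(** Off the real axis [G_1] is controlled by [1 / |Im z|], which says nothing on the axis itself. On
    the boundary of a square centred on the axis the weight [(w - l)^2 - eps^2] vanishes where the
    contour meets the axis and so restores boundedness; this one device gives both the simple poles
    of [G_1] and the growth of [h_N]. The order of [h_N / phi_0(N)^2] is bounded by dividing out
    zeros one at a time and applying Borel-Caratheodory to the zero-free rest, without canonical
    products.

    The factor [c^2] arises because the left solution of [H_1] that equals [phi_0] up to [N - 1]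
    takes the value [phi_0(N) / c] at [N]: the equation at [N - 1] fixes only the product
    [a(N - 1) u(N)].

    A Jacobi operator is given here by its domain alone, so its symmetry has to be proved.
    Discreteness of the spectrum provides one resolvent point, whose resolvent approximates any
    element of the domain in the graph norm by sequences solving the equation near both endpoints;
    for these Green's formula leaves no boundary terms. *)

Definition near (z : C) (P : C -> Prop) : Prop :=
  exists d, 0 < d /\ forall w, Cmod (w - z) < d -> P w.

Lemma near_and z (P Q : C -> Prop) : near z P -> near z Q -> near z (fun w => P w /\ Q w).
Proof.
  intros [d [Hd H]] [e [He K]]. exists (Rmin d e); split; [now apply Rmin_pos|].
  intros w Hw; split; [apply H | apply K]; apply (Rlt_le_trans _ _ _ Hw);
    [apply Rmin_l | apply Rmin_r].
Qed.

Lemma near_imp z (P Q : C -> Prop) : (forall w, P w -> Q w) -> near z P -> near z Q.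
Proof. intros H [d [Hd K]]; exists d; split; auto. Qed.

Lemma Cmod_minus_diag z : Cmod (z - z) = 0.
Proof. replace (z - z)%C with (RtoC 0) by ring. apply Cmod_0. Qed.

Lemma near_self z (P : C -> Prop) : near z P -> P z.
Proof. intros [d [Hd K]]; apply K. now rewrite Cmod_minus_diag. Qed.

Lemma Cmod_sym z w : Cmod (z - w) = Cmod (w - z).
Proof. rewrite -Cmod_opp. f_equal. ring. Qed.

Lemma near_near z (P : C -> Prop) : near z P -> near z (fun w => near w P).
Proof.
  intros [d [Hd K]]. exists (d/2); split; [lra|]. intros w Hw.
  exists (d/2); split; [lra|]. intros v Hv. apply K.
  replace (v - z)%C with ((v - w) + (w - z))%C by ring.
  apply (Rle_lt_trans _ _ _ (Cmod_triangle _ _)). lra.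
Qed.

Lemma near_ne z a : z <> a -> near z (fun w => w <> a).
Proof.
  intros H. exists (Cmod (a - z)); split.
  { apply Cmod_gt_0. intros E; apply H. replace a with (a - z + z)%C by ring. rewrite E; ring. }
  intros w Hw E; subst; lra.
Qed.

Lemma near_ball z r : 0 < r -> near z (fun w => Cmod (w - z) < r).
Proof. intros; exists r; auto. Qed.

Definition Ccont (f : C -> C) (z : C) : Prop :=
  forall eps, 0 < eps -> near z (fun w => Cmod (f w - f z) < eps).

Lemma Ccont_ext f g z : near z (fun w => f w = g w) -> Ccont f z -> Ccont g z.
Proof.
  intros E H eps He. pose proof (near_self _ _ E) as E0.
  eapply near_imp; [|exact (near_and _ _ _ E (H eps He))].
  cbv beta; intros w [-> K]; now rewrite -E0.
Qed.

Lemma Ccont_const c z : Ccont (fun _ => c) z.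
Proof. intros eps He; exists 1; split; [lra|]; intros; now rewrite Cmod_minus_diag. Qed.

Lemma Ccont_id z : Ccont (fun w => w) z.
Proof. intros eps He; exists eps; auto. Qed.

Lemma Ccont_plus f g z : Ccont f z -> Ccont g z -> Ccont (fun w => f w + g w)%C z.
Proof.
  intros Hf Hg eps He.
  eapply near_imp; [|exact (near_and _ _ _ (Hf (eps/2) ltac:(lra)) (Hg (eps/2) ltac:(lra)))].
  cbv beta; intros w [A B].
  replace (f w + g w - (f z + g z))%C with ((f w - f z) + (g w - g z))%C by ring.
  apply (Rle_lt_trans _ _ _ (Cmod_triangle _ _)). lra.
Qed.

Lemma Ccont_bounded f z : Ccont f z -> near z (fun w => Cmod (f w) <= Cmod (f z) + 1).
Proof.
  intros Hf. eapply near_imp; [|exact (Hf 1 ltac:(lra))]. cbv beta; intros w A.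
  replace (f w) with ((f w - f z) + f z)%C by ring.
  apply (Rle_trans _ _ _ (Cmod_triangle _ _)). lra.
Qed.

Lemma Ccont_mult f g z : Ccont f z -> Ccont g z -> Ccont (fun w => f w * g w)%C z.
Proof.
  intros Hf Hg eps He.
  set (A := Cmod (f z) + 1). set (B := Cmod (g z) + 1).
  assert (HA : 0 < A) by (unfold A; pose proof (Cmod_ge_0 (f z)); lra).
  assert (HB : 0 < B) by (unfold B; pose proof (Cmod_ge_0 (g z)); lra).
  assert (EA : 0 < eps / (2*B)) by (apply Rdiv_lt_0_compat; lra).
  assert (EB : 0 < eps / (2*A)) by (apply Rdiv_lt_0_compat; lra).
  eapply near_imp; [|exact (near_and _ _ _ (Ccont_bounded _ _ Hf)
    (near_and _ _ _ (Hf _ EA) (Hg _ EB)))].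
  cbv beta; intros w [H1 [H2 H3]].
  replace (f w * g w - f z * g z)%C with (f w * (g w - g z) + (f w - f z) * g z)%C by ring.
  apply (Rle_lt_trans _ _ _ (Cmod_triangle _ _)). rewrite !Cmod_mult.
  assert (Cmod (f w) * Cmod (g w - g z) <= A * Cmod (g w - g z))
    by (apply Rmult_le_compat_r; [apply Cmod_ge_0 | exact H1]).
  assert (A * Cmod (g w - g z) < eps/2).
  { replace (eps/2) with (A * (eps/(2*A))) by (field; lra). now apply Rmult_lt_compat_l. }
  assert (Cmod (f w - f z) * Cmod (g z) <= Cmod (f w - f z) * B)
    by (apply Rmult_le_compat_l; [apply Cmod_ge_0 | unfold B; lra]).
  assert (Cmod (f w - f z) * B < eps/2).
  { replace (eps/2) with ((eps/(2*B)) * B) by (field; lra). now apply Rmult_lt_compat_r. }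
  lra.
Qed.

Lemma Ccont_opp f z : Ccont f z -> Ccont (fun w => - f w)%C z.
Proof.
  intros H. apply (Ccont_ext (fun w => (- (1)) * f w)%C).
  { exists 1; split; [lra|]; intros; ring. }
  apply Ccont_mult; [apply Ccont_const | exact H].
Qed.

Lemma Ccont_minus f g z : Ccont f z -> Ccont g z -> Ccont (fun w => f w - g w)%C z.
Proof. intros; apply Ccont_plus; [|apply Ccont_opp]; assumption. Qed.

Lemma Ccont_comp f g z : Ccont g z -> Ccont f (g z) -> Ccont (fun w => f (g w)) z.
Proof.
  intros Hg Hf eps He. destruct (Hf eps He) as [d [Hd K]].
  eapply near_imp; [|exact (Hg d Hd)]. cbv beta; intros; auto.
Qed.

Lemma Ccont_near_ne f z c : Ccont f z -> f z <> c -> near z (fun w => f w <> c).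
Proof.
  intros Hf H. destruct (near_ne _ _ H) as [d [Hd K]].
  eapply near_imp; [|exact (Hf d Hd)]. cbv beta; intros; auto.
Qed.

Lemma Ccont_lower f z : Ccont f z -> f z <> 0 -> near z (fun w => Cmod (f z) / 2 <= Cmod (f w)).
Proof.
  intros Hf H. apply Cmod_gt_0 in H.
  eapply near_imp; [|exact (Hf (Cmod (f z)/2) ltac:(lra))]. cbv beta; intros w A.
  pose proof (Cmod_triangle (f w) (f z - f w)) as T.
  replace (f w + (f z - f w))%C with (f z) in T by ring. rewrite (Cmod_sym (f z)) in T. lra.
Qed.

Lemma Ccont_inv f z : Ccont f z -> f z <> 0 -> Ccont (fun w => / f w)%C z.
Proof.
  intros Hf H eps He. pose proof (proj1 (Cmod_gt_0 _) H) as Hp.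
  set (m := Cmod (f z)) in *.
  assert (E1 : 0 < eps * m * m / 2) by (assert (0 < eps * m) by nra; nra).
  eapply near_imp; [|exact (near_and _ _ _ (Ccont_near_ne _ _ _ Hf H)
     (near_and _ _ _ (Ccont_lower _ _ Hf H) (Hf _ E1)))].
  cbv beta; intros w [N [L U]]. fold m in L.
  replace (/ f w - / f z)%C with ((f z - f w) * (/ f w * / f z))%C by (field; auto).
  rewrite Cmod_mult Cmod_mult !Cmod_inv // Cmod_sym. fold m.
  assert (Hw : 0 < Cmod (f w)) by lra.
  assert (I : / Cmod (f w) <= 2 / m).
  { replace (2/m) with (/ (m/2)) by (field; lra). apply Rinv_le_contravar; lra. }
  assert (I2 : 0 < / m) by now apply Rinv_0_lt_compat.
  assert (J : / Cmod (f w) * / m <= 2 / m * / m) by (apply Rmult_le_compat_r; lra).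
  assert (J2 : 0 < 2 / m * / m) by (apply Rmult_lt_0_compat; [unfold Rdiv; lra|lra]).
  apply Rle_lt_trans with (Cmod (f w - f z) * (2 / m * / m)).
  { apply Rmult_le_compat_l; [apply Cmod_ge_0|exact J]. }
  replace eps with ((eps * m * m / 2) * (2 / m * / m)) by (field; lra).
  now apply Rmult_lt_compat_r.
Qed.

Lemma Ccont_div f g z : Ccont f z -> Ccont g z -> g z <> 0 -> Ccont (fun w => f w / g w)%C z.
Proof. intros; apply Ccont_mult; [|apply Ccont_inv]; assumption. Qed.

(* Caratheodory's form of complex differentiability. *)
Definition hasd (f : C -> C) (z l : C) : Prop :=
  exists q, Ccont q z /\ q z = l /\ near z (fun w => f w = f z + q w * (w - z))%C.

Definition holo (f : C -> C) (z : C) : Prop := exists l, hasd f z l.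

Lemma hasd_holo f z l : hasd f z l -> holo f z.
Proof. now exists l. Qed.

Lemma hasd_cont f z l : hasd f z l -> Ccont f z.
Proof.
  intros [q [Hq [_ E]]].
  apply (Ccont_ext (fun w => f z + q w * (w - z))%C).
  { eapply near_imp; [|exact E]; auto. }
  apply Ccont_plus; [apply Ccont_const|]. apply Ccont_mult; [exact Hq|].
  apply Ccont_minus; [apply Ccont_id | apply Ccont_const].
Qed.

Lemma holo_cont f z : holo f z -> Ccont f z.
Proof. intros [l H]; exact (hasd_cont _ _ _ H). Qed.

Lemma hasd_ext f g z l : near z (fun w => f w = g w) -> hasd f z l -> hasd g z l.
Proof.
  intros E [q [Hq [Hl H]]]. exists q; split; [exact Hq|split; [exact Hl|]].
  pose proof (near_self _ _ E) as E0.
  eapply near_imp; [|exact (near_and _ _ _ E H)]. cbv beta; intros w [-> K].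
  now rewrite -E0.
Qed.

Lemma holo_ext f g z : near z (fun w => f w = g w) -> holo f z -> holo g z.
Proof. intros E [l H]; exists l; exact (hasd_ext _ _ _ _ E H). Qed.

Lemma hasd_const c z : hasd (fun _ => c) z 0.
Proof.
  exists (fun _ => RtoC 0); split; [apply Ccont_const|split; [reflexivity|]].
  exists 1; split; [lra|]; intros; ring.
Qed.

Lemma hasd_id z : hasd (fun w => w) z 1.
Proof.
  exists (fun _ => RtoC 1); split; [apply Ccont_const|split; [reflexivity|]].
  exists 1; split; [lra|]; intros; ring.
Qed.

Lemma hasd_plus f g z l m : hasd f z l -> hasd g z m -> hasd (fun w => f w + g w)%C z (l + m).
Proof.
  intros [p [Hp [<- E]]] [q [Hq [<- F]]].
  exists (fun w => p w + q w)%C; split; [now apply Ccont_plus|split; [reflexivity|]].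
  eapply near_imp; [|exact (near_and _ _ _ E F)]. cbv beta; intros w [-> ->]; ring.
Qed.

Lemma hasd_mult f g z l m : hasd f z l -> hasd g z m ->
  hasd (fun w => f w * g w)%C z (l * g z + f z * m).
Proof.
  intros Hf Hg; pose proof (hasd_cont _ _ _ Hg) as Cg. revert Hf Hg.
  intros [p [Hp [<- E]]] [q [Hq [<- F]]].
  exists (fun w => p w * g w + f z * q w)%C; split.
  { apply Ccont_plus; apply Ccont_mult; auto using Ccont_const. }
  split; [reflexivity|].
  eapply near_imp; [|exact (near_and _ _ _ E F)]. cbv beta; intros w [-> ->]; ring.
Qed.

Lemma hasd_inv f z l : hasd f z l -> f z <> 0 -> hasd (fun w => / f w)%C z (- l / (f z * f z)).
Proof.
  intros Hf H; pose proof (hasd_cont _ _ _ Hf) as Cf. destruct Hf as [q [Hq [<- E]]].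
  exists (fun w => - q w / (f w * f z))%C; split.
  { apply Ccont_div; [now apply Ccont_opp| | now apply Cmult_neq_0].
    apply Ccont_mult; [exact Cf | apply Ccont_const]. }
  split; [reflexivity|].
  eapply near_imp; [|exact (near_and _ _ _ (Ccont_near_ne _ _ _ Cf H) E)]. cbv beta; intros w [N K].
  assert (q w * (w - z) = f w - f z)%C as X by (rewrite K; ring).
  replace (/ f z + - q w / (f w * f z) * (w - z))%C
    with (/ f z + - (q w * (w - z)) / (f w * f z))%C by (field; auto).
  rewrite X. field; auto.
Qed.

Lemma hasd_comp f g z l m : hasd g z m -> hasd f (g z) l -> hasd (fun w => f (g w)) z (l * m).
Proof.
  intros Hg Hf; pose proof (hasd_cont _ _ _ Hg) as Cg. revert Hg Hf.
  intros [q [Hq [<- F]]] [p [Hp [<- [d [Hd E]]]]].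
  exists (fun w => p (g w) * q w)%C; split.
  { apply Ccont_mult; [now apply Ccont_comp|exact Hq]. }
  split; [reflexivity|].
  eapply near_imp; [|exact (near_and _ _ _ F (Cg d Hd))]. cbv beta; intros w [A B].
  rewrite (E _ B). replace (g w - g z)%C with (q w * (w - z))%C by (rewrite A; ring). ring.
Qed.

Lemma hasd_eq f z l m : l = m -> hasd f z l -> hasd f z m.
Proof. now intros ->. Qed.

Lemma holo_const c z : holo (fun _ => c) z.
Proof. exact (hasd_holo _ _ _ (hasd_const c z)). Qed.
Lemma holo_id z : holo (fun w => w) z.
Proof. exact (hasd_holo _ _ _ (hasd_id z)). Qed.
Lemma holo_plus f g z : holo f z -> holo g z -> holo (fun w => f w + g w)%C z.
Proof. intros [l H] [m K]; exact (hasd_holo _ _ _ (hasd_plus _ _ _ _ _ H K)). Qed.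
Lemma holo_mult f g z : holo f z -> holo g z -> holo (fun w => f w * g w)%C z.
Proof. intros [l H] [m K]; exact (hasd_holo _ _ _ (hasd_mult _ _ _ _ _ H K)). Qed.
Lemma holo_inv f z : holo f z -> f z <> 0 -> holo (fun w => / f w)%C z.
Proof. intros [l H] K; exact (hasd_holo _ _ _ (hasd_inv _ _ _ H K)). Qed.
Lemma holo_comp f g z : holo g z -> holo f (g z) -> holo (fun w => f (g w)) z.
Proof. intros [l H] [m K]; exact (hasd_holo _ _ _ (hasd_comp _ _ _ _ _ H K)). Qed.
Lemma holo_opp f z : holo f z -> holo (fun w => - f w)%C z.
Proof.
  intros H. apply (holo_ext (fun w => (- (1)) * f w)%C).
  { exists 1; split; [lra|]; intros; ring. }
  apply holo_mult; [apply holo_const | exact H].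
Qed.
Lemma holo_minus f g z : holo f z -> holo g z -> holo (fun w => f w - g w)%C z.
Proof. intros; apply holo_plus; [|apply holo_opp]; assumption. Qed.
Lemma holo_div f g z : holo f z -> holo g z -> g z <> 0 -> holo (fun w => f w / g w)%C z.
Proof. intros; apply holo_mult; [|apply holo_inv]; assumption. Qed.
Lemma holo_pow f z n : holo f z -> holo (fun w => f w ^ n)%C z.
Proof.
  intros H; induction n as [|n IH]; [exact (holo_const 1 z)|].
  apply (holo_ext (fun w => f w * f w ^ n)%C); [|now apply holo_mult].
  exists 1; split; [lra|]; intros; now rewrite Cpow_S.
Qed.

(** The function [q] demanded by [hasd] is the difference quotient, completed at [z] by [l]. *)
Lemma hasd_eps f z l :
  (forall eps, 0 < eps -> near z (fun w => Cmod (f w - f z - l * (w - z)) <= eps * Cmod (w - z))) ->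
  hasd f z l.
Proof.
  intros H. set (q := fun w => if excluded_middle_informative (w = z) then l
                      else ((f w - f z) / (w - z))%C).
  assert (Ez : q z = l) by (unfold q; destruct (excluded_middle_informative (z = z)); tauto).
  assert (Eq : forall w, w <> z -> q w = ((f w - f z) / (w - z))%C)
    by (intros w Hw; unfold q; destruct (excluded_middle_informative (w = z)); tauto).
  exists q; split; [|split; [exact Ez|]].
  - intros eps He. eapply near_imp; [|exact (H (eps/2) ltac:(lra))]. cbv beta; intros w Hw.
    rewrite Ez. destruct (classic (w = z)) as [->|N].
    { rewrite Ez Cmod_minus_diag. exact He. }
    rewrite (Eq _ N). assert (M : (w - z <> 0)%C)
      by (intros X; apply N; replace w with (w - z + z)%C by ring; rewrite X; ring).
    replace ((f w - f z) / (w - z) - l)%C with ((f w - f z - l * (w - z)) / (w - z))%C by (field; auto).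
    rewrite Cmod_div //. apply Cmod_gt_0 in M.
    apply Rle_lt_trans with (eps/2); [|lra].
    apply (Rmult_le_reg_r (Cmod (w - z))); [exact M|].
    unfold Rdiv at 1. rewrite Rmult_assoc Rinv_l; lra.
  - exists 1; split; [lra|]. intros w _. destruct (classic (w = z)) as [->|N]; [ring|].
    rewrite (Eq _ N). field. intros X; apply N; replace w with (w - z + z)%C by ring; rewrite X; ring.
Qed.

Lemma hasd_eps_inv f z l : hasd f z l ->
  forall eps, 0 < eps -> near z (fun w => Cmod (f w - f z - l * (w - z)) <= eps * Cmod (w - z)).
Proof.
  intros [q [Hq [<- E]]] eps He.
  eapply near_imp; [|exact (near_and _ _ _ E (Hq eps He))]. cbv beta; intros w [-> B].
  replace (f z + q w * (w - z) - f z - q z * (w - z))%C with ((q w - q z) * (w - z))%C by ring.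
  rewrite Cmod_mult. apply Rmult_le_compat_r; [apply Cmod_ge_0|lra].
Qed.

Lemma entire_holo f : entire f -> forall z, holo f z.
Proof.
  intros H z. destruct (H z) as [l [_ Hl]]. exists l. apply hasd_eps.
  intros eps He. specialize (Hl z (fun P HP => HP) (mkposreal eps He)).
  destruct Hl as [d Hd]. exists d; split; [apply cond_pos|]. intros w Hw.
  specialize (Hd w Hw). replace (f w - f z - l * (w - z))%C with (minus (minus (f w) (f z)) (scal (minus w z) l)).
  2:{ unfold minus, scal, plus, opp; simpl. unfold mult; simpl. ring. }
  exact Hd.
Qed.

Lemma Ccont_unique f g a : Ccont f a -> Ccont g a ->
  near a (fun w => w <> a -> f w = g w) -> f a = g a.
Proof.
  intros Hf Hg E. apply NNPP; intros N.
  assert (Hh : Ccont (fun w => f w - g w)%C a) by now apply Ccont_minus.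
  assert (Hn : (f a - g a <> 0)%C).
  { intros X; apply N. replace (f a) with (f a - g a + g a)%C by ring. rewrite X; ring. }
  destruct (near_and _ _ _ E (Ccont_near_ne _ _ 0 Hh Hn)) as [d [Hd K]].
  assert (B : Cmod (a + RtoC (d/2) - a) < d).
  { replace (a + RtoC (d/2) - a)%C with (RtoC (d/2)) by ring. rewrite Cmod_R Rabs_pos_eq; lra. }
  destruct (K _ B) as [K1 K2]. apply K2. rewrite K1; [ring|].
  intros X. assert (Y : RtoC (d/2) = 0).
  { replace (RtoC (d/2)) with (a + RtoC (d/2) - a)%C by ring. rewrite X; ring. }
  apply RtoC_inj in Y. lra.
Qed.

(** Each point [a] brings its own extension [G a], compared with [f] only off [a]; the glued value
    at [z] is [G z z]. Two such extensions agree on a punctured disc, hence by continuity also at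
    its centre. The last conclusion recovers [f] itself wherever it was continuous. *)
Lemma holo_glue (f : C -> C) :
  (forall a, exists g, near a (holo g) /\ near a (fun w => w <> a -> g w = f w)) ->
  exists F, (forall z, holo F z) /\ (forall z, near z (fun w => w <> z -> F w = f w)) /\
    forall z, Ccont f z -> F z = f z.
Proof.
  intros H.
  set (G := fun a => proj1_sig (constructive_indefinite_description _ (H a))).
  assert (HG : forall a, near a (holo (G a)) /\ near a (fun w => w <> a -> G a w = f w))
    by (intros a; unfold G; destruct (constructive_indefinite_description _ (H a)); auto).
  set (F := fun z => G z z).
  assert (E : forall a, near a (fun w => F w = G a w)).
  { intros a. destruct (HG a) as [A B].
    eapply near_imp; [|exact (near_and _ _ _ (near_near _ _ A) (near_near _ _ B))].
    cbv beta; intros w [A1 B1]. destruct (classic (w = a)) as [->|N]; [reflexivity|].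
    destruct (HG w) as [A2 B2]. unfold F. apply Ccont_unique.
    - apply holo_cont. exact (near_self _ _ A2).
    - apply holo_cont. exact (near_self _ _ A1).
    - eapply near_imp; [|exact (near_and _ _ _ (near_ne _ _ N) (near_and _ _ _ B1 B2))].
      cbv beta; intros v [V1 [V2 V3]] V4. rewrite (V3 V4). symmetry; auto. }
  exists F; split; [|split].
  - intros z. destruct (HG z) as [A B]. apply (holo_ext (G z)).
    { eapply near_imp; [|exact (E z)]; auto. }
    exact (near_self _ _ A).
  - intros z. destruct (HG z) as [A B].
    eapply near_imp; [|exact (near_and _ _ _ (E z) B)]. cbv beta; intros w [-> K]; auto.
  - intros z Hf. destruct (HG z) as [A B]. unfold F. apply Ccont_unique; auto.
    apply holo_cont. exact (near_self _ _ A).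
Qed.

(** * Contour integrals over rectangles *)

Definition pcont (g : R -> C) (t : R) : Prop :=
  forall eps, 0 < eps -> exists d, 0 < d /\ forall s, Rabs (s - t) < d -> Cmod (g s - g t) < eps.

Definition pcont_on (g : R -> C) (a b : R) : Prop :=
  forall t, Rmin a b <= t <= Rmax a b -> pcont g t.

Definition CInt (g : R -> C) (a b : R) : C :=
  (RInt (fun t => fst (g t)) a b, RInt (fun t => snd (g t)) a b).

Definition exC (g : R -> C) (a b : R) : Prop :=
  ex_RInt (fun t => fst (g t)) a b /\ ex_RInt (fun t => snd (g t)) a b.

Lemma fst_le_Cmod (z : C) : Rabs (fst z) <= Cmod z.
Proof. exact (Rle_trans _ _ _ (Rmax_l _ _) (Rmax_Cmod z)). Qed.
Lemma snd_le_Cmod (z : C) : Rabs (snd z) <= Cmod z.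
Proof. exact (Rle_trans _ _ _ (Rmax_r _ _) (Rmax_Cmod z)). Qed.

Lemma Cmod_le_abs (z : C) : Cmod z <= Rabs (fst z) + Rabs (snd z).
Proof.
  unfold Cmod. apply Rsqr_incr_0_var.
  - rewrite Rsqr_sqrt; [|nra]. unfold Rsqr.
    pose proof (Rabs_pos (fst z)); pose proof (Rabs_pos (snd z)).
    rewrite -(pow2_abs (fst z)) -(pow2_abs (snd z)). nra.
  - pose proof (Rabs_pos (fst z)); pose proof (Rabs_pos (snd z)); lra.
Qed.

Lemma pcont_fst g t : pcont g t -> continuous (fun t => fst (g t)) t.
Proof.
  intros H P [eps HP]. destruct (H eps (cond_pos eps)) as [d [Hd K]].
  exists (mkposreal d Hd). intros s Hs. apply HP.
  apply (Rle_lt_trans _ (Cmod (g s - g t))); [exact (fst_le_Cmod (g s - g t)) | now apply K].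
Qed.

Lemma pcont_snd g t : pcont g t -> continuous (fun t => snd (g t)) t.
Proof.
  intros H P [eps HP]. destruct (H eps (cond_pos eps)) as [d [Hd K]].
  exists (mkposreal d Hd). intros s Hs. apply HP.
  apply (Rle_lt_trans _ (Cmod (g s - g t))); [exact (snd_le_Cmod (g s - g t)) | now apply K].
Qed.

Lemma pcont_comp f g t : pcont g t -> Ccont f (g t) -> pcont (fun s => f (g s)) t.
Proof.
  intros Hg Hf eps He. destruct (Hf eps He) as [d [Hd K]].
  destruct (Hg d Hd) as [e [He' L]]. exists e; split; auto.
Qed.

Lemma pcont_h y t : pcont (fun x => (x, y)) t.
Proof.
  intros eps He; exists eps; split; auto. intros s Hs.
  apply (Rle_lt_trans _ _ _ (Cmod_le_abs _)). simpl.
  replace (y + - y) with 0 by ring. rewrite Rabs_R0. unfold Rminus in Hs; lra.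
Qed.

Lemma pcont_v x t : pcont (fun y => (x, y)) t.
Proof.
  intros eps He; exists eps; split; auto. intros s Hs.
  apply (Rle_lt_trans _ _ _ (Cmod_le_abs _)). simpl.
  replace (x + - x) with 0 by ring. rewrite Rabs_R0. unfold Rminus in Hs; lra.
Qed.

Lemma pcont_exC g a b : pcont_on g a b -> exC g a b.
Proof.
  intros H; split; apply (ex_RInt_continuous (V := R_CompleteNormedModule));
   intros t Ht; [apply pcont_fst | apply pcont_snd]; auto.
Qed.

Lemma CInt_ext f g a b : (forall t, Rmin a b < t < Rmax a b -> f t = g t) -> CInt f a b = CInt g a b.
Proof.
  intros H. unfold CInt. f_equal; apply RInt_ext; intros t Ht; now rewrite H.
Qed.

Lemma CInt_plus f g a b : exC f a b -> exC g a b ->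
  CInt (fun t => f t + g t)%C a b = (CInt f a b + CInt g a b)%C.
Proof.
  intros [A B] [A' B']. unfold CInt, Cplus; simpl. f_equal.
  - exact (RInt_plus (fun t => fst (f t)) (fun t => fst (g t)) a b A A').
  - exact (RInt_plus (fun t => snd (f t)) (fun t => snd (g t)) a b B B').
Qed.

Lemma exC_scal c f a b : exC f a b -> exC (fun t => c * f t)%C a b.
Proof.
  intros [A B]. split; simpl.
  - exact (ex_RInt_minus _ _ _ _ (ex_RInt_scal _ _ _ (fst c) A) (ex_RInt_scal _ _ _ (snd c) B)).
  - exact (ex_RInt_plus _ _ _ _ (ex_RInt_scal _ _ _ (fst c) B) (ex_RInt_scal _ _ _ (snd c) A)).
Qed.

Lemma CInt_scal c f a b : exC f a b -> CInt (fun t => c * f t)%C a b = (c * CInt f a b)%C.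
Proof.
  intros [A B]. unfold CInt, Cmult; simpl. f_equal.
  - etransitivity; [exact (RInt_minus _ _ _ _ (ex_RInt_scal _ _ _ (fst c) A) (ex_RInt_scal _ _ _ (snd c) B))|].
    rewrite (RInt_scal (V := R_CompleteNormedModule) _ _ _ _ A)
            (RInt_scal (V := R_CompleteNormedModule) _ _ _ _ B). reflexivity.
  - etransitivity; [exact (RInt_plus _ _ _ _ (ex_RInt_scal _ _ _ (fst c) B) (ex_RInt_scal _ _ _ (snd c) A))|].
    rewrite (RInt_scal (V := R_CompleteNormedModule) _ _ _ _ A)
            (RInt_scal (V := R_CompleteNormedModule) _ _ _ _ B). reflexivity.
Qed.

Lemma CInt_minus f g a b : exC f a b -> exC g a b ->
  CInt (fun t => f t - g t)%C a b = (CInt f a b - CInt g a b)%C.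
Proof.
  intros Hf Hg.
  rewrite (CInt_ext _ (fun t => f t + (-(1)) * g t)%C); [|intros; ring].
  rewrite CInt_plus //; [|now apply exC_scal]. rewrite CInt_scal //. ring.
Qed.

Lemma CInt_swap f a b : exC f b a -> CInt f a b = (- CInt f b a)%C.
Proof.
  intros [A B]. unfold CInt, Copp; simpl. f_equal; symmetry.
  - exact (opp_RInt_swap _ _ _ A).
  - exact (opp_RInt_swap _ _ _ B).
Qed.

Lemma exC_swap f a b : exC f a b -> exC f b a.
Proof. intros [A B]; split; now apply ex_RInt_swap. Qed.

Lemma CInt_Chasles f a b c : exC f a b -> exC f b c -> (CInt f a b + CInt f b c)%C = CInt f a c.
Proof.
  intros [A B] [A' B']. unfold CInt, Cplus; simpl. f_equal.
  - exact (RInt_Chasles _ _ _ _ A A').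
  - exact (RInt_Chasles _ _ _ _ B B').
Qed.

(** The factor 2 comes from estimating real and imaginary parts separately. It is harmless, since
    the later estimates all have a free parameter. *)
Lemma CInt_bound f a b M : exC f a b ->
  (forall t, Rmin a b <= t <= Rmax a b -> Cmod (f t) <= M) ->
  Cmod (CInt f a b) <= 2 * M * Rabs (b - a).
Proof.
  assert (X : forall a b, a <= b -> exC f a b ->
    (forall t, a <= t <= b -> Cmod (f t) <= M) -> Cmod (CInt f a b) <= 2 * M * Rabs (b - a)).
  { clear a b. intros a b Hab [A B] H. rewrite Rabs_pos_eq; [|lra].
    apply (Rle_trans _ _ _ (Cmod_le_abs _)). simpl.
    pose proof (abs_RInt_le_const _ a b M Hab A) as P1.
    pose proof (abs_RInt_le_const _ a b M Hab B) as P2.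
    assert (Q1 := P1 (fun t Ht => Rle_trans _ _ _ (fst_le_Cmod _) (H t Ht))).
    assert (Q2 := P2 (fun t Ht => Rle_trans _ _ _ (snd_le_Cmod _) (H t Ht))).
    lra. }
  intros E H. destruct (Rle_dec a b) as [L|L].
  - rewrite Rmin_left in H; [|lra]. rewrite Rmax_right in H; [|lra]. now apply X.
  - rewrite Rmin_right in H; [|lra]. rewrite Rmax_left in H; [|lra].
    apply exC_swap in E.
    rewrite CInt_swap // Cmod_opp Rabs_minus_sym. apply X; [lra|exact E|exact H].
Qed.

Lemma CInt_FTC (F l : R -> C) a b :
  (forall t, Rmin a b <= t <= Rmax a b -> forall eps, 0 < eps ->
     exists d, 0 < d /\ forall s, Rabs (s - t) < d ->
       Cmod (F s - F t - l t * RtoC (s - t)) <= eps * Rabs (s - t)) ->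
  pcont_on l a b -> CInt l a b = (F b - F a)%C.
Proof.
  intros HF Hl. unfold CInt, Cminus, Cplus, Copp; simpl.
  f_equal; apply is_RInt_unique.
  - apply (is_RInt_derive (V := R_CompleteNormedModule) (fun t => fst (F t))).
    + intros t Ht. split; [apply (is_linear_scal_l (K := R_AbsRing))|].
      intros x Hx eps. apply (is_filter_lim_locally_unique (K := R_AbsRing) (V := R_NormedModule)) in Hx. rewrite -Hx.
      destruct (HF t Ht eps (cond_pos eps)) as [d [Hd K]].
      exists (mkposreal d Hd). intros s Hs. specialize (K s Hs).
      apply (Rle_trans _ _ _ (fst_le_Cmod _)) in K. 
      match goal with |- ?A <= ?B => replace A with (Rabs (fst (F s - F t - l t * RtoC (s - t))%C)) end; [exact K|].
      simpl. unfold norm, minus, plus, opp, scal; simpl. unfold abs, mult; simpl.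
      f_equal. unfold mult; simpl. ring.
    + intros t Ht; now apply pcont_fst, Hl.
  - apply (is_RInt_derive (V := R_CompleteNormedModule) (fun t => snd (F t))).
    + intros t Ht. split; [apply (is_linear_scal_l (K := R_AbsRing))|].
      intros x Hx eps. apply (is_filter_lim_locally_unique (K := R_AbsRing) (V := R_NormedModule)) in Hx. rewrite -Hx.
      destruct (HF t Ht eps (cond_pos eps)) as [d [Hd K]].
      exists (mkposreal d Hd). intros s Hs. specialize (K s Hs).
      apply (Rle_trans _ _ _ (snd_le_Cmod _)) in K. 
      match goal with |- ?A <= ?B => replace A with (Rabs (snd (F s - F t - l t * RtoC (s - t))%C)) end; [exact K|].
      simpl. unfold norm, minus, plus, opp, scal; simpl. unfold abs, mult; simpl.
      f_equal. unfold mult; simpl. ring.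
    + intros t Ht; now apply pcont_snd, Hl.
Qed.

Lemma CInt_FTC_h P f y a b :
  (forall t, Rmin a b <= t <= Rmax a b -> hasd P (t, y) (f (t, y))) ->
  (forall t, Rmin a b <= t <= Rmax a b -> Ccont f (t, y)) ->
  CInt (fun t => f (t, y)) a b = (P (b, y) - P (a, y))%C.
Proof.
  intros HP Hf. apply (CInt_FTC (fun t => P (t, y))).
  - intros t Ht eps He. destruct (hasd_eps_inv _ _ _ (HP t Ht) eps He) as [d [Hd K]].
    exists d; split; [exact Hd|]. intros s Hs.
    assert (E : ((s, y) - (t, y))%C = RtoC (s - t))
      by (unfold Cminus, Cplus, Copp, RtoC; simpl; f_equal; ring).
    specialize (K (s, y)). rewrite E Cmod_R in K. now apply K.
  - intros t Ht. apply (pcont_comp f (fun t => (t, y))); [apply pcont_h | now apply Hf].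
Qed.

Lemma CInt_FTC_v P f x a b :
  (forall t, Rmin a b <= t <= Rmax a b -> hasd P (x, t) (f (x, t))) ->
  (forall t, Rmin a b <= t <= Rmax a b -> Ccont f (x, t)) ->
  (Ci * CInt (fun t => f (x, t)) a b)%C = (P (x, b) - P (x, a))%C.
Proof.
  intros HP Hf.
  assert (Hc : pcont_on (fun t => f (x, t)) a b).
  { intros t Ht. apply (pcont_comp f (fun t => (x, t))); [apply pcont_v | now apply Hf]. }
  rewrite -CInt_scal; [|now apply pcont_exC].
  apply (CInt_FTC (fun t => P (x, t))).
  - intros t Ht eps He. destruct (hasd_eps_inv _ _ _ (HP t Ht) eps He) as [d [Hd K]].
    exists d; split; [exact Hd|]. intros s Hs.
    assert (E : ((x, s) - (x, t))%C = (Ci * RtoC (s - t))%C)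
      by (unfold Cminus, Cplus, Copp, RtoC, Cmult; simpl; f_equal; ring).
    specialize (K (x, s)). rewrite E Cmod_mult Cmod_R in K.
    replace (Cmod Ci) with 1 in K.
    2:{ unfold Cmod; simpl. replace (0 * (0 * 1) + 1 * (1 * 1)) with 1 by ring. now rewrite sqrt_1. }
    rewrite Rmult_1_l in K.
    replace (Ci * f (x, t) * RtoC (s - t))%C with (f (x, t) * (Ci * RtoC (s - t)))%C by ring.
    now apply K.
  - intros t Ht. apply (pcont_comp (fun w => Ci * w)%C); [now apply Hc|].
    apply Ccont_mult; [apply Ccont_const | apply Ccont_id].
Qed.

(** The counterclockwise contour integral over the boundary of a rectangle; the factor [Ci] is
    [dz = i dt] on the vertical sides. *)
Definition rectint (f : C -> C) (x0 x1 y0 y1 : R) : C :=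
  (CInt (fun t => f (t, y0)) x0 x1 + Ci * CInt (fun t => f (x1, t)) y0 y1
   - CInt (fun t => f (t, y1)) x0 x1 - Ci * CInt (fun t => f (x0, t)) y0 y1)%C.

Definition inrect (x0 x1 y0 y1 : R) (z : C) : Prop :=
  x0 <= fst z <= x1 /\ y0 <= snd z <= y1.

Definition bdrect (x0 x1 y0 y1 : R) (z : C) : Prop :=
  inrect x0 x1 y0 y1 z /\ (fst z = x0 \/ fst z = x1 \/ snd z = y0 \/ snd z = y1).

Definition inside (x0 x1 y0 y1 : R) (z : C) : Prop :=
  x0 < fst z < x1 /\ y0 < snd z < y1.

Lemma exC_h f y a b : a <= b -> (forall t, a <= t <= b -> Ccont f (t, y)) -> exC (fun t => f (t, y)) a b.
Proof.
  intros Hab H. apply pcont_exC. intros t Ht. rewrite Rmin_left in Ht; [|lra].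
  rewrite Rmax_right in Ht; [|lra].
  apply (pcont_comp f (fun t => (t, y))); [apply pcont_h | now apply H].
Qed.

Lemma exC_v f x a b : a <= b -> (forall t, a <= t <= b -> Ccont f (x, t)) -> exC (fun t => f (x, t)) a b.
Proof.
  intros Hab H. apply pcont_exC. intros t Ht. rewrite Rmin_left in Ht; [|lra].
  rewrite Rmax_right in Ht; [|lra].
  apply (pcont_comp f (fun t => (x, t))); [apply pcont_v | now apply H].
Qed.

Ltac bd := split; [split; simpl; lra | simpl; lra].

Section Boundary.
Variables (x0 x1 y0 y1 : R).
Hypotheses (Hx : x0 <= x1) (Hy : y0 <= y1).

Lemma bd_exC f : (forall z, bdrect x0 x1 y0 y1 z -> Ccont f z) ->
  exC (fun t => f (t, y0)) x0 x1 /\ exC (fun t => f (x1, t)) y0 y1 /\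
  exC (fun t => f (t, y1)) x0 x1 /\ exC (fun t => f (x0, t)) y0 y1.
Proof.
  intros H. split; [|split; [|split]];
   [apply (exC_h f y0) | apply (exC_v f x1) | apply (exC_h f y1) | apply (exC_v f x0)];
   auto; intros t Ht; apply H; bd.
Qed.

Lemma rectint_ext f g : (forall z, bdrect x0 x1 y0 y1 z -> f z = g z) ->
  rectint f x0 x1 y0 y1 = rectint g x0 x1 y0 y1.
Proof.
  intros H. unfold rectint.
  rewrite (CInt_ext (fun t => f (t, y0)) (fun t => g (t, y0)));
    [|rewrite Rmin_left // Rmax_right //; intros t Ht; apply H; bd].
  rewrite (CInt_ext (fun t => f (t, y1)) (fun t => g (t, y1)));
    [|rewrite Rmin_left // Rmax_right //; intros t Ht; apply H; bd].
  rewrite (CInt_ext (fun t => f (x1, t)) (fun t => g (x1, t)));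
    [|rewrite Rmin_left // Rmax_right //; intros t Ht; apply H; bd].
  rewrite (CInt_ext (fun t => f (x0, t)) (fun t => g (x0, t))) //.
  rewrite Rmin_left // Rmax_right //; intros t Ht; apply H; bd.
Qed.

Lemma rectint_scal c f : (forall z, bdrect x0 x1 y0 y1 z -> Ccont f z) ->
  rectint (fun z => c * f z)%C x0 x1 y0 y1 = (c * rectint f x0 x1 y0 y1)%C.
Proof.
  intros Hf. destruct (bd_exC f Hf) as [A [B [D E]]].
  unfold rectint. rewrite !CInt_scal //. ring.
Qed.

Lemma rectint_minus f g : (forall z, bdrect x0 x1 y0 y1 z -> Ccont f z) ->
  (forall z, bdrect x0 x1 y0 y1 z -> Ccont g z) ->
  rectint (fun z => f z - g z)%C x0 x1 y0 y1 = (rectint f x0 x1 y0 y1 - rectint g x0 x1 y0 y1)%C.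
Proof.
  intros Hf Hg. destruct (bd_exC f Hf) as [A [B [D E]]]. destruct (bd_exC g Hg) as [A' [B' [D' E']]].
  unfold rectint. rewrite !CInt_minus //. ring.
Qed.

Lemma rectint_bound f M : (forall z, bdrect x0 x1 y0 y1 z -> Ccont f z) ->
  (forall z, bdrect x0 x1 y0 y1 z -> Cmod (f z) <= M) ->
  Cmod (rectint f x0 x1 y0 y1) <= 4 * M * (x1 - x0 + (y1 - y0)).
Proof.
  intros Hf HM. destruct (bd_exC f Hf) as [A [B [D E]]]. unfold rectint.
  assert (HI : Cmod Ci = 1).
  { unfold Cmod; simpl. replace (0 * (0 * 1) + 1 * (1 * 1)) with 1 by ring. now rewrite sqrt_1. }
  assert (K1 : forall y, (y = y0 \/ y = y1) -> exC (fun t => f (t, y)) x0 x1 ->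
     Cmod (CInt (fun t => f (t, y)) x0 x1) <= 2 * M * (x1 - x0)).
  { intros y Hyy He. rewrite -(Rabs_pos_eq (x1 - x0)); [|lra]. apply CInt_bound; [exact He|].
    rewrite Rmin_left // Rmax_right //. intros t Ht. apply HM. bd. }
  assert (K2 : forall x, (x = x0 \/ x = x1) -> exC (fun t => f (x, t)) y0 y1 ->
     Cmod (CInt (fun t => f (x, t)) y0 y1) <= 2 * M * (y1 - y0)).
  { intros x Hxx He. rewrite -(Rabs_pos_eq (y1 - y0)); [|lra]. apply CInt_bound; [exact He|].
    rewrite Rmin_left // Rmax_right //. intros t Ht. apply HM. bd. }
  pose proof (K1 y0 ltac:(auto) A). pose proof (K1 y1 ltac:(auto) D).
  pose proof (K2 x1 ltac:(auto) B). pose proof (K2 x0 ltac:(auto) E).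
  assert (T : forall p q r v : C, Cmod (p + Ci * q - r - Ci * v) <= Cmod p + Cmod q + Cmod r + Cmod v).
  { intros p q r v. unfold Cminus.
    pose proof (Cmod_triangle (p + Ci * q + - r) (- (Ci * v))) as T1.
    pose proof (Cmod_triangle (p + Ci * q) (- r)) as T2.
    pose proof (Cmod_triangle p (Ci * q)) as T3.
    rewrite !Cmod_opp ?Cmod_mult ?HI in T1, T2, T3. lra. }
  eapply Rle_trans; [apply T|].
  lra.
Qed.

End Boundary.

Lemma rectint_cut_x f x0 c x1 y0 y1 :
  exC (fun t => f (t, y0)) x0 c -> exC (fun t => f (t, y0)) c x1 ->
  exC (fun t => f (t, y1)) x0 c -> exC (fun t => f (t, y1)) c x1 ->
  rectint f x0 x1 y0 y1 = (rectint f x0 c y0 y1 + rectint f c x1 y0 y1)%C.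
Proof.
  intros A B D E. unfold rectint. rewrite -(CInt_Chasles _ _ _ _ A B) -(CInt_Chasles _ _ _ _ D E). ring.
Qed.

Lemma rectint_cut_y f x0 x1 y0 c y1 :
  exC (fun t => f (x0, t)) y0 c -> exC (fun t => f (x0, t)) c y1 ->
  exC (fun t => f (x1, t)) y0 c -> exC (fun t => f (x1, t)) c y1 ->
  rectint f x0 x1 y0 y1 = (rectint f x0 x1 y0 c + rectint f x0 x1 c y1)%C.
Proof.
  intros A B D E. unfold rectint. rewrite -(CInt_Chasles _ _ _ _ A B) -(CInt_Chasles _ _ _ _ D E). ring.
Qed.

Lemma rectint_primitive P f x0 x1 y0 y1 : x0 <= x1 -> y0 <= y1 ->
  (forall z, inrect x0 x1 y0 y1 z -> hasd P z (f z)) ->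
  (forall z, inrect x0 x1 y0 y1 z -> Ccont f z) -> rectint f x0 x1 y0 y1 = 0.
Proof.
  intros Hx Hy HP Hf. unfold rectint.
  rewrite (CInt_FTC_h P); [|intros t; rewrite Rmin_left // Rmax_right // => Ht; apply HP; split; simpl; lra
    |intros t; rewrite Rmin_left // Rmax_right // => Ht; apply Hf; split; simpl; lra].
  rewrite (CInt_FTC_h P); [|intros t; rewrite Rmin_left // Rmax_right // => Ht; apply HP; split; simpl; lra
    |intros t; rewrite Rmin_left // Rmax_right // => Ht; apply Hf; split; simpl; lra].
  rewrite (CInt_FTC_v P); [|intros t; rewrite Rmin_left // Rmax_right // => Ht; apply HP; split; simpl; lra
    |intros t; rewrite Rmin_left // Rmax_right // => Ht; apply Hf; split; simpl; lra].
  rewrite (CInt_FTC_v P); [|intros t; rewrite Rmin_left // Rmax_right // => Ht; apply HP; split; simpl; lra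
    |intros t; rewrite Rmin_left // Rmax_right // => Ht; apply Hf; split; simpl; lra].
  ring.
Qed.

(** Lets [goursat] subtract the tangent of [f] at the limit point at no cost. *)
Lemma rectint_affine a b p x0 x1 y0 y1 : x0 <= x1 -> y0 <= y1 ->
  rectint (fun w => a + b * (w - p))%C x0 x1 y0 y1 = 0.
Proof.
  intros Hx Hy. apply (rectint_primitive (fun w => a * w + (b * / 2) * ((w - p) * (w - p)))%C); auto.
  - intros z _. eapply hasd_eq.
    2:{ apply hasd_plus; apply hasd_mult; [apply hasd_const|apply hasd_id|apply hasd_const|].
        apply hasd_mult; apply (hasd_plus _ (fun _ => - p)%C); (apply hasd_id || apply hasd_const). }
    cbv beta. field.
  - intros z _. apply Ccont_plus; [apply Ccont_const|]. apply Ccont_mult; [apply Ccont_const|].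
    apply Ccont_minus; [apply Ccont_id|apply Ccont_const].
Qed.

(** Choosing by [Rle_dec] makes the bisection an ordinary recursive function. The last quarter needs
    no test: if the first three fail, the triangle inequality forces it. *)
Definition quarter (f : C -> C) (r : (R * R) * (R * R)) : (R * R) * (R * R) :=
  let '((x0, x1), (y0, y1)) := r in
  let xm := (x0 + x1) / 2 in let ym := (y0 + y1) / 2 in
  let ok := fun a b c d => Rle_dec (Cmod (rectint f x0 x1 y0 y1)) (4 * Cmod (rectint f a b c d)) in
  if ok x0 xm y0 ym then ((x0, xm), (y0, ym)) else
  if ok x0 xm ym y1 then ((x0, xm), (ym, y1)) else
  if ok xm x1 y0 ym then ((xm, x1), (y0, ym)) else ((xm, x1), (ym, y1)).

Lemma quarter_spec f x0 x1 y0 y1 : x0 <= x1 -> y0 <= y1 ->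
  (forall z, inrect x0 x1 y0 y1 z -> Ccont f z) ->
  exists u0 u1 v0 v1, quarter f ((x0, x1), (y0, y1)) = ((u0, u1), (v0, v1)) /\
    x0 <= u0 <= u1 /\ u1 <= x1 /\ y0 <= v0 <= v1 /\ v1 <= y1 /\
    u1 - u0 = (x1 - x0) / 2 /\ v1 - v0 = (y1 - y0) / 2 /\
    Cmod (rectint f x0 x1 y0 y1) <= 4 * Cmod (rectint f u0 u1 v0 v1).
Proof.
  intros Hx Hy Hf. set (xm := (x0 + x1) / 2). set (ym := (y0 + y1) / 2).
  assert (X : x0 <= xm <= x1) by (unfold xm; lra). assert (Y : y0 <= ym <= y1) by (unfold ym; lra).
  assert (S : rectint f x0 x1 y0 y1 = ((rectint f x0 xm y0 ym + rectint f x0 xm ym y1)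
      + (rectint f xm x1 y0 ym + rectint f xm x1 ym y1))%C).
  { rewrite (rectint_cut_x f x0 xm x1);
      try (apply exC_h; [lra|]; intros t Ht; apply Hf; split; simpl; lra).
    f_equal; apply rectint_cut_y; apply exC_v; try lra; intros t Ht; apply Hf; split; simpl; lra. }
  unfold quarter. fold xm ym.
  destruct (Rle_dec _ _) as [L1|L1].
  { exists x0, xm, y0, ym; repeat split; try lra; unfold xm, ym; lra. }
  destruct (Rle_dec _ _) as [L2|L2].
  { exists x0, xm, ym, y1; repeat split; try lra; unfold xm, ym; lra. }
  destruct (Rle_dec _ _) as [L3|L3].
  { exists xm, x1, y0, ym; repeat split; try lra; unfold xm, ym; lra. }
  exists xm, x1, ym, y1; repeat split; try (unfold xm, ym; lra).
  pose proof (Cmod_triangle (rectint f x0 xm y0 ym + rectint f x0 xm ym y1)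
    (rectint f xm x1 y0 ym + rectint f xm x1 ym y1)) as T1. rewrite -S in T1.
  pose proof (Cmod_triangle (rectint f x0 xm y0 ym) (rectint f x0 xm ym y1)).
  pose proof (Cmod_triangle (rectint f xm x1 y0 ym) (rectint f xm x1 ym y1)). lra.
Qed.

Lemma nested_intervals (l u : nat -> R) : (forall n, l n <= l (S n)) -> (forall n, u (S n) <= u n) ->
  (forall n, l n <= u n) -> exists p, forall n, l n <= p <= u n.
Proof.
  intros Hl Hu Hlu.
  assert (Ml : forall n k, l n <= l (n + k)%nat).
  { intros n k; induction k as [|k IH]; [rewrite Nat.add_0_r; lra|].
    rewrite Nat.add_succ_r. specialize (Hl (n + k)%nat); lra. }
  assert (Mu : forall n k, u (n + k)%nat <= u n).
  { intros n k; induction k as [|k IH]; [rewrite Nat.add_0_r; lra|].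
    rewrite Nat.add_succ_r. specialize (Hu (n + k)%nat); lra. }
  assert (Mlu : forall n m, l n <= u m).
  { intros n m. specialize (Ml n m). specialize (Mu m n). rewrite Nat.add_comm in Mu.
    specialize (Hlu (n + m)%nat). lra. }
  destruct (completeness (fun x => exists n, x = l n)) as [p [P1 P2]].
  - exists (u O). intros x [n ->]; auto.
  - now exists (l O), O.
  - exists p. intros n; split.
    + apply P1; now exists n.
    + apply P2. intros x [m ->]; auto.
Qed.

(** Each bisection loses at most a factor 4, and the rectangles shrink to a point [p]. Near [p] the
    function differs from its tangent by [eps * |w - p|]. Both this distance and the perimeter are
    of order [2^-n], which balances [4^n] and leaves a multiple of [eps]. *)
Theorem goursat f x0 x1 y0 y1 : x0 <= x1 -> y0 <= y1 ->
  (forall z, inrect x0 x1 y0 y1 z -> holo f z) -> rectint f x0 x1 y0 y1 = 0.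
Proof.
  intros Hx Hy Hf.
  set (rs := fix rs n := match n with O => ((x0, x1), (y0, y1)) | S n => quarter f (rs n) end).
  set (a := fun n => fst (fst (rs n))). set (b := fun n => snd (fst (rs n))).
  set (c := fun n => fst (snd (rs n))). set (d := fun n => snd (snd (rs n))).
  assert (Hrs : forall n, rs n = ((a n, b n), (c n, d n))).
  { intros n; unfold a, b, c, d. now destruct (rs n) as [[? ?] [? ?]]. }
  assert (INV : forall n, x0 <= a n <= b n /\ b n <= x1 /\ y0 <= c n <= d n /\ d n <= y1 /\
     b n - a n = (x1 - x0) / 2 ^ n /\ d n - c n = (y1 - y0) / 2 ^ n /\
     Cmod (rectint f x0 x1 y0 y1) <= 4 ^ n * Cmod (rectint f (a n) (b n) (c n) (d n)) /\
     a n <= a (S n) /\ b (S n) <= b n /\ c n <= c (S n) /\ d (S n) <= d n).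
  { assert (STEP : forall n, x0 <= a n <= b n -> b n <= x1 -> y0 <= c n <= d n -> d n <= y1 ->
      a n <= a (S n) <= b (S n) /\ b (S n) <= b n /\ c n <= c (S n) <= d (S n) /\ d (S n) <= d n /\
      b (S n) - a (S n) = (b n - a n) / 2 /\ d (S n) - c (S n) = (d n - c n) / 2 /\
      Cmod (rectint f (a n) (b n) (c n) (d n)) <=
        4 * Cmod (rectint f (a (S n)) (b (S n)) (c (S n)) (d (S n)))).
    { intros n A B D E. destruct (quarter_spec f (a n) (b n) (c n) (d n)) as
        [u0 [u1 [v0 [v1 [Q K]]]]]; try lra.
      { intros z [Z1 Z2]. apply holo_cont, Hf. split; lra. }
      rewrite -Hrs in Q. change (quarter f (rs n)) with (rs (S n)) in Q.
      unfold a at 2 3 5 6, b at 2 3 5 6, c at 2 3 5 6, d at 2 3 5 6.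
      unfold a, b, c, d in *. rewrite Q. simpl. tauto. }
    induction n as [|n IH].
    - assert (S0 := STEP O). unfold a at 1 2, b at 1 2, c at 1 2, d at 1 2 in S0. simpl in S0.
      specialize (S0 ltac:(lra) ltac:(lra) ltac:(lra) ltac:(lra)).
      destruct S0 as [S1 [S2 [S3 [S4 [S5 [S6 S7]]]]]].
      unfold a at 1 2 3 4 5, b at 1 2 3 4, c at 1 2 3 4 5, d at 1 2 3 4. simpl.
      change (rs 0%nat) with ((x0, x1), (y0, y1)). simpl.
      repeat split; try lra; try tauto.
      change (a 0%nat) with x0 in *. change (b 0%nat) with x1 in *. change (c 0%nat) with y0 in *.
      change (d 0%nat) with y1 in *. all: try lra.
    - destruct IH as [I1 [I2 [I3 [I4 [I5 [I6 [I7 _]]]]]]].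
      destruct (STEP n I1 I2 I3 I4) as [S1 [S2 [S3 [S4 [S5 [S6 S7]]]]]].
      assert (P : 0 < 2 ^ n) by (apply pow_lt; lra).
      assert (P4 : 0 < 4 ^ n) by (apply pow_lt; lra).
      assert (J1 : x0 <= a (S n) <= b (S n)) by lra. assert (J2 : b (S n) <= x1) by lra.
      assert (J3 : y0 <= c (S n) <= d (S n)) by lra. assert (J4 : d (S n) <= y1) by lra.
      destruct (STEP (S n) J1 J2 J3 J4) as [T1 [T2 [T3 [T4 _]]]].
      split; [lra|]. split; [lra|]. split; [lra|]. split; [lra|].
      split; [rewrite S5 I5; simpl; field; lra|]. split; [rewrite S6 I6; simpl; field; lra|].
      split; [|lra].
      simpl. apply (Rle_trans _ _ _ I7). apply (Rmult_le_compat_l (4 ^ n)) in S7; lra. }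
  destruct (nested_intervals a b) as [px Hpx]; [intros n; apply INV..| ].
  destruct (nested_intervals c d) as [py Hpy]; [intros n; apply INV..| ].
  set (p := (px, py) : C).
  assert (Hp : inrect x0 x1 y0 y1 p).
  { specialize (Hpx O). specialize (Hpy O). destruct (INV O) as [? [? [? [? _]]]]. split; simpl; lra. }
  destruct (Hf p Hp) as [l Hl].
  set (L := x1 - x0 + (y1 - y0)). assert (HL : 0 <= L) by (unfold L; lra).
  assert (B : forall eps, 0 < eps -> Cmod (rectint f x0 x1 y0 y1) <= 4 * eps * L * L).
  { intros eps He. destruct (hasd_eps_inv _ _ _ Hl eps He) as [dl [Hd K]].
    assert (EX : exists n, L / 2 ^ n < dl).
    { destruct (pow_lt_1_zero (/2) ltac:(rewrite Rabs_pos_eq; lra) (dl / (L + 1))) as [N HN].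
      { apply Rdiv_lt_0_compat; lra. }
      exists N. specialize (HN N (Nat.le_refl _)).
      rewrite Rabs_pos_eq in HN; [|apply pow_le; lra]. rewrite pow_inv in HN.
      assert (P : 0 < / 2 ^ N) by (apply Rinv_0_lt_compat, pow_lt; lra).
      apply (Rmult_lt_compat_l (L + 1)) in HN; [|lra].
      replace ((L + 1) * (dl / (L + 1))) with dl in HN by (field; lra).
      unfold Rdiv. nra. }
    destruct EX as [n Hn]. destruct (INV n) as [I1 [I2 [I3 [I4 [I5 [I6 [I7 _]]]]]]].
    assert (P : 0 < 2 ^ n) by (apply pow_lt; lra).
    set (Ln := L / 2 ^ n) in *.
    assert (ELn : b n - a n + (d n - c n) = Ln) by (rewrite I5 I6; unfold Ln, L; field; lra).
    assert (INR : forall z, inrect (a n) (b n) (c n) (d n) z -> Cmod (z - p) <= Ln).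
    { intros z [Z1 Z2]. apply (Rle_trans _ _ _ (Cmod_le_abs _)). simpl.
      specialize (Hpx n). specialize (Hpy n).
      assert (Rabs (fst z + - px) <= b n - a n) by (apply Rabs_le; lra).
      assert (Rabs (snd z + - py) <= d n - c n) by (apply Rabs_le; lra). lra. }
    set (g := fun z => (f z - (f p + l * (z - p)))%C).
    assert (Haff : forall z, Ccont (fun w => f p + l * (w - p))%C z).
    { intros z. apply Ccont_plus; [apply Ccont_const|]. apply Ccont_mult; [apply Ccont_const|].
      apply Ccont_minus; [apply Ccont_id|apply Ccont_const]. }
    assert (Hfc : forall z, bdrect (a n) (b n) (c n) (d n) z -> Ccont f z).
    { intros z [[Z1 Z2] _]. apply holo_cont, Hf. split; lra. }
    assert (EI : rectint f (a n) (b n) (c n) (d n) = rectint g (a n) (b n) (c n) (d n)).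
    { unfold g. rewrite rectint_minus; try lra; auto. rewrite rectint_affine; try lra. ring. }
    assert (BI : Cmod (rectint g (a n) (b n) (c n) (d n)) <= 4 * (eps * Ln) * Ln).
    { rewrite -{2}ELn. apply rectint_bound; try lra.
      - intros z Hz. unfold g. apply Ccont_minus; auto.
      - intros z Hz. pose proof (INR z (proj1 Hz)) as J.
        apply Rle_trans with (eps * Cmod (z - p)).
        + specialize (K z (Rle_lt_trans _ _ _ J Hn)). unfold g.
          replace (f z - (f p + l * (z - p)))%C with (f z - f p - l * (z - p))%C by ring. exact K.
        + apply Rmult_le_compat_l; lra. }
    rewrite -EI in BI.
    assert (E4 : 4 ^ n = 2 ^ n * 2 ^ n) by (rewrite -Rpow_mult_distr; f_equal; lra).
    assert (P4 : 0 < 4 ^ n) by (apply pow_lt; lra).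
    apply (Rmult_le_compat_l (4 ^ n)) in BI; [|lra].
    replace (4 ^ n * (4 * (eps * Ln) * Ln)) with (4 * eps * L * L) in BI; [lra|].
    rewrite E4. unfold Ln. field. lra. }
  apply Cmod_eq_0. apply Rle_antisym; [|apply Cmod_ge_0].
  apply Rnot_lt_le. intros N. set (m := Cmod (rectint f x0 x1 y0 y1)) in *.
  assert (He : 0 < m / (8 * (L * L + 1))) by (apply Rdiv_lt_0_compat; nra).
  specialize (B _ He).
  assert (4 * (m / (8 * (L * L + 1))) * L * L < m); [|lra].
  apply (Rmult_lt_reg_r (8 * (L * L + 1))); [nra|].
  replace (4 * (m / (8 * (L * L + 1))) * L * L * (8 * (L * L + 1))) with (4 * m * L * L) by (field; nra).
  nra.
Qed.

(** * Cauchy's formula and its consequences *)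

(** The frame between the rectangles is cut into four rectangles that avoid the open hole, and
    [goursat] applies to each. The inner rectangle may touch the outer one. *)
Lemma rectint_hole f x0 u0 u1 x1 y0 v0 v1 y1 :
  x0 <= u0 -> u0 <= u1 -> u1 <= x1 -> y0 <= v0 -> v0 <= v1 -> v1 <= y1 ->
  (forall z, inrect x0 x1 y0 y1 z -> ~ inside u0 u1 v0 v1 z -> holo f z) ->
  rectint f x0 x1 y0 y1 = rectint f u0 u1 v0 v1.
Proof.
  intros A1 A2 A3 B1 B2 B3 H.
  assert (Hh : forall y a b, (y <= v0 \/ v1 <= y) -> y0 <= y <= y1 -> x0 <= a -> a <= b -> b <= x1 ->
    exC (fun t => f (t, y)) a b).
  { intros y a b ? ? ? ? ?. apply (exC_h f y); [lra|]. intros t Ht. apply holo_cont, H;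
     [split; simpl; lra|]. unfold inside; simpl; lra. }
  assert (Hv : forall x a b, (x <= u0 \/ u1 <= x) -> x0 <= x <= x1 -> y0 <= a -> a <= b -> b <= y1 ->
    exC (fun t => f (x, t)) a b).
  { intros x a b ? ? ? ? ?. apply (exC_v f x); [lra|]. intros t Ht. apply holo_cont, H;
     [split; simpl; lra|]. unfold inside; simpl; lra. }
  rewrite (rectint_cut_x f x0 u0 x1); try (apply Hh; lra).
  rewrite (rectint_cut_x f u0 u1 x1); try (apply Hh; lra).
  rewrite (rectint_cut_y f u0 u1 y0 v0 y1); try (apply Hv; lra).
  rewrite (rectint_cut_y f u0 u1 v0 v1 y1); try (apply Hv; lra).
  rewrite (goursat f x0 u0 y0 y1); [ | lra | lra |
    intros z [Z1 Z2]; apply H; [split; lra|unfold inside; lra]].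
  rewrite (goursat f u1 x1 y0 y1); [ | lra | lra |
    intros z [Z1 Z2]; apply H; [split; lra|unfold inside; lra]].
  rewrite (goursat f u0 u1 y0 v0); [ | lra | lra |
    intros z [Z1 Z2]; apply H; [split; lra|unfold inside; lra]].
  rewrite (goursat f u0 u1 v1 y1); [ | lra | lra |
    intros z [Z1 Z2]; apply H; [split; lra|unfold inside; lra]].
  ring.
Qed.

(* The value is [2 i pi], but only its being nonzero matters. *)
Definition kappa : C := rectint (fun w => / w)%C (-1) 1 (-1) 1.

Lemma CInt_lin g u v a b : exC g (u * a + v) (u * b + v) ->
  CInt g (u * a + v) (u * b + v) = (RtoC u * CInt (fun s => g (u * s + v)%R) a b)%C.
Proof.
  intros [A B]. unfold CInt, RtoC, Cmult. simpl.
  assert (E1 := RInt_comp_lin (V := R_CompleteNormedModule) _ u v a b A).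
  assert (E2 := RInt_comp_lin (V := R_CompleteNormedModule) _ u v a b B).
  assert (X1 := ex_RInt_comp_lin (V := R_CompleteNormedModule) _ u v a b A).
  assert (X2 := ex_RInt_comp_lin (V := R_CompleteNormedModule) _ u v a b B).
  rewrite -E1 -E2. 
  destruct (Req_dec u 0) as [->|N].
  - f_equal; [rewrite (RInt_ext _ (fun _ => 0)) | rewrite (RInt_ext _ (fun _ => 0))];
    try (intros x _; exact (Rmult_0_l _)); rewrite RInt_const; unfold scal; simpl; unfold mult; simpl; ring.
  - assert (S : forall h : R -> R, ex_RInt (fun y => scal u (h y)) a b ->
       RInt (fun y => scal u (h y)) a b = u * RInt h a b).
    { intros h Hh. rewrite (RInt_scal (V := R_CompleteNormedModule)) //.
      apply (ex_RInt_ext (fun y => scal (/u) (scal u (h y)))).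
      - intros x _. unfold scal; simpl; unfold mult; simpl. now field.
      - now apply (ex_RInt_scal (V := R_CompleteNormedModule)). }
    rewrite (S (fun y => fst (g (u * y + v)))) // (S (fun y => snd (g (u * y + v)))) //. f_equal; ring.
Qed.

Lemma Ccont_inv_minus a z : z <> a -> Ccont (fun w => / (w - a))%C z.
Proof.
  intros N. apply Ccont_inv; [apply Ccont_minus; [apply Ccont_id|apply Ccont_const]|].
  intros X; apply N. replace z with (z - a + a)%C by ring. rewrite X; ring.
Qed.

Lemma Cminus_neq_0 z a : z <> a -> (z - a <> 0)%C.
Proof. intros N X; apply N. replace z with (z - a + a)%C by ring. rewrite X; ring. Qed.

(** The substitution [w = a + d v]: the factor [d] of [dw] cancels that of [1 / (w - a)]. *)
Lemma kappa_scale a d : 0 < d ->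
  rectint (fun w => / (w - a))%C (fst a - d) (fst a + d) (snd a - d) (snd a + d) = kappa.
Proof.
  intros Hd. destruct a as [ax ay]. simpl.
  assert (RC : RtoC d <> 0) by (intros X; apply RtoC_inj in X; lra).
  assert (Nh : forall t y, y <> 0 -> (t, y) <> RtoC 0) by (intros t y N X; injection X; intros; lra).
  assert (Nv : forall x t, x <> 0 -> (x, t) <> RtoC 0) by (intros x t N X; injection X; intros; lra).
  assert (Hh : forall y, y <> 0 ->
     CInt (fun t => / ((t, (ay + d * y)%R) - (ax, ay)))%C (ax - d) (ax + d) = CInt (fun t => / (t, y))%C (-1) 1).
  { intros y Hy. assert (ay + d * y <> ay) by (intros X; assert (d * y = 0) by lra; nra).
    replace (ax - d) with (d * (-1) + ax) by ring. replace (ax + d) with (d * 1 + ax) by ring.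
    rewrite CInt_lin.
    - rewrite -CInt_scal.
      + apply CInt_ext. intros t _.
        replace (((d * t + ax)%R, (ay + d * y)%R) - (ax, ay))%C with (RtoC d * (t, y))%C.
        2:{ unfold Cminus, Cplus, Copp, Cmult, RtoC; simpl; f_equal; ring. }
        field; auto.
      + apply (pcont_exC). intros s Hs.
        apply (pcont_comp (fun w => / (w - (ax, ay)))%C (fun s => ((d * s + ax)%R, (ay + d * y)%R))).
        * intros eps He. exists (eps / d). split; [now apply Rdiv_lt_0_compat|]. intros r Hr.
          apply (Rle_lt_trans _ _ _ (Cmod_le_abs _)). simpl.
          replace (ay + d * y + - (ay + d * y)) with 0 by ring. rewrite Rabs_R0.
          replace (d * r + ax + - (d * s + ax)) with (d * (r - s)) by ring.
          rewrite Rabs_mult (Rabs_pos_eq d); [|lra].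
          replace eps with (d * (eps / d)) by (field; lra). apply (Rmult_lt_compat_l d) in Hr; lra.
        * apply Ccont_inv_minus. intros X; injection X; intros; lra.
    - apply (exC_h (fun w => / (w - (ax, ay)))%C); [lra|]. intros t _.
      apply Ccont_inv_minus. intros X; injection X; intros; lra. }
  assert (Hv : forall x, x <> 0 ->
     CInt (fun t => / (((ax + d * x)%R, t) - (ax, ay)))%C (ay - d) (ay + d) = CInt (fun t => / (x, t))%C (-1) 1).
  { intros x Hx. assert (ax + d * x <> ax) by (intros X; assert (d * x = 0) by lra; nra).
    replace (ay - d) with (d * (-1) + ay) by ring. replace (ay + d) with (d * 1 + ay) by ring.
    rewrite CInt_lin.
    - rewrite -CInt_scal.
      + apply CInt_ext. intros t _.
        replace (((ax + d * x)%R, (d * t + ay)%R) - (ax, ay))%C with (RtoC d * (x, t))%C.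
        2:{ unfold Cminus, Cplus, Copp, Cmult, RtoC; simpl; f_equal; ring. }
        field; auto.
      + apply (pcont_exC). intros s Hs.
        apply (pcont_comp (fun w => / (w - (ax, ay)))%C (fun s => ((ax + d * x)%R, (d * s + ay)%R))).
        * intros eps He. exists (eps / d). split; [now apply Rdiv_lt_0_compat|]. intros r Hr.
          apply (Rle_lt_trans _ _ _ (Cmod_le_abs _)). simpl.
          replace (ax + d * x + - (ax + d * x)) with 0 by ring. rewrite Rabs_R0.
          replace (d * r + ay + - (d * s + ay)) with (d * (r - s)) by ring.
          rewrite Rabs_mult (Rabs_pos_eq d); [|lra].
          replace eps with (d * (eps / d)) by (field; lra). apply (Rmult_lt_compat_l d) in Hr; lra.
        * apply Ccont_inv_minus. intros X; injection X; intros; lra.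
    - apply (exC_v (fun w => / (w - (ax, ay)))%C); [lra|]. intros t _.
      apply Ccont_inv_minus. intros X; injection X; intros; lra. }
  pose proof (Hh (-1) ltac:(lra)) as E1. pose proof (Hh 1 ltac:(lra)) as E2.
  pose proof (Hv (-1) ltac:(lra)) as E3. pose proof (Hv 1 ltac:(lra)) as E4.
  replace (ay + d * -1) with (ay - d) in E1 by ring. replace (ay + d * 1) with (ay + d) in E2 by ring.
  replace (ax + d * -1) with (ax - d) in E3 by ring. replace (ax + d * 1) with (ax + d) in E4 by ring.
  unfold rectint, kappa. rewrite E1 E2 E3 E4. reflexivity.
Qed.

(** The imaginary part is four times the integral of [1 / (1 + t^2)] over [[-1, 1]], one
    contribution for each side. *)
Lemma kappa_neq_0 : kappa <> 0.
Proof.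
  set (J := RInt (fun t => / (1 + t ^ 2)) (-1) 1).
  assert (HJ : 0 < J).
  { apply RInt_gt_0; [lra| |].
    - intros t Ht. apply Rinv_0_lt_compat; nra.
    - intros t Ht. apply (continuous_comp (fun t => 1 + t ^ 2) Rinv).
      + apply (ex_derive_continuous (fun t => 1 + t ^ 2)). auto_derive; auto.
      + apply continuous_Rinv. nra. }
  assert (ON : forall k : R, RInt (fun t => k * / (1 + t ^ 2)) (-1) 1 = k * J).
  { intros k. apply (RInt_scal (V := R_CompleteNormedModule)).
    apply (ex_RInt_continuous (V := R_CompleteNormedModule)). intros t Ht.
    apply (continuous_comp (fun t => 1 + t ^ 2) Rinv).
    + apply (ex_derive_continuous (fun t => 1 + t ^ 2)). auto_derive; auto.
    + apply continuous_Rinv. nra. }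
  intros X. assert (Y : snd kappa = 0) by (rewrite X; reflexivity).
  unfold kappa, rectint, CInt in Y. simpl in Y.
  rewrite (RInt_ext (fun t => - -1 / (t * (t * 1) + -1 * (-1 * 1))) (fun t => 1 * / (1 + t ^ 2))) in Y.
  2:{ intros t _. simpl. field. nra. }
  rewrite (RInt_ext (fun t => - (1) / (t * (t * 1) + 1 * (1 * 1))) (fun t => -1 * / (1 + t ^ 2))) in Y.
  2:{ intros t _. simpl. field. nra. }
  rewrite (RInt_ext (fun t => 1 / (1 * (1 * 1) + t * (t * 1))) (fun t => 1 * / (1 + t ^ 2))) in Y.
  2:{ intros t _. simpl. field. nra. }
  rewrite (RInt_ext (fun t => -1 / (-1 * (-1 * 1) + t * (t * 1))) (fun t => -1 * / (1 + t ^ 2))) in Y.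
  2:{ intros t _. simpl. field. nra. }
  rewrite !ON in Y. lra.
Qed.

Lemma inside_inrect x0 x1 y0 y1 z : inside x0 x1 y0 y1 z -> inrect x0 x1 y0 y1 z.
Proof. unfold inside, inrect; lra. Qed.

Lemma inside_margin x0 x1 y0 y1 z : inside x0 x1 y0 y1 z ->
  exists d, 0 < d /\ x0 < fst z - d /\ fst z + d < x1 /\ y0 < snd z - d /\ snd z + d < y1 /\
    forall w, bdrect x0 x1 y0 y1 w -> d <= Cmod (w - z).
Proof.
  intros [[A B] [D E]].
  set (d := Rmin (Rmin (fst z - x0) (x1 - fst z)) (Rmin (snd z - y0) (y1 - snd z)) / 2).
  assert (H : d <= (fst z - x0) / 2 /\ d <= (x1 - fst z) / 2 /\ d <= (snd z - y0) / 2 /\ d <= (y1 - snd z) / 2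
     /\ 0 < d).
  { unfold d, Rmin. repeat destruct (Rle_dec _ _); lra. }
  exists d. repeat split; try lra. intros w [[[W1 W2] [W3 W4]] W].
  pose proof (fst_le_Cmod (w - z)) as P. pose proof (snd_le_Cmod (w - z)) as Q. simpl in P, Q.
  destruct W as [W|[W|[W|W]]]; rewrite W in P, Q;
   [rewrite Rabs_left in P | rewrite Rabs_pos_eq in P |rewrite Rabs_left in Q | rewrite Rabs_pos_eq in Q ]; lra.
Qed.

Lemma bd_ne x0 x1 y0 y1 z w : inside x0 x1 y0 y1 z -> bdrect x0 x1 y0 y1 w -> w <> z.
Proof. intros [A B] [_ H] ->; lra. Qed.

Lemma near_inside x0 x1 y0 y1 z : inside x0 x1 y0 y1 z -> near z (inside x0 x1 y0 y1).
Proof.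
  intros H. destruct (inside_margin _ _ _ _ _ H) as [d [Hd K]]. exists d; split; [exact Hd|].
  intros w Hw. pose proof (fst_le_Cmod (w - z)) as P. pose proof (snd_le_Cmod (w - z)) as Q.
  apply (Rle_lt_trans _ _ _ P) in Hw as P'. apply (Rle_lt_trans _ _ _ Q) in Hw as Q'. simpl in P', Q'.
  apply Rabs_def2 in P'. apply Rabs_def2 in Q'. unfold inside. lra.
Qed.

(** [rectint_hole] shrinks the contour to a square of half-side [e] about [z]. There [f w] is
    replaced by [f z] at a cost of [eps / e] times a perimeter proportional to [e]. *)
Theorem cauchy_formula f x0 x1 y0 y1 z : inside x0 x1 y0 y1 z ->
  (forall w, inrect x0 x1 y0 y1 w -> holo f w) ->
  rectint (fun w => f w / (w - z))%C x0 x1 y0 y1 = (kappa * f z)%C.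
Proof.
  intros Hz Hf. destruct (inside_margin _ _ _ _ _ Hz) as [d [Hd [D1 [D2 [D3 [D4 _]]]]]].
  assert (Cf : Ccont f z) by (apply holo_cont, Hf, inside_inrect, Hz).
  set (I := rectint (fun w => f w / (w - z))%C x0 x1 y0 y1).
  assert (B : forall eps, 0 < eps -> Cmod (I - kappa * f z) <= 16 * eps).
  { intros eps He. destruct (Cf eps He) as [r [Hr K]].
    set (e := Rmin d (r / 4)).
    assert (He1 : 0 < e) by (apply Rmin_pos; lra). assert (He2 : e <= d) by apply Rmin_l.
    assert (He3 : e <= r / 4) by apply Rmin_r.
    assert (EI : I = rectint (fun w => f w / (w - z))%C (fst z - e) (fst z + e) (snd z - e) (snd z + e)).
    { apply rectint_hole; try lra. intros w Hw Nw. apply holo_div; [now apply Hf| |].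
      - apply holo_minus; [apply holo_id|apply holo_const].
      - apply Cminus_neq_0. intros ->; apply Nw; unfold inside; lra. }
    assert (Zin : inside (fst z - e) (fst z + e) (snd z - e) (snd z + e) z) by (unfold inside; lra).
    assert (Dist : forall w, bdrect (fst z - e) (fst z + e) (snd z - e) (snd z + e) w ->
        e <= Cmod (w - z) < r).
    { intros w [[W1 W2] W]. split.
      - pose proof (fst_le_Cmod (w - z)) as P. pose proof (snd_le_Cmod (w - z)) as Q. simpl in P, Q.
        destruct W as [W|[W|[W|W]]]; rewrite W in P, Q;
        [rewrite Rabs_left in P | rewrite Rabs_pos_eq in P |rewrite Rabs_left in Q | rewrite Rabs_pos_eq in Q ]; lra.
      - apply (Rle_lt_trans _ _ _ (Cmod_le_abs _)). simpl.
        assert (Rabs (fst w + - fst z) <= e) by (apply Rabs_le; lra).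
        assert (Rabs (snd w + - snd z) <= e) by (apply Rabs_le; lra). lra. }
    assert (Cw : forall w, bdrect (fst z - e) (fst z + e) (snd z - e) (snd z + e) w ->
        Ccont f w /\ Ccont (fun w => / (w - z))%C w).
    { intros w Hw. split.
      - apply holo_cont, Hf. destruct Hw as [[W1 W2] _]. unfold inrect; lra.
      - apply Ccont_inv_minus. exact (bd_ne _ _ _ _ _ _ Zin Hw). }
    rewrite EI -(kappa_scale z e He1).
    rewrite Cmult_comm -rectint_scal; try lra; [|intros w Hw; apply Cw, Hw].
    rewrite -rectint_minus; try lra.
    2:{ intros w Hw. apply Ccont_mult; apply Cw, Hw. }
    2:{ intros w Hw. apply Ccont_mult; [apply Ccont_const|apply Cw, Hw]. }
    apply Rle_trans with (4 * (eps / e) * (fst z + e - (fst z - e) + (snd z + e - (snd z - e)))).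
    2:{ right; field; lra. }
    apply rectint_bound; try lra.
    - intros w Hw. apply Ccont_minus; apply Ccont_mult; try apply Ccont_const; apply Cw, Hw.
    - intros w Hw. destruct (Dist w Hw) as [W1 W2].
      pose proof (Cminus_neq_0 _ _ (bd_ne _ _ _ _ _ _ Zin Hw)) as N.
      replace (f w / (w - z) - f z * / (w - z))%C with ((f w - f z) / (w - z))%C by (field; auto).
      rewrite Cmod_div //. specialize (K w W2).
      apply Rmult_le_compat; [apply Cmod_ge_0| |lra|apply Rinv_le_contravar; lra].
      left. apply Rinv_0_lt_compat. lra. }
  replace I with ((I - kappa * f z) + kappa * f z)%C by ring.
  replace (I - kappa * f z)%C with (RtoC 0); [ring|]. symmetry. apply Cmod_eq_0.
  apply Rle_antisym; [|apply Cmod_ge_0]. apply Rnot_lt_le. intros N.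
  specialize (B (Cmod (I - kappa * f z) / 32) ltac:(lra)). lra.
Qed.

(** * Integrals with a parameter and removable singularities *)

Lemma pcont_bounded g a b : a <= b -> (forall t, a <= t <= b -> pcont g t) ->
  exists M, forall t, a <= t <= b -> Cmod (g t) <= M.
Proof.
  intros Hab H. destruct (continuity_ab_maj (fun t => Cmod (g t)) a b Hab) as [m [K _]].
  - intros t Ht eps He. destruct (H t Ht eps He) as [d [Hd L]]. exists d; split; [exact Hd|].
    intros s [_ Hs]. simpl. unfold Rdist. specialize (L s Hs).
    apply Rle_lt_trans with (Cmod (g s - g t)); [|exact L].
    pose proof (Cmod_triangle (g s - g t) (g t)) as T1. pose proof (Cmod_triangle (g t - g s) (g s)) as T2.
    replace (g s - g t + g t)%C with (g s) in T1 by ring.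
    replace (g t - g s + g s)%C with (g t) in T2 by ring. rewrite (Cmod_sym (g t)) in T2.
    apply Rabs_le. lra.
  - exists (Cmod (g m)). auto.
Qed.

Lemma bd_bounded f x0 x1 y0 y1 : x0 <= x1 -> y0 <= y1 ->
  (forall z, bdrect x0 x1 y0 y1 z -> Ccont f z) ->
  exists M, 0 <= M /\ forall z, bdrect x0 x1 y0 y1 z -> Cmod (f z) <= M.
Proof.
  intros Hx Hy H.
  assert (Hh : forall y, y = y0 \/ y = y1 -> exists M, forall t, x0 <= t <= x1 -> Cmod (f (t, y)) <= M).
  { intros y Y. apply pcont_bounded; [exact Hx|]. intros t Ht.
    apply (pcont_comp f (fun t => (t, y))); [apply pcont_h|]. apply H. split; [split; simpl; lra|simpl; lra]. }
  assert (Hv : forall x, x = x0 \/ x = x1 -> exists M, forall t, y0 <= t <= y1 -> Cmod (f (x, t)) <= M).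
  { intros x X. apply pcont_bounded; [exact Hy|]. intros t Ht.
    apply (pcont_comp f (fun t => (x, t))); [apply pcont_v|]. apply H. split; [split; simpl; lra|simpl; lra]. }
  destruct (Hh y0 ltac:(auto)) as [M1 K1]. destruct (Hh y1 ltac:(auto)) as [M2 K2].
  destruct (Hv x0 ltac:(auto)) as [M3 K3]. destruct (Hv x1 ltac:(auto)) as [M4 K4].
  pose proof (Rle_abs M1). pose proof (Rle_abs M2). pose proof (Rle_abs M3). pose proof (Rle_abs M4).
  pose proof (Rabs_pos M1). pose proof (Rabs_pos M2). pose proof (Rabs_pos M3). pose proof (Rabs_pos M4).
  exists (Rabs M1 + Rabs M2 + Rabs M3 + Rabs M4). split; [lra|].
  intros [x y] [[Z1 Z2] Z]. simpl in *.
  destruct Z as [-> | [-> | [-> | ->]]].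
  - specialize (K3 y Z2). lra.
  - specialize (K4 y Z2). lra.
  - specialize (K1 x Z1). lra.
  - specialize (K2 x Z1). lra.
Qed.

(** Differentiation under the integral sign. A remainder quadratic in [v - z], with one constant for
    the whole contour, is available for both Cauchy kernels below and spares any uniform continuity
    argument. *)
Lemma rectint_param (k : C -> C -> C) (k' : C -> C) x0 x1 y0 y1 z B : x0 <= x1 -> y0 <= y1 ->
  (forall w, bdrect x0 x1 y0 y1 w -> Ccont k' w) ->
  near z (fun v => forall w, bdrect x0 x1 y0 y1 w -> Ccont (fun w => k w v) w /\
    Cmod (k w v - k w z - k' w * (v - z)) <= B * (Cmod (v - z) * Cmod (v - z))) ->
  hasd (fun v => rectint (fun w => k w v) x0 x1 y0 y1) z (rectint k' x0 x1 y0 y1).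
Proof.
  intros Hx Hy Hk' H. pose proof (near_self _ _ H) as H0. apply hasd_eps. intros eps He.
  set (L := x1 - x0 + (y1 - y0)). assert (HL : 0 <= L) by (unfold L; lra).
  set (B1 := Rabs B + 1). assert (HB : 0 < B1) by (unfold B1; pose proof (Rabs_pos B); lra).
  assert (Hr : 0 < eps / (4 * B1 * (L + 1))) by (apply Rdiv_lt_0_compat; nra).
  eapply near_imp; [|exact (near_and _ _ _ H (near_ball z _ Hr))]. cbv beta; intros v [Hv Hdv].
  rewrite -rectint_minus //; [|intros w Hw; apply Hv, Hw|intros w Hw; apply H0, Hw].
  rewrite Cmult_comm -rectint_scal //. rewrite -rectint_minus //.
  2:{ intros w Hw. apply Ccont_minus; [apply Hv, Hw|apply H0, Hw]. }
  2:{ intros w Hw. apply Ccont_mult; [apply Ccont_const|auto]. }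
  set (m := Cmod (v - z)) in *. assert (Hm : 0 <= m) by apply Cmod_ge_0.
  apply Rle_trans with (4 * (B1 * (m * m)) * L).
  - apply rectint_bound; try lra.
    + intros w Hw. apply Ccont_minus; [apply Ccont_minus; [apply Hv, Hw|apply H0, Hw]|].
      apply Ccont_mult; [apply Ccont_const|auto].
    + intros w Hw. rewrite (Cmult_comm (v - z)). eapply Rle_trans; [apply Hv, Hw|]. fold m.
      apply Rmult_le_compat_r; [nra|]. unfold B1. pose proof (Rle_abs B). lra.
  - assert (4 * B1 * (L + 1) * m <= eps).
    { apply (Rmult_lt_compat_l (4 * B1 * (L + 1))) in Hdv; [|nra].
      replace (4 * B1 * (L + 1) * (eps / (4 * B1 * (L + 1)))) with eps in Hdv by (field; nra). lra. }
    assert (4 * B1 * L * m <= eps) by (assert (0 <= B1 * m) by nra; nra). nra.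
Qed.

Lemma near_dist_half z d : 0 < d -> near z (fun v => forall w, d <= Cmod (w - z) -> d / 2 <= Cmod (w - v)).
Proof.
  intros Hd. exists (d / 2); split; [lra|]. intros v Hv w Hw.
  pose proof (Cmod_triangle (w - v) (v - z)) as T. replace (w - v + (v - z))%C with (w - z)%C in T by ring. lra.
Qed.

Lemma Cmod_pos_ne (z : C) d : 0 < d -> d <= Cmod z -> z <> 0.
Proof. intros Hd H ->. rewrite Cmod_0 in H. lra. Qed.

Section CauchyTransform.
Variables (c : C -> C) (x0 x1 y0 y1 : R) (z : C).
Hypotheses (Hz : inside x0 x1 y0 y1 z) (Hc : forall w, bdrect x0 x1 y0 y1 w -> Ccont c w).

(** Since [c] need only be continuous on the boundary, it may itself contain a kernel such as
    [1 / (w - a)]. The constant [2 / d^3] comes from [|w - z| >= d] and [|w - v| >= d / 2]. *)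
Lemma cauchy_transform_hasd :
  hasd (fun v => rectint (fun w => c w / (w - v))%C x0 x1 y0 y1) z
       (rectint (fun w => c w / ((w - z) * (w - z)))%C x0 x1 y0 y1).
Proof.
  destruct (inside_margin _ _ _ _ _ Hz) as [d [Hd [_ [_ [_ [_ D]]]]]].
  assert (Hx : x0 <= x1) by (destruct Hz; lra). assert (Hy : y0 <= y1) by (destruct Hz; lra).
  destruct (bd_bounded c x0 x1 y0 y1 Hx Hy Hc) as [M [HM K]].
  apply (rectint_param (fun w v => c w / (w - v))%C _ x0 x1 y0 y1 z (M * (2 / (d * d * d)))); auto.
  - intros w Hw. apply Ccont_mult; [auto|]. apply Ccont_inv.
    + apply Ccont_mult; apply Ccont_minus; (apply Ccont_id || apply Ccont_const).
    + apply Cmult_neq_0; apply Cminus_neq_0, (bd_ne _ _ _ _ _ _ Hz Hw).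
  - eapply near_imp; [|exact (near_and _ _ _ (near_inside _ _ _ _ _ Hz) (near_dist_half z d Hd))].
    cbv beta; intros v [V1 V2] w Hw. specialize (D w Hw). specialize (V2 w D). split.
    { apply Ccont_mult; [auto|]. apply Ccont_inv_minus, (bd_ne _ _ _ _ _ _ V1 Hw). }
    assert (N1 : (w - z <> 0)%C) by (apply (Cmod_pos_ne _ d); lra).
    assert (N2 : (w - v <> 0)%C) by (apply (Cmod_pos_ne _ (d / 2)); lra).
    replace (c w / (w - v) - c w / (w - z) - c w / ((w - z) * (w - z)) * (v - z))%C
      with (c w * ((v - z) * (v - z) / ((w - v) * ((w - z) * (w - z)))))%C by (field; auto).
    rewrite Cmod_mult Cmod_div; [|now repeat apply Cmult_neq_0]. rewrite !Cmod_mult.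
    rewrite Rmult_assoc. apply Rmult_le_compat; [apply Cmod_ge_0| |auto|].
    { apply Rmult_le_pos; [apply Rmult_le_pos; apply Cmod_ge_0|].
      left; apply Rinv_0_lt_compat. assert (0 < Cmod (w - z) * Cmod (w - z)) by nra. nra. }
    rewrite (Rmult_comm (2 / (d * d * d))). apply Rmult_le_compat_l; [apply Rmult_le_pos; apply Cmod_ge_0|].
    replace (2 / (d * d * d)) with (/ (d / 2 * (d * d))) by (field; lra).
    apply Rinv_le_contravar; [assert (0 < d * d) by nra; nra|].
    apply Rmult_le_compat; try nra.
Qed.

(** The remainder has numerator [3 (w - z) - 2 (v - z)], at most [4 |w - z|] for [|v - z| <= d / 2];
    dividing by the denominator gives [16 / d^4]. *)
Lemma cauchy_transform2_holo :
  holo (fun v => rectint (fun w => c w / ((w - v) * (w - v)))%C x0 x1 y0 y1) z.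
Proof.
  destruct (inside_margin _ _ _ _ _ Hz) as [d [Hd [_ [_ [_ [_ D]]]]]].
  assert (Hx : x0 <= x1) by (destruct Hz; lra). assert (Hy : y0 <= y1) by (destruct Hz; lra).
  destruct (bd_bounded c x0 x1 y0 y1 Hx Hy Hc) as [M [HM K]].
  eexists.
  apply (rectint_param (fun w v => c w / ((w - v) * (w - v)))%C
     (fun w => c w * (2 / ((w - z) * (w - z) * (w - z))))%C x0 x1 y0 y1 z (M * (16 / (d * d * d * d)))); auto.
  - intros w Hw. apply Ccont_mult; [auto|]. apply Ccont_mult; [apply Ccont_const|]. apply Ccont_inv.
    + repeat apply Ccont_mult; apply Ccont_minus; (apply Ccont_id || apply Ccont_const).
    + repeat apply Cmult_neq_0; apply Cminus_neq_0, (bd_ne _ _ _ _ _ _ Hz Hw).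
  - eapply near_imp; [|exact (near_and _ _ _ (near_and _ _ _ (near_inside _ _ _ _ _ Hz) (near_dist_half z d Hd))
      (near_ball z (d / 2) ltac:(lra)))].
    cbv beta; intros v [[V1 V2] V3] w Hw. specialize (D w Hw). specialize (V2 w D). split.
    { apply Ccont_mult; [auto|]. apply Ccont_inv.
      - apply Ccont_mult; apply Ccont_minus; (apply Ccont_id || apply Ccont_const).
      - apply Cmult_neq_0; apply Cminus_neq_0, (bd_ne _ _ _ _ _ _ V1 Hw). }
    assert (N1 : (w - z <> 0)%C) by (apply (Cmod_pos_ne _ d); lra).
    assert (N2 : (w - v <> 0)%C) by (apply (Cmod_pos_ne _ (d / 2)); lra).
    replace (c w / ((w - v) * (w - v)) - c w / ((w - z) * (w - z))
        - c w * (2 / ((w - z) * (w - z) * (w - z))) * (v - z))%C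
      with (c w * ((3 * (w - z) - 2 * (v - z)) / ((w - z) * (w - z) * (w - z) * ((w - v) * (w - v)))
             * ((v - z) * (v - z))))%C by (field; auto).
    rewrite Cmod_mult Cmod_mult Cmod_div; [|now repeat apply Cmult_neq_0]. rewrite !Cmod_mult.
    set (r := Cmod (w - z)) in *. set (s := Cmod (w - v)) in *. set (h := Cmod (v - z)) in *.
    assert (T : Cmod (3 * (w - z) - 2 * (v - z)) <= 4 * r).
    { unfold Cminus at 1. eapply Rle_trans; [apply Cmod_triangle|].
      rewrite Cmod_opp !Cmod_mult !Cmod_R !Rabs_pos_eq; try lra. fold r h. lra. }
    set (q := Cmod (3 * (w - z) - 2 * (v - z))) in *. assert (Hq : 0 <= q) by apply Cmod_ge_0.
    assert (R0 : 0 < r * r) by nra. assert (S0 : 0 < s * s) by nra.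
    rewrite (Rmult_assoc M). apply Rmult_le_compat; [apply Cmod_ge_0| |auto|].
    { apply Rmult_le_pos; [|apply Rmult_le_pos; apply Cmod_ge_0].
      apply Rmult_le_pos; [exact Hq|]. left; apply Rinv_0_lt_compat. assert (0 < r * r * r) by nra. nra. }
    apply Rmult_le_compat_r; [apply Rmult_le_pos; apply Cmod_ge_0|].
    apply Rle_trans with (4 * r / (r * r * r * (s * s))).
    + apply Rmult_le_compat_r; [|exact T]. left; apply Rinv_0_lt_compat. assert (0 < r * r * r) by nra. nra.
    + replace (4 * r / (r * r * r * (s * s))) with (4 * / ((r * r) * (s * s))) by (field; nra).
      replace (16 / (d * d * d * d)) with (4 * / ((d * d) * (d / 2 * (d / 2)))) by (field; lra).
      apply Rmult_le_compat_l; [lra|]. apply Rinv_le_contravar; [assert (0 < d * d) by nra; nra|].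
      apply Rmult_le_compat; nra.
Qed.
End CauchyTransform.

(** The value [d] at [a] is left free; [quot_holo] supplies the one that removes the singularity. *)
Definition quot (f : C -> C) (a d w : C) : C :=
  match excluded_middle_informative (w = a) with
  | left _ => d
  | right _ => ((f w - f a) / (w - a))%C
  end.

Lemma quot_eq f a d : quot f a d a = d.
Proof. unfold quot. destruct (excluded_middle_informative (a = a)); tauto. Qed.

Lemma quot_ne f a d w : w <> a -> quot f a d w = ((f w - f a) / (w - a))%C.
Proof. unfold quot. destruct (excluded_middle_informative (w = a)); tauto. Qed.

Lemma sq_small a r w : 0 < r -> inrect (fst a - r / 4) (fst a + r / 4) (snd a - r / 4) (snd a + r / 4) w ->
  Cmod (w - a) < r.
Proof.
  intros Hr [W1 W2]. apply (Rle_lt_trans _ _ _ (Cmod_le_abs _)). simpl.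
  assert (Rabs (fst w + - fst a) <= r / 4) by (apply Rabs_le; lra).
  assert (Rabs (snd w + - snd a) <= r / 4) by (apply Rabs_le; lra). lra.
Qed.

Lemma inside_sq a r : 0 < r -> inside (fst a - r / 4) (fst a + r / 4) (snd a - r / 4) (snd a + r / 4) a.
Proof. unfold inside; lra. Qed.

(** Subtracting Cauchy's formulas at [v] and at [a] exhibits the quotient as the Cauchy transform of
    [f w / (w - a)], which is holomorphic at [a] as well. *)
Lemma quot_holo f a : near a (holo f) -> exists d, holo (quot f a d) a.
Proof.
  intros [r [Hr Hf]].
  set (x0 := fst a - r / 4). set (x1 := fst a + r / 4). set (y0 := snd a - r / 4). set (y1 := snd a + r / 4).
  assert (Ha : inside x0 x1 y0 y1 a) by now apply inside_sq.
  assert (Hh : forall w, inrect x0 x1 y0 y1 w -> holo f w) by (intros w Hw; apply Hf; now apply sq_small).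
  assert (Cc : forall w, bdrect x0 x1 y0 y1 w -> Ccont (fun w => f w / (w - a))%C w).
  { intros w Hw. apply Ccont_mult; [apply holo_cont, Hh, Hw|apply Ccont_inv_minus, (bd_ne _ _ _ _ _ _ Ha Hw)]. }
  set (g := fun v => (/ kappa * rectint (fun w => (f w / (w - a)) / (w - v)) x0 x1 y0 y1)%C).
  exists (g a). apply (holo_ext g).
  - eapply near_imp; [|exact (near_inside _ _ _ _ _ Ha)]. cbv beta; intros v Hv.
    destruct (classic (v = a)) as [->|N]; [now rewrite quot_eq|]. rewrite quot_ne //.
    pose proof (Cminus_neq_0 _ _ N) as N'. pose proof kappa_neq_0 as KN.
    unfold g.
    assert (E : (kappa * f v - kappa * f a)%C = ((v - a) * rectint (fun w => (f w / (w - a)) / (w - v)) x0 x1 y0 y1)%C).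
    { rewrite -(cauchy_formula f x0 x1 y0 y1 v) // -(cauchy_formula f x0 x1 y0 y1 a) //.
      assert (Cv : forall z, inside x0 x1 y0 y1 z -> forall w, bdrect x0 x1 y0 y1 w -> Ccont (fun w => f w / (w - z))%C w).
      { intros z Hz w Hw. apply Ccont_mult; [apply holo_cont, Hh, Hw|apply Ccont_inv_minus, (bd_ne _ _ _ _ _ _ Hz Hw)]. }
      rewrite -rectint_minus; auto; try (unfold x0, x1, y0, y1; lra).
      rewrite -rectint_scal; try (unfold x0, x1, y0, y1; lra).
      - apply rectint_ext; try (unfold x0, x1, y0, y1; lra). intros w Hw. 
        pose proof (Cminus_neq_0 _ _ (bd_ne _ _ _ _ _ _ Ha Hw)).
        pose proof (Cminus_neq_0 _ _ (bd_ne _ _ _ _ _ _ Hv Hw)). field; auto.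
      - intros w Hw. apply Ccont_mult; [auto|apply Ccont_inv_minus, (bd_ne _ _ _ _ _ _ Hv Hw)]. }
    assert (E2 : (f v - f a)%C = (/ kappa * (kappa * f v - kappa * f a))%C) by (field; auto).
    rewrite E2 E. field; auto.
  - apply holo_mult; [apply holo_const|]. eexists. apply cauchy_transform_hasd; auto.
Qed.

Lemma holo_factor_near f a : near a (holo f) -> f a = 0 ->
  exists g, near a (holo g) /\ near a (fun w => f w = (w - a) * g w)%C.
Proof.
  intros H E. destruct (quot_holo f a H) as [d Hd]. exists (quot f a d). split.
  - eapply near_imp; [|exact (near_near _ _ H)]. cbv beta; intros w Hw.
    destruct (classic (w = a)) as [->|N]; [exact Hd|].
    apply (holo_ext (fun w => (f w - f a) / (w - a))%C).
    { eapply near_imp; [|exact (near_ne _ _ N)]. cbv beta; intros v Hv. now rewrite quot_ne. }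
    apply holo_div; [apply holo_minus; [exact (near_self _ _ Hw)|apply holo_const]| |now apply Cminus_neq_0].
    apply holo_minus; [apply holo_id|apply holo_const].
  - exists 1; split; [lra|]. intros w _. destruct (classic (w = a)) as [->|N]; [rewrite E; ring|].
    rewrite quot_ne // E. field. now apply Cminus_neq_0.
Qed.

Lemma near_all (P : C -> Prop) z : (forall w, P w) -> near z P.
Proof. intros H; exists 1; split; [lra|auto]. Qed.

Lemma entire_factor f a : (forall z, holo f z) -> f a = 0 ->
  exists g, (forall z, holo g z) /\ forall z, f z = ((z - a) * g z)%C.
Proof.
  intros H E. destruct (quot_holo f a (near_all _ _ H)) as [d Hd]. exists (quot f a d). split.
  - intros w. destruct (classic (w = a)) as [->|N]; [exact Hd|].
    apply (holo_ext (fun w => (f w - f a) / (w - a))%C).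
    { eapply near_imp; [|exact (near_ne _ _ N)]. cbv beta; intros v Hv. now rewrite quot_ne. }
    apply holo_div; [apply holo_minus; [auto|apply holo_const]| |now apply Cminus_neq_0].
    apply holo_minus; [apply holo_id|apply holo_const].
  - intros w. destruct (classic (w = a)) as [->|N]; [rewrite E; ring|].
    rewrite quot_ne // E. field. now apply Cminus_neq_0.
Qed.

(** * The maximum principle and simple poles on the real axis *)

Lemma Cmod_pow (z : C) n : Cmod (z ^ n) = Cmod z ^ n.
Proof.
  induction n as [|n IH]; [apply Cmod_1|]. now rewrite Cpow_S Cmod_mult IH.
Qed.

(* Cauchy's formula for [f ^ n] bounds [Cmod (f z)] by [K ^ (1 / n) * M]. *)
Theorem max_principle f x0 x1 y0 y1 M z :
  (forall w, inrect x0 x1 y0 y1 w -> holo f w) ->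
  (forall w, bdrect x0 x1 y0 y1 w -> Cmod (f w) <= M) ->
  inrect x0 x1 y0 y1 z -> Cmod (f z) <= M.
Proof.
  intros Hf HM Hz.
  destruct (classic (bdrect x0 x1 y0 y1 z)) as [B|B]; [auto|].
  assert (Hi : inside x0 x1 y0 y1 z).
  { destruct Hz as [[Z1 Z2] [Z3 Z4]].
    assert (~ (fst z = x0 \/ fst z = x1 \/ snd z = y0 \/ snd z = y1)).
    { intros X; apply B. split; [split; lra|exact X]. }
    unfold inside. lra. }
  destruct (inside_margin _ _ _ _ _ Hi) as [d [Hd [_ [_ [_ [_ D]]]]]].
  assert (Hx : x0 <= x1) by (destruct Hi; lra). assert (Hy : y0 <= y1) by (destruct Hi; lra).
  assert (M0 : 0 <= M).
  { apply Rle_trans with (Cmod (f (x0, y0))); [apply Cmod_ge_0|]. apply HM. split; [split; simpl; lra|simpl; lra]. }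
  set (L := x1 - x0 + (y1 - y0)). pose proof (proj1 (Cmod_gt_0 _) kappa_neq_0) as HK.
  assert (P : forall n, Cmod kappa * Cmod (f z) ^ n <= 4 * (M ^ n * / d) * L).
  { intros n. rewrite -Cmod_pow -Cmod_mult. rewrite -(cauchy_formula (fun w => f w ^ n)%C x0 x1 y0 y1) //.
    2:{ intros w Hw; apply holo_pow; auto. }
    apply rectint_bound; auto.
    - intros w Hw. apply Ccont_mult; [apply holo_cont, holo_pow, Hf, Hw|].
      apply Ccont_inv_minus, (bd_ne _ _ _ _ _ _ Hi Hw).
    - intros w Hw. rewrite Cmod_div; [|apply Cminus_neq_0, (bd_ne _ _ _ _ _ _ Hi Hw)].
      rewrite Cmod_pow. specialize (D w Hw). apply Rmult_le_compat.
      + apply pow_le, Cmod_ge_0.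
      + left; apply Rinv_0_lt_compat; lra.
      + apply pow_incr. split; [apply Cmod_ge_0|auto].
      + apply Rinv_le_contravar; lra. }
  apply Rnot_lt_le. intros N. set (q := Cmod (f z)) in *. assert (Hq : 0 < q) by lra.
  assert (L0 : 0 <= L) by (unfold L; lra).
  assert (Q : 0 <= M / q < 1).
  { split; [apply Rdiv_le_0_compat; lra|]. apply (Rmult_lt_reg_r q); [lra|]. unfold Rdiv. rewrite Rmult_assoc Rinv_l; lra. }
  set (e := Cmod kappa * d / (4 * (L + 1))).
  assert (He : 0 < e) by (apply Rdiv_lt_0_compat; nra).
  destruct (pow_lt_1_zero (M / q)) with (y := e) as [n Hn]; [rewrite Rabs_pos_eq; lra|exact He|].
  specialize (Hn n (Nat.le_refl _)). specialize (P n).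
  rewrite Rabs_pos_eq in Hn; [|apply pow_le; lra].
  assert (Qn : 0 < q ^ n) by now apply pow_lt.
  unfold Rdiv in Hn. rewrite Rpow_mult_distr pow_inv in Hn.
  assert (Hn' : M ^ n < e * q ^ n).
  { apply (Rmult_lt_compat_r (q ^ n)) in Hn; [|exact Qn]. rewrite Rmult_assoc Rinv_l in Hn; lra. }
  assert (Hm : 0 <= M ^ n) by now apply pow_le.
  assert (4 * (M ^ n * / d) * L < 4 * (e * q ^ n * / d) * (L + 1)).
  { assert (0 < / d) by now apply Rinv_0_lt_compat.
    assert (M ^ n * / d < e * q ^ n * / d) by now apply Rmult_lt_compat_r.
    assert (0 <= M ^ n * / d) by nra. nra. }
  replace (4 * (e * q ^ n * / d) * (L + 1)) with (Cmod kappa * q ^ n) in H by (unfold e; field; lra).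
  lra.
Qed.

(* On the boundary of the square of half-side [eps] about [l] the weight
   [(w - l)^2 - eps^2] compensates the factor [1 / Im w]. *)
Lemma weight_bound (l : R) eps w : 0 < eps ->
  bdrect (l - eps) (l + eps) (- eps) eps w ->
  Cmod ((w - l) * (w - l) - eps * eps) <= 3 * eps * Rabs (snd w).
Proof.
  intros He [[W1 W2] W]. destruct w as [x y]. simpl in *.
  assert (Hx : Rabs (x - l) <= eps) by (apply Rabs_le; lra). assert (Hy : Rabs y <= eps) by (apply Rabs_le; lra).
  assert (V : forall s : R, s = eps \/ s = - eps -> x - l = s ->
     Cmod (((x, y) - l) * ((x, y) - l) - eps * eps) <= 3 * eps * Rabs y).
  { intros s Hs E.
    (* On a vertical side [w - l = s + i y] with [s^2 = eps^2], so the weight equals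
       [y (2 i s - y)]. *)
    replace (((x, y) - l) * ((x, y) - l) - eps * eps)%C with (RtoC y * ((- y)%R, (2 * s)%R))%C.
    - rewrite Cmod_mult Cmod_R (Rmult_comm (3 * eps)). apply Rmult_le_compat_l; [apply Rabs_pos|].
      apply (Rle_trans _ _ _ (Cmod_le_abs _)). simpl. rewrite Rabs_Ropp Rabs_mult (Rabs_pos_eq 2); [|lra].
      assert (Rabs s = eps) by (destruct Hs; subst s; [rewrite Rabs_pos_eq|rewrite Rabs_left]; lra). lra.
    - assert (x = l + s) by lra. subst x. unfold Cminus, Cplus, Copp, Cmult, RtoC; simpl.
      f_equal; destruct Hs; subst s; ring. }
  destruct W as [W|[W|W]]; [apply (V (- eps)); lra|apply (V eps); lra|].
  assert (Ey : Rabs y = eps) by (destruct W; subst y; [rewrite Rabs_left|rewrite Rabs_pos_eq]; lra).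
  rewrite Ey. apply (Rle_trans _ _ _ (Cmod_le_abs _)). simpl.
  assert (Y2 : y * y = eps * eps) by (rewrite -Ey; destruct (Rcase_abs y); [rewrite Rabs_left|rewrite Rabs_pos_eq]; lra).
  assert (E2 : (x - l) * (x - l) = Rabs (x - l) * Rabs (x - l)).
  { destruct (Rcase_abs (x - l)); [rewrite Rabs_left|rewrite Rabs_pos_eq]; lra. }
  pose proof (Rabs_pos (x - l)).
  assert (X2 : 0 <= (x - l) * (x - l) <= eps * eps) by (rewrite E2; nra).
  (* On a horizontal side, with [t = |x - l|], the claim is [2 eps^2 - t^2 + 2 t eps <= 3 eps^2],
     that is [(eps - t)^2 >= 0]; the 3 originates here. *)
  match goal with |- Rabs ?a + Rabs ?b <= _ =>
    replace a with ((x - l) * (x - l) - 2 * (eps * eps)) by lra;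
    replace b with (2 * ((x - l) * y)) by ring end.
  rewrite (Rabs_mult 2) (Rabs_pos_eq 2); [|lra]. rewrite Rabs_mult Ey.
  assert (0 < eps * eps) by nra. rewrite (Rabs_left ((x - l) * (x - l) - 2 * (eps * eps))); [|lra].
  nra.
Qed.

Lemma Rle_of_eps x K e0 : 0 < e0 -> (forall e, 0 < e < e0 -> x <= K * e) -> x <= 0.
Proof.
  intros He H. apply Rnot_lt_le. intros N.
  assert (A : 0 < Rabs K + 1) by (pose proof (Rabs_pos K); lra).
  set (e := Rmin (e0 / 2) (x / (2 * (Rabs K + 1)))).
  assert (E1 : 0 < x / (2 * (Rabs K + 1))) by (apply Rdiv_lt_0_compat; lra).
  assert (E2 : 0 < e) by (apply Rmin_pos; lra).
  assert (E3 : e <= e0 / 2) by apply Rmin_l. assert (E4 : e <= x / (2 * (Rabs K + 1))) by apply Rmin_r.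
  specialize (H e ltac:(lra)). 
  assert (K * e <= (Rabs K + 1) * e) by (apply Rmult_le_compat_r; [lra|pose proof (Rle_abs K); lra]).
  apply (Rmult_le_compat_l (Rabs K + 1)) in E4; [|lra].
  replace ((Rabs K + 1) * (x / (2 * (Rabs K + 1)))) with (x / 2) in E4 by (field; lra). lra.
Qed.

(* Cauchy's formula on a square annulus about [l], for [(w - l)^2 - e^2] times [f];
   the inner contribution vanishes as [e] tends to 0. *)
Lemma cauchy_weighted f (l : R) S K z :
  0 < S -> 0 <= K ->
  (forall w, inrect (l - S) (l + S) (- S) S w -> w <> RtoC l -> holo f w) ->
  (forall w, inrect (l - S) (l + S) (- S) S w -> Im w <> 0 -> Cmod (f w) <= K / Rabs (Im w)) ->
  inside (l - S) (l + S) (- S) S z -> z <> RtoC l ->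
  rectint (fun w => (w - l) * (w - l) * f w / (w - z))%C (l - S) (l + S) (- S) S
   = (kappa * ((z - l) * (z - l) * f z))%C.
Proof.
  intros HS HK Hf HB Hz Nz.
  set (dz := Cmod (z - l)). assert (Hdz : 0 < dz) by (apply Cmod_gt_0, Cminus_neq_0, Nz).
  assert (Sub : forall w, bdrect (l - S) (l + S) (- S) S w -> w <> RtoC l).
  { intros w [_ W] ->. simpl in W. lra. }
  set (X := (rectint (fun w => (w - l) * (w - l) * f w / (w - z)) (l - S) (l + S) (- S) S
     - kappa * ((z - l) * (z - l) * f z))%C).
  set (Y := (rectint (fun w => f w / (w - z)) (l - S) (l + S) (- S) S - kappa * f z)%C).
  assert (Hl : forall p, p <> RtoC l -> forall e : R, inrect (l - S) (l + S) (- S) S p ->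
     holo (fun w => f w * ((w - l) * (w - l) - e * e))%C p).
  { intros p Np e Hp. apply holo_mult; [now apply Hf|]. apply holo_minus; [|apply holo_const].
    apply holo_mult; apply holo_minus; (apply holo_id || apply holo_const). }
  (* [X] does not depend on [e], so a bound proportional to [e] makes it vanish. *)
  assert (MAIN : forall e, 0 < e < Rmin 1 (Rmin S (dz / 4)) ->
     Cmod X <= (Cmod Y + 96 * K / dz) * e).
  { intros e He. assert (e1 : e < 1) by (pose proof (Rmin_l 1 (Rmin S (dz / 4))); lra).
    assert (e2 : e < S).
    { pose proof (Rmin_r 1 (Rmin S (dz / 4))). pose proof (Rmin_l S (dz / 4)). lra. }
    assert (e3 : e < dz / 4).
    { pose proof (Rmin_r 1 (Rmin S (dz / 4))). pose proof (Rmin_r S (dz / 4)). lra. }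
    set (F := fun w => (f w * ((w - l) * (w - l) - e * e))%C).
    assert (HF : near z (holo F)).
    { eapply near_imp; [|exact (near_and _ _ _ (near_inside _ _ _ _ _ Hz) (near_ne _ _ Nz))].
      cbv beta; intros w [W1 W2]. apply Hl; [exact W2|now apply inside_inrect]. }
    (* [G] has no singularity at [z], which leaves the small square about [l] as the only hole. *)
    destruct (quot_holo F z HF) as [d Hd]. set (G := quot F z d) in *.
    assert (HG : forall w, inrect (l - S) (l + S) (- S) S w -> w <> RtoC l -> holo G w).
    { intros w W1 W2. destruct (classic (w = z)) as [->|N]; [exact Hd|].
      apply (holo_ext (fun w => (F w - F z) / (w - z))%C).
      { eapply near_imp; [|exact (near_ne _ _ N)]. cbv beta; intros v Hv. unfold G. now rewrite quot_ne. }
      apply holo_div; [apply holo_minus; [now apply Hl|apply holo_const]| |now apply Cminus_neq_0].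
      apply holo_minus; [apply holo_id|apply holo_const]. }
    assert (EG : rectint G (l - S) (l + S) (- S) S = rectint G (l - e) (l + e) (- e) e).
    { apply rectint_hole; try lra. intros w W1 W2. apply HG; [exact W1|]. intros ->. apply W2.
      unfold inside; simpl; lra. }
    assert (Hsz : forall w, inrect (l - e) (l + e) (- e) e w -> dz / 2 <= Cmod (w - z)).
    { intros w [W1 W2]. pose proof (Cmod_triangle (w - l) (z - w)) as T.
      replace (w - l + (z - w))%C with (z - l)%C in T by ring. fold dz in T. rewrite (Cmod_sym z) in T.
      assert (Cmod (w - l) <= dz / 2); [|lra].
      apply (Rle_trans _ _ _ (Cmod_le_abs _)). simpl.
      assert (Rabs (fst w + - l) <= e) by (apply Rabs_le; lra).
      assert (Rabs (snd w + - 0) <= e) by (apply Rabs_le; lra). lra. }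
    assert (SPLIT : forall a b c0 d0, a <= b -> c0 <= d0 ->
      (forall w, bdrect a b c0 d0 w -> Ccont F w /\ w <> z) ->
      rectint G a b c0 d0 = (rectint (fun w => F w / (w - z)) a b c0 d0
          - F z * rectint (fun w => / (w - z)) a b c0 d0)%C).
    { intros a b c0 d0 Hab Hcd Hw. rewrite -rectint_scal; auto.
      2:{ intros w W; apply Ccont_inv_minus, Hw, W. }
      rewrite -rectint_minus; auto.
      - apply rectint_ext; auto. intros w W. unfold G. rewrite quot_ne; [|apply Hw, W].
        pose proof (Cminus_neq_0 _ _ (proj2 (Hw w W))). field; auto.
      - intros w W. apply Ccont_mult; [apply Hw, W|apply Ccont_inv_minus, Hw, W].
      - intros w W. apply Ccont_mult; [apply Ccont_const|apply Ccont_inv_minus, Hw, W]. }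
    assert (EB : forall w, bdrect (l - S) (l + S) (- S) S w -> Ccont F w /\ w <> z).
    { intros w W. split; [|exact (bd_ne _ _ _ _ _ _ Hz W)]. apply holo_cont, Hl; [now apply Sub|apply W]. }
    assert (ES : forall w, bdrect (l - e) (l + e) (- e) e w -> Ccont F w /\ w <> z).
    { intros w W. split.
      - apply holo_cont, Hl.
        + destruct W as [_ W]. intros ->. simpl in W. lra.
        + destruct W as [[W1 W2] _]. split; lra.
      - intros ->. specialize (Hsz z (proj1 W)). rewrite Cmod_minus_diag in Hsz. lra. }
    rewrite (SPLIT (l - S) (l + S) (- S) S) in EG; try lra; auto.
    rewrite (SPLIT (l - e) (l + e) (- e) e) in EG; try lra; auto.
    assert (K1 : rectint (fun w => / (w - z))%C (l - S) (l + S) (- S) S = kappa).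
    { rewrite (rectint_ext (l - S) (l + S) (- S) S ltac:(lra) ltac:(lra) _ (fun w => 1 / (w - z))%C).
      - rewrite (cauchy_formula (fun _ => RtoC 1)) //; [ring|]. intros; apply holo_const.
      - intros w W. field. exact (Cminus_neq_0 _ _ (bd_ne _ _ _ _ _ _ Hz W)). }
    assert (K2 : rectint (fun w => / (w - z))%C (l - e) (l + e) (- e) e = 0).
    { apply goursat; try lra. intros w W. apply holo_inv.
      - apply holo_minus; [apply holo_id|apply holo_const].
      - apply Cminus_neq_0. intros ->. specialize (Hsz z W). rewrite Cmod_minus_diag in Hsz. lra. }
    rewrite K1 K2 in EG.
    set (J := rectint (fun w => F w / (w - z))%C (l - e) (l + e) (- e) e) in *.
    assert (BJ : Cmod J <= 4 * (3 * e * K / (dz / 2)) * (l + e - (l - e) + (e - - e))).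
    { apply rectint_bound; try lra.
      - intros w W. apply Ccont_mult; [apply ES, W|apply Ccont_inv_minus, ES, W].
      - intros w W. rewrite Cmod_div; [|apply Cminus_neq_0, ES, W].
        specialize (Hsz w (proj1 W)).
        apply Rmult_le_compat; [apply Cmod_ge_0|left; apply Rinv_0_lt_compat; lra| |apply Rinv_le_contravar; lra].
        unfold F. rewrite Cmod_mult.
        pose proof (weight_bound l e w ltac:(lra) W) as WB.
        (* Where the contour meets the real axis [HB] says nothing, but there the weight
           vanishes. *)
        destruct (Req_dec (Im w) 0) as [E0|E0].
        + unfold Im in E0. rewrite E0 Rabs_R0 Rmult_0_r in WB.
          pose proof (Cmod_ge_0 ((w - l) * (w - l) - e * e)).
          replace (Cmod ((w - l) * (w - l) - e * e)) with 0 by lra. nra.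
        + assert (HBw := HB w ltac:(destruct W as [[? ?] _]; split; lra) E0).
          assert (P : 0 < Rabs (Im w)) by now apply Rabs_pos_lt.
          apply Rle_trans with (K / Rabs (Im w) * (3 * e * Rabs (snd w))).
          * apply Rmult_le_compat; auto using Cmod_ge_0.
          * unfold Im in *. right. field. lra. }
    assert (EX : X = (e * e * Y + J)%C).
    { unfold X, Y.
      assert (Q : rectint (fun w => F w / (w - z))%C (l - S) (l + S) (- S) S =
        (rectint (fun w => (w - l) * (w - l) * f w / (w - z)) (l - S) (l + S) (- S) S
          - e * e * rectint (fun w => f w / (w - z)) (l - S) (l + S) (- S) S)%C).
      { assert (Cf : forall w, bdrect (l - S) (l + S) (- S) S w -> Ccont f w).
        { intros w W. apply holo_cont, Hf; [apply W|now apply Sub]. }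
        assert (C2 : forall w, bdrect (l - S) (l + S) (- S) S w -> Ccont (fun w => f w / (w - z))%C w).
        { intros w W. apply Ccont_mult; [auto|apply Ccont_inv_minus, EB, W]. }
        rewrite -rectint_scal; try lra; auto. rewrite -rectint_minus; try lra.
        - apply rectint_ext; try lra. intros w W. unfold F. field. apply Cminus_neq_0, EB, W.
        - intros w W. apply Ccont_mult; [|apply Ccont_inv_minus, EB, W].
          apply Ccont_mult; [|auto]. apply Ccont_mult; apply Ccont_minus; (apply Ccont_id || apply Ccont_const).
        - intros w W. apply Ccont_mult; [apply Ccont_const|auto]. }
      rewrite Q in EG.
      match type of EG with (?A - ?B - ?D = _)%C =>
        transitivity ((A - B - D) + B + D - kappa * ((z - l) * (z - l) * f z))%C; [ring|rewrite EG] end.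
      unfold F. ring. }
    rewrite EX. eapply Rle_trans; [apply Cmod_triangle|]. rewrite !Cmod_mult Cmod_R Rabs_pos_eq; [|lra].
    assert (0 <= Cmod Y) by apply Cmod_ge_0.
    assert (0 <= K / dz) by (apply Rdiv_le_0_compat; lra).
    replace (4 * (3 * e * K / (dz / 2)) * (l + e - (l - e) + (e - - e))) with (96 * (K / dz) * (e * e)) in BJ by (field; lra).
    replace ((Cmod Y + 96 * K / dz) * e) with (Cmod Y * e + 96 * (K / dz) * e) by (field; lra).
    assert (e * e <= e) by nra. nra. }
  assert (Z : Cmod X <= 0).
  { eapply Rle_of_eps; [|exact MAIN]. repeat apply Rmin_pos; lra. }
  pose proof (Cmod_ge_0 X). assert (X0 : X = 0) by (apply Cmod_eq_0; lra).
  unfold X in X0.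
  match type of X0 with (?A - ?B = _)%C => transitivity (A - B + B)%C; [ring|rewrite X0; ring] end.
Qed.

(** By [cauchy_weighted] the function [(w - l)^2 f] extends to [l] as a Cauchy transform [P].
    Approaching [l] vertically, [|P| <= y^2 * (K / y)], so [P l = 0] and one factor [w - l] splits
    off. *)
Lemma simple_pole f (l K : R) : 0 <= K ->
  near l (fun w => w <> RtoC l -> holo f w) ->
  (forall w, Im w <> 0 -> Cmod (f w) <= K / Rabs (Im w)) ->
  exists E, near l (holo E) /\ near l (fun w => w <> RtoC l -> E w = ((w - l) * f w)%C).
Proof.
  intros HK [r [Hr Hf]] HB. set (S := r / 4).
  assert (HS : 0 < S) by (unfold S; lra).
  assert (Hin : forall w, inrect (l - S) (l + S) (- S) S w -> Cmod (w - l) < r).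
  { intros w [W1 W2]. apply sq_small; [exact Hr|]. unfold S in *. split; simpl; lra. }
  assert (Hl : inside (l - S) (l + S) (- S) S (RtoC l)) by (unfold inside; simpl; lra).
  set (P := fun v => (/ kappa * rectint (fun w => (w - l) * (w - l) * f w / (w - v))%C (l - S) (l + S) (- S) S)%C).
  assert (HP : forall v, inside (l - S) (l + S) (- S) S v -> holo P v).
  { intros v Hv. apply holo_mult; [apply holo_const|]. eexists.
    apply (cauchy_transform_hasd (fun w => (w - l) * (w - l) * f w)%C); [exact Hv|].
    intros w W. apply Ccont_mult.
    - apply Ccont_mult; apply Ccont_minus; (apply Ccont_id || apply Ccont_const).
    - apply holo_cont, Hf; [apply Hin, W|]. exact (bd_ne _ _ _ _ _ _ Hl W). }
  assert (EP : forall v, inside (l - S) (l + S) (- S) S v -> v <> RtoC l -> P v = ((v - l) * (v - l) * f v)%C).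
  { intros v Hv Nv. unfold P. rewrite (cauchy_weighted f l S K v) //.
    - pose proof kappa_neq_0. field; auto.
    - intros w W1 W2. apply Hf; auto.
    - intros w W1 W2. now apply HB. }
  assert (P0 : P l = 0).
  { apply NNPP; intros N. pose proof (holo_cont _ _ (HP _ Hl)) as Cp.
    pose proof (proj1 (Cmod_gt_0 _) N) as Np.
    destruct (near_and _ _ _ (near_inside _ _ _ _ _ Hl) (Ccont_lower _ _ Cp N)) as [d [Hd Q]].
    set (y := Rmin (d / 2) (Cmod (P l) / (4 * (K + 1)))).
    assert (Y0 : 0 < Cmod (P l) / (4 * (K + 1))) by (apply Rdiv_lt_0_compat; lra).
    assert (Y1 : 0 < y) by (apply Rmin_pos; lra).
    assert (Y2 : y <= d / 2) by apply Rmin_l. assert (Y3 : y <= Cmod (P l) / (4 * (K + 1))) by apply Rmin_r.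
    assert (Ew : ((l, y) - l)%C = (0, y)) by (unfold Cminus, Cplus, Copp, RtoC; simpl; f_equal; ring).
    assert (My : Cmod (0, y) = y).
    { unfold Cmod; simpl. replace (0 * (0 * 1) + y * (y * 1)) with (y * y) by ring. apply sqrt_square; lra. }
    destruct (Q (l, y)) as [Q1 Q2]; [rewrite Ew My; lra|].
    assert (Nl : (l, y) <> RtoC l).
    { intros X. assert (Y : snd (l, y) = snd (RtoC l)) by now rewrite X. simpl in Y. lra. }
    rewrite (EP _ Q1 Nl) in Q2.
    assert (X : Cmod ((0, y) * (0, y) * f (l, y)) = y * y * Cmod (f (l, y))) by now rewrite !Cmod_mult My.
    rewrite Ew X in Q2.
    assert (B := HB (l, y)). simpl in B. rewrite Rabs_pos_eq in B; [|lra].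
    specialize (B ltac:(lra)).
    assert (y * y * Cmod (f (l, y)) <= y * K).
    { replace (y * K) with (y * y * (K / y)) by (field; lra). apply Rmult_le_compat_l; [nra|exact B]. }
    assert (y * (K + 1) <= Cmod (P l) / 4).
    { apply (Rmult_le_compat_r (K + 1)) in Y3; [|lra].
      replace (Cmod (P l) / (4 * (K + 1)) * (K + 1)) with (Cmod (P l) / 4) in Y3 by (field; lra). exact Y3. }
    lra. }
  assert (NP : near l (holo P)).
  { eapply near_imp; [|exact (near_inside _ _ _ _ _ Hl)]. exact HP. }
  destruct (holo_factor_near P l NP P0) as [g [Hg Eg]].
  exists g; split; [exact Hg|].
  eapply near_imp; [|exact (near_and _ _ _ Eg (near_inside _ _ _ _ _ Hl))]. cbv beta; intros w [A B] N.
  pose proof (Cminus_neq_0 _ _ N). rewrite EP // in A.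
  replace (g w) with (((w - l) * g w) / (w - l))%C by (field; auto). rewrite -A. field; auto.
Qed.

(** * Exponential and logarithm *)

Definition Cexp (z : C) : C := (exp (fst z) * cos (snd z), exp (fst z) * sin (snd z)).

Lemma Cexp_plus z w : Cexp (z + w) = (Cexp z * Cexp w)%C.
Proof.
  unfold Cexp, Cplus, Cmult; simpl. rewrite exp_plus cos_plus sin_plus. f_equal; ring.
Qed.

Lemma Cexp_0 : Cexp 0 = 1.
Proof. unfold Cexp; simpl. rewrite exp_0 cos_0 sin_0. unfold RtoC. f_equal; ring. Qed.

Lemma Cmod_Cexp z : Cmod (Cexp z) = exp (fst z).
Proof.
  unfold Cmod, Cexp; simpl.
  replace (exp (fst z) * cos (snd z) * (exp (fst z) * cos (snd z) * 1)
    + exp (fst z) * sin (snd z) * (exp (fst z) * sin (snd z) * 1))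
    with ((exp (fst z) * exp (fst z)) * (Rsqr (sin (snd z)) + Rsqr (cos (snd z)))) by (unfold Rsqr; ring).
  rewrite sin2_cos2 Rmult_1_r. apply sqrt_square. left; apply exp_pos.
Qed.

Lemma derivable_pt_lim_le f x l eps : 0 < eps -> derivable_pt_lim f x l ->
  exists d, 0 < d /\ forall h, Rabs h < d -> Rabs (f (x + h) - f x - l * h) <= eps * Rabs h.
Proof.
  intros He H. destruct (H eps He) as [d K]. exists d; split; [apply cond_pos|]. intros h Hh.
  destruct (Req_dec h 0) as [->|N].
  - rewrite Rplus_0_r. replace (f x - f x - l * 0) with 0 by ring. rewrite !Rabs_R0. lra.
  - specialize (K h N Hh). replace (f (x + h) - f x - l * h) with (((f (x + h) - f x) / h - l) * h) by (field; auto).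
    rewrite Rabs_mult. apply Rmult_le_compat_r; [apply Rabs_pos|lra].
Qed.

Lemma Cexp_hasd_0 : hasd Cexp 0 1.
Proof.
  apply hasd_eps. intros eps He.
  (* The two components of the remainder turn out to be at most [4 e m] and [5 e m], with [m] the
     modulus of the increment; any constant from 9 on would do for 16. *)
  set (e := Rmin (eps / 16) 1). assert (E0 : 0 < e) by (apply Rmin_pos; lra).
  assert (E1 : e <= eps / 16) by apply Rmin_l. assert (E2 : e <= 1) by apply Rmin_r.
  destruct (derivable_pt_lim_le exp 0 1 e E0) as [d1 [D1 K1]].
  { pose proof (derivable_pt_lim_exp 0) as X. now rewrite exp_0 in X. }
  destruct (derivable_pt_lim_le cos 0 0 e E0) as [d2 [D2 K2]].
  { pose proof (derivable_pt_lim_cos 0) as X. now rewrite sin_0 Ropp_0 in X. }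
  destruct (derivable_pt_lim_le sin 0 1 e E0) as [d3 [D3 K3]].
  { pose proof (derivable_pt_lim_sin 0) as X. now rewrite cos_0 in X. }
  set (d := Rmin e (Rmin d1 (Rmin d2 d3))).
  exists d; split; [unfold d; repeat apply Rmin_pos; lra|]. intros [x y] Hw.
  assert (Hd : d <= e /\ d <= d1 /\ d <= d2 /\ d <= d3) by (unfold d, Rmin; repeat destruct (Rle_dec _ _); lra).
  replace ((x, y) - 0)%C with ((x, y) : C) in * by (unfold Cminus, Cplus, Copp, RtoC; simpl; f_equal; ring).
  set (m := Cmod (x, y)) in *.
  pose proof (fst_le_Cmod (x, y)) as P. pose proof (snd_le_Cmod (x, y)) as Q. fold m in P, Q. simpl in P, Q.
  specialize (K1 x ltac:(lra)). specialize (K2 y ltac:(lra)). specialize (K3 y ltac:(lra)).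
  rewrite exp_0 Rplus_0_l Rmult_1_l in K1. rewrite cos_0 Rplus_0_l Rmult_0_l Rminus_0_r in K2.
  rewrite sin_0 Rplus_0_l Rmult_1_l Rminus_0_r in K3.
  rewrite Cexp_0. apply (Rle_trans _ _ _ (Cmod_le_abs _)). simpl.
  set (A := exp x - 1 - x) in *. set (B := cos y - 1) in *. set (D := sin y - y) in *.
  match goal with |- Rabs ?a + Rabs ?b <= _ =>
    replace a with (A + (1 + x + A) * B) by (unfold A, B; ring);
    replace b with (D + (x + A) * (y + D)) by (unfold A, D; ring) end.
  assert (Hm : 0 <= m) by apply Cmod_ge_0.
  pose proof (Rabs_pos x). pose proof (Rabs_pos y).
  assert (A1 : Rabs A <= e * m) by nra. assert (B1 : Rabs B <= e * m) by nra. assert (D1' : Rabs D <= e * m) by nra.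
  assert (EM : 0 <= e * m <= 1) by nra.
  assert (T1 : Rabs (A + (1 + x + A) * B) <= e * m + 3 * (e * m)).
  { eapply Rle_trans; [apply Rabs_triang|]. rewrite Rabs_mult.
    assert (Rabs (1 + x + A) <= 3).
    { eapply Rle_trans; [apply Rabs_triang|]. pose proof (Rabs_triang 1 x). rewrite Rabs_R1 in H1. lra. }
    pose proof (Rabs_pos B). pose proof (Rabs_pos (1 + x + A)). nra. }
  assert (T2 : Rabs (D + (x + A) * (y + D)) <= e * m + 4 * (e * m)).
  { eapply Rle_trans; [apply Rabs_triang|]. rewrite Rabs_mult.
    assert (Rabs (x + A) <= 2 * m) by (eapply Rle_trans; [apply Rabs_triang|]; nra).
    assert (Rabs (y + D) <= 2 * m) by (eapply Rle_trans; [apply Rabs_triang|]; nra).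
    pose proof (Rabs_pos (x + A)). pose proof (Rabs_pos (y + D)).
    assert (Rabs (x + A) * Rabs (y + D) <= 2 * m * (2 * m)) by (apply Rmult_le_compat; lra).
    nra. }
  nra.
Qed.

Lemma Cexp_hasd z : hasd Cexp z (Cexp z).
Proof.
  apply (hasd_ext (fun w => Cexp z * Cexp (w - z))%C).
  { apply near_all. intros w. rewrite -Cexp_plus. f_equal; ring. }
  eapply hasd_eq; [|apply hasd_mult; [apply hasd_const|]].
  2:{ apply hasd_comp.
      - apply (hasd_plus _ (fun _ => - z)%C); [apply hasd_id|apply hasd_const].
      - replace (z - z)%C with (RtoC 0) by ring. exact Cexp_hasd_0. }
  cbv beta. ring.
Qed.

Lemma Cexp_holo z : holo Cexp z.
Proof. exact (hasd_holo _ _ _ (Cexp_hasd z)). Qed.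

(** [primitive] compares points lying in any direction from each other, so the corners come
    unordered. *)
Lemma goursat_oriented f x0 x1 y0 y1 a b c d :
  (forall w, inrect x0 x1 y0 y1 w -> holo f w) ->
  x0 <= a <= x1 -> x0 <= b <= x1 -> y0 <= c <= y1 -> y0 <= d <= y1 -> rectint f a b c d = 0.
Proof.
  intros Hf Ha Hb Hc Hd.
  assert (Eh : forall y u v, y0 <= y <= y1 -> x0 <= u <= x1 -> x0 <= v <= x1 -> u <= v -> exC (fun t => f (t, y)) u v).
  { intros y u v ? ? ? ?. apply (exC_h f y); [lra|]. intros t Ht. apply holo_cont, Hf. split; simpl; lra. }
  assert (Ev : forall x u v, x0 <= x <= x1 -> y0 <= u <= y1 -> y0 <= v <= y1 -> u <= v -> exC (fun t => f (x, t)) u v).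
  { intros x u v ? ? ? ?. apply (exC_v f x); [lra|]. intros t Ht. apply holo_cont, Hf. split; simpl; lra. }
  assert (G1 : forall u v c d, x0 <= u <= x1 -> x0 <= v <= x1 -> u <= v -> y0 <= c <= y1 -> y0 <= d <= y1 ->
      rectint f u v c d = 0).
  { intros u v e g Hu Hv Huv He Hg. destruct (Rle_dec e g) as [L|L].
    - apply goursat; try lra. intros w [W1 W2]. apply Hf. split; lra.
    - assert (E : rectint f u v g e = 0).
      { apply goursat; try lra. intros w [W1 W2]. apply Hf. split; lra. }
      revert E. unfold rectint. 
      rewrite (CInt_swap (fun t => f (v, t)) e g); [|apply (Ev v); lra].
      rewrite (CInt_swap (fun t => f (u, t)) e g); [|apply (Ev u); lra].
      intros E. match type of E with ?A = _ => transitivity (- A)%C end; [ring|rewrite E; ring]. }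
  destruct (Rle_dec a b) as [L|L]; [now apply G1|].
  assert (E : rectint f b a c d = 0) by (apply G1; lra).
  revert E. unfold rectint.
  rewrite (CInt_swap (fun t => f (t, c)) a b); [|apply (Eh c); lra].
  rewrite (CInt_swap (fun t => f (t, d)) a b); [|apply (Eh d); lra].
  intros E. match type of E with ?A = _ => transitivity (- A)%C end; [ring|rewrite E; ring].
Qed.

Lemma CInt_near_const f z r eps u v : 0 <= eps ->
  (forall w, Cmod (w - z) < r -> Cmod (f w - f z) <= eps /\ Ccont f w) ->
  (forall (g : R -> C), (forall t, Rmin u v <= t <= Rmax u v -> Cmod (g t - z) < r) ->
     pcont_on g u v ->
     Cmod (CInt (fun t => f (g t)) u v - f z * RtoC (v - u)) <= 2 * eps * Rabs (v - u)).
Proof.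
  intros He H g Hg Cg.
  assert (Ef : exC (fun t => f (g t)) u v).
  { apply pcont_exC. intros t Ht. apply pcont_comp; [now apply Cg|now apply H, Hg]. }
  assert (Ec : exC (fun _ => f z) u v).
  { apply pcont_exC. intros t Ht e Hpe. exists 1; split; [lra|]. intros; now rewrite Cmod_minus_diag. }
  assert (E : (f z * RtoC (v - u))%C = CInt (fun _ => f z) u v).
  { unfold CInt. rewrite !RInt_const. unfold scal, Cmult, RtoC; simpl. unfold mult; simpl. f_equal; ring. }
  rewrite E -CInt_minus //. apply CInt_bound.
  - apply pcont_exC. intros t Ht e Hpe.
    destruct (pcont_comp f g t (Cg t Ht) (proj2 (H _ (Hg t Ht))) e Hpe) as [d [Hd K]].
    exists d; split; [exact Hd|]. intros s Hs. replace (f (g s) - f z - (f (g t) - f z))%C with (f (g s) - f (g t))%C by ring.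
    now apply K.
  - intros t Ht. now apply H, Hg.
Qed.

(** The candidate integrates along the bottom side and then upwards. Cauchy's theorem moves the
    horizontal part of the increment from height [y0] to that of [z], where [f] is almost
    constant. *)
Lemma primitive f x0 x1 y0 y1 : x0 < x1 -> y0 < y1 ->
  (forall w, inrect x0 x1 y0 y1 w -> holo f w) ->
  exists P, forall z, inside x0 x1 y0 y1 z -> hasd P z (f z).
Proof.
  intros Hx Hy Hf.
  exists (fun z => CInt (fun t => f (t, y0)) x0 (fst z) + Ci * CInt (fun t => f (fst z, t)) y0 (snd z))%C.
  intros z Hz. apply hasd_eps. intros eps He.
  assert (Hi := inside_inrect _ _ _ _ _ Hz).
  destruct (near_and _ _ _ (near_inside _ _ _ _ _ Hz) (holo_cont _ _ (Hf z Hi) (eps / 4) ltac:(lra))) as [r [Hr K]].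
  exists (r / 2); split; [lra|]. intros [x' y'] Hw. destruct z as [x y]. simpl fst. simpl snd.
  assert (Hw' : Cmod ((x', y') - (x, y)) < r) by lra.
  destruct (K _ Hw') as [[Kx Ky] _]. simpl in Kx, Ky. destruct Hz as [Zx Zy]. simpl in Zx, Zy.
  pose proof (fst_le_Cmod ((x', y') - (x, y))) as P1. pose proof (snd_le_Cmod ((x', y') - (x, y))) as P2.
  simpl in P1, P2. set (m := Cmod ((x', y') - (x, y))) in *.
  assert (Eh : forall y u v, y0 <= y <= y1 -> x0 <= u <= x1 -> x0 <= v <= x1 -> exC (fun t => f (t, y)) u v).
  { intros yy u v ? ? ?. apply pcont_exC. intros t Ht. apply (pcont_comp f (fun t => (t, yy))); [apply pcont_h|].
    apply holo_cont, Hf. unfold Rmin, Rmax in Ht. split; simpl; destruct (Rle_dec u v); lra. }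
  assert (Ev : forall x u v, x0 <= x <= x1 -> y0 <= u <= y1 -> y0 <= v <= y1 -> exC (fun t => f (x, t)) u v).
  { intros xx u v ? ? ?. apply pcont_exC. intros t Ht. apply (pcont_comp f (fun t => (xx, t))); [apply pcont_v|].
    apply holo_cont, Hf. unfold Rmin, Rmax in Ht. split; simpl; destruct (Rle_dec u v); lra. }
  pose proof (goursat_oriented f x0 x1 y0 y1 x x' y0 y Hf ltac:(lra) ltac:(lra) ltac:(lra) ltac:(lra)) as G.
  unfold rectint in G.
  rewrite -(CInt_Chasles (fun t => f (t, y0)) x0 x x'); try (apply Eh; lra).
  rewrite -(CInt_Chasles (fun t => f (x', t)) y0 y y'); try (apply Ev; lra).
  set (A := CInt (fun t => f (t, y)) x x') in *. set (B := CInt (fun t => f (x', t)) y y') in *.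
  match goal with |- Cmod ?T <= _ => replace T with ((A - f (x, y) * RtoC (x' - x)) + Ci * (B - f (x, y) * RtoC (y' - y)))%C end.
  2:{ replace ((x', y') - (x, y))%C with (RtoC (x' - x) + Ci * RtoC (y' - y))%C
        by (unfold Cminus, Cplus, Copp, RtoC, Cmult; simpl; f_equal; ring).
      match type of G with ?T = _ => 
      match goal with |- _ = ?U => transitivity (U - T)%C; [ring|rewrite G; ring] end end. }
  assert (NC : forall w, Cmod (w - (x, y)) < r -> Cmod (f w - f (x, y)) <= eps / 4 /\ Ccont f w).
  { intros w Hwr. destruct (K w Hwr) as [K1 K2]. split; [lra|]. apply holo_cont, Hf, inside_inrect, K1. }
  assert (HA : Cmod (A - f (x, y) * RtoC (x' - x)) <= 2 * (eps / 4) * Rabs (x' - x)).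
  { apply (CInt_near_const f (x, y) r (eps / 4) x x' ltac:(lra) NC (fun t => (t, y))).
    - intros t Ht. apply (Rle_lt_trans _ _ _ (Cmod_le_abs _)). simpl.
      replace (y + - y) with 0 by ring. rewrite Rabs_R0.
      assert (Rabs (t + - x) <= Rabs (x' + - x)); [|lra].
      unfold Rmin, Rmax in Ht. destruct (Rle_dec x x');
       [rewrite !Rabs_pos_eq; lra | rewrite (Rabs_left (x' + - x)); [|lra]; apply Rabs_le; lra].
    - intros t _; apply pcont_h. }
  assert (HB : Cmod (B - f (x, y) * RtoC (y' - y)) <= 2 * (eps / 4) * Rabs (y' - y)).
  { apply (CInt_near_const f (x, y) r (eps / 4) y y' ltac:(lra) NC (fun t => (x', t))).
    - intros t Ht. apply (Rle_lt_trans _ _ _ (Cmod_le_abs _)). simpl.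
      assert (Rabs (t + - y) <= Rabs (y' + - y)); [|lra].
      unfold Rmin, Rmax in Ht. destruct (Rle_dec y y');
       [rewrite !Rabs_pos_eq; lra | rewrite (Rabs_left (y' + - y)); [|lra]; apply Rabs_le; lra].
    - intros t _; apply pcont_v. }
  eapply Rle_trans; [apply Cmod_triangle|]. rewrite Cmod_mult.
  replace (Cmod Ci) with 1.
  2:{ unfold Cmod; simpl. replace (0 * (0 * 1) + 1 * (1 * 1)) with 1 by ring. now rewrite sqrt_1. }
  unfold Rminus in *. nra.
Qed.

Lemma hasd_0_const P x0 x1 y0 y1 z w : (forall v, inside x0 x1 y0 y1 v -> hasd P v 0) ->
  inside x0 x1 y0 y1 z -> inside x0 x1 y0 y1 w -> P z = P w.
Proof.
  intros H Hz Hw. destruct z as [x y]. destruct w as [x' y'].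
  destruct Hz as [Zx Zy]. destruct Hw as [Wx Wy]. simpl in *.
  assert (C0 : forall a b, CInt (fun _ => RtoC 0) a b = 0).
  { intros a b. unfold CInt, RtoC. simpl. rewrite !RInt_const. unfold scal; simpl; unfold mult; simpl. f_equal; ring. }
  assert (E1 := CInt_FTC_h P (fun _ => RtoC 0) y x x').
  assert (E2 := CInt_FTC_v P (fun _ => RtoC 0) x' y y').
  rewrite C0 in E1. rewrite C0 in E2.
  assert (F1 : RtoC 0 = (P (x', y) - P (x, y))%C).
  { apply E1; intros t Ht; [apply H|apply Ccont_const]. unfold Rmin, Rmax in Ht.
    split; simpl; destruct (Rle_dec x x'); lra. }
  assert (F2 : (Ci * 0)%C = (P (x', y') - P (x', y))%C).
  { apply E2; intros t Ht; [apply H|apply Ccont_const]. unfold Rmin, Rmax in Ht.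
    split; simpl; destruct (Rle_dec y y'); lra. }
  transitivity (P (x', y') - (P (x', y') - P (x', y)) - (P (x', y) - P (x, y)))%C; [ring|].
  rewrite -F1 -F2. ring.
Qed.

Lemma holo_deriv f x0 x1 y0 y1 : (forall w, inrect x0 x1 y0 y1 w -> holo f w) ->
  exists D, forall z, inside x0 x1 y0 y1 z -> hasd f z (D z) /\ holo D z.
Proof.
  intros Hf.
  assert (Cf : forall w, bdrect x0 x1 y0 y1 w -> Ccont f w) by (intros w W; apply holo_cont, Hf, W).
  exists (fun v => / kappa * rectint (fun w => f w / ((w - v) * (w - v))) x0 x1 y0 y1)%C.
  intros z Hz. split.
  - eapply hasd_eq; [|apply (hasd_ext (fun v => / kappa * rectint (fun w => f w / (w - v)) x0 x1 y0 y1)%C)].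
    3:{ apply hasd_mult; [apply hasd_const|]. apply (cauchy_transform_hasd f x0 x1 y0 y1 z); auto. }
    + cbv beta; ring.
    + eapply near_imp; [|exact (near_inside _ _ _ _ _ Hz)]. cbv beta; intros v Hv.
      rewrite (cauchy_formula f) //. pose proof kappa_neq_0. field; auto.
  - apply holo_mult; [apply holo_const|]. now apply cauchy_transform2_holo.
Qed.

(** Squares take the role of discs, since all contours are rectangles. *)
Definition sq (T : R) : C -> Prop := inrect (- T) T (- T) T.

Lemma sq_0 T : 0 <= T -> sq T 0.
Proof. intros; split; simpl; lra. Qed.

(** [P] is a primitive of [f' / f], and [f exp(- P)] has derivative 0. The half-sides [2 T],
    [3 / 2 T] and [T] leave room first for differentiating and then for integrating. *)
Lemma holo_log f T : 0 < T -> (forall z, sq (2 * T) z -> holo f z /\ f z <> 0) ->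
  exists L : C -> C, L 0 = 0 /\ forall z, sq T z -> holo L z /\ f z = (f 0 * Cexp (L z))%C.
Proof.
  intros HT H.
  assert (S2 : forall a z, a <= 2 * T -> sq a z -> sq (2 * T) z) by (intros a z Ha [Z1 Z2]; split; lra).
  destruct (holo_deriv f (- (2 * T)) (2 * T) (- (2 * T)) (2 * T)) as [D HD]; [intros w W; now apply H|].
  assert (I2 : forall a z, a < 2 * T -> sq a z -> inside (- (2 * T)) (2 * T) (- (2 * T)) (2 * T) z).
  { intros a z Ha [Z1 Z2]. unfold inside. lra. }
  destruct (primitive (fun z => D z / f z)%C (- (3 / 2 * T)) (3 / 2 * T) (- (3 / 2 * T)) (3 / 2 * T)) as [P HP]; try lra.
  { intros w W. assert (W2 := I2 (3 / 2 * T) w ltac:(lra) W). apply holo_div; [now apply HD| |].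
    - exists (D w). now apply HD.
    - apply H, inside_inrect, W2. }
  exists (fun z => P z - P 0)%C. split; [ring|]. intros z Hz.
  assert (Iz : inside (- (3 / 2 * T)) (3 / 2 * T) (- (3 / 2 * T)) (3 / 2 * T) z) by (destruct Hz; unfold inside; lra).
  assert (I0 : inside (- (3 / 2 * T)) (3 / 2 * T) (- (3 / 2 * T)) (3 / 2 * T) 0) by (unfold inside; simpl; lra).
  split; [apply holo_minus; [exists (D z / f z)%C; now apply HP|apply holo_const]|].
  rewrite Cexp_plus. 
  assert (K : (f z * Cexp (- P z))%C = (f 0 * Cexp (- P 0))%C).
  { apply (hasd_0_const (fun w => f w * Cexp (- P w))%C (- (3 / 2 * T)) (3 / 2 * T) (- (3 / 2 * T)) (3 / 2 * T)); auto.
    intros v Hv. assert (V2 : inside (- (2 * T)) (2 * T) (- (2 * T)) (2 * T) v) by (destruct Hv; unfold inside; lra).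
    eapply hasd_eq; [|apply hasd_mult; [now apply HD|]].
    2:{ apply (hasd_comp Cexp (fun w => - P w)%C); [|apply Cexp_hasd].
        apply (hasd_ext (fun w => (-(1)) * P w)%C); [apply near_all; intros; ring|].
        apply hasd_mult; [apply hasd_const|now apply HP]. }
    cbv beta. assert (f v <> 0) by now apply H, inside_inrect. field; auto. }
  rewrite (Cmult_comm (Cexp (P z))) Cmult_assoc -K -Cmult_assoc -Cexp_plus.
  replace (- P z + P z)%C with (RtoC 0) by ring. rewrite Cexp_0. ring.
Qed.

(** * Growth of entire functions *)

Lemma near_sq T : 0 < T -> near 0 (sq T).
Proof.
  intros HT. assert (I0 : inside (- T) T (- T) T 0) by (unfold inside; simpl; lra).
  eapply near_imp; [|exact (near_inside _ _ _ _ _ I0)]. intros w; apply inside_inrect.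
Qed.

Lemma sq_Cmod T z : sq T z -> Cmod z <= 2 * T.
Proof.
  intros [Z1 Z2]. apply (Rle_trans _ _ _ (Cmod_le_abs _)).
  assert (Rabs (fst z) <= T) by (apply Rabs_le; lra). assert (Rabs (snd z) <= T) by (apply Rabs_le; lra). lra.
Qed.

Lemma Cmod_sq T z : Cmod z <= T -> sq T z.
Proof.
  intros H. pose proof (fst_le_Cmod z) as P. pose proof (snd_le_Cmod z) as Q.
  assert (P' : Rabs (fst z) <= T) by lra. assert (Q' : Rabs (snd z) <= T) by lra.
  apply Rabs_le_between in P'. apply Rabs_le_between in Q'. split; lra.
Qed.

Lemma bd_sq_Cmod T z : bdrect (- T) T (- T) T z -> T <= Cmod z.
Proof.
  intros [_ H]. pose proof (fst_le_Cmod z) as P. pose proof (snd_le_Cmod z) as Q.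
  pose proof (Rle_abs (fst z)). pose proof (Rle_abs (snd z)).
  pose proof (Rle_abs (- fst z)) as P2. pose proof (Rle_abs (- snd z)) as Q2. rewrite Rabs_Ropp in P2. rewrite Rabs_Ropp in Q2.
  destruct H as [H|[H|[H|H]]]; lra.
Qed.

(** Since [Re L <= A], the function [g = L / (2 A - L)] maps into the unit disc, and Schwarz's lemma
    on the square gives [|g z| <= |z| / T]. On the square of half-side [T / 4] this is at most 1/2;
    solving for [L] gives [2 A]. *)
Lemma borel_caratheodory (L : C -> C) T A : 0 < T -> 0 < A -> L 0 = 0 ->
  (forall z, sq T z -> holo L z /\ fst (L z) <= A) ->
  forall z, sq (T / 4) z -> Cmod (L z) <= 2 * A.
Proof.
  intros HT HA L0 H.
  assert (Nd : forall z, sq T z -> (2 * A - L z <> 0)%C).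
  { intros z Hz X. assert (Y : fst (2 * A - L z)%C = 0) by now rewrite X. simpl in Y.
    pose proof (proj2 (H z Hz)). lra. }
  set (g := fun z => (L z / (2 * A - L z))%C).
  assert (Hg : forall z, sq T z -> holo g z).
  { intros z Hz. apply holo_div; [now apply H| |now apply Nd]. apply holo_minus; [apply holo_const|now apply H]. }
  assert (Bg : forall z, sq T z -> Cmod (g z) <= 1).
  { intros z Hz. unfold g. rewrite Cmod_div; [|now apply Nd].
    pose proof (proj1 (Cmod_gt_0 _) (Nd z Hz)) as P. apply (Rmult_le_reg_r (Cmod (2 * A - L z))); [exact P|].
    unfold Rdiv. rewrite Rmult_assoc Rinv_l; [|lra]. rewrite Rmult_1_r Rmult_1_l.
    unfold Cmod. apply sqrt_le_1_alt. simpl. pose proof (proj2 (H z Hz)). nra. }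
  destruct (quot_holo g 0) as [d Hd].
  { eapply near_imp; [|exact (near_sq T HT)]. auto. }
  assert (g0 : g 0 = 0) by (unfold g; rewrite L0; unfold Cdiv; ring).
  assert (Hq : forall z, sq T z -> holo (quot g 0 d) z).
  { intros z Hz. destruct (classic (z = 0)) as [->|N]; [exact Hd|].
    apply (holo_ext (fun w => (g w - g 0) / (w - 0))%C).
    { eapply near_imp; [|exact (near_ne _ _ N)]. cbv beta; intros v Hv. now rewrite quot_ne. }
    apply holo_div; [apply holo_minus; [now apply Hg|apply holo_const]| |now apply Cminus_neq_0].
    apply holo_minus; [apply holo_id|apply holo_const]. }
  assert (Bq : forall z, sq T z -> Cmod (quot g 0 d z) <= / T).
  { intros z Hz. apply (max_principle _ (- T) T (- T) T); auto.
    intros w W. pose proof (bd_sq_Cmod _ _ W) as D.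
    assert (N : w <> 0) by (apply (Cmod_pos_ne _ T); auto).
    rewrite quot_ne // g0. replace ((g w - 0) / (w - 0))%C with (g w / w)%C by (field; auto).
    rewrite Cmod_div //. specialize (Bg w (proj1 W)).
    rewrite -(Rmult_1_l (/ T)). apply Rmult_le_compat; auto using Cmod_ge_0.
    - left; apply Rinv_0_lt_compat; lra.
    - apply Rinv_le_contravar; lra. }
  intros z Hz. assert (Hz' : sq T z) by (destruct Hz; split; lra).
  assert (G : Cmod (g z) <= 1 / 2).
  { destruct (classic (z = 0)) as [->|N]; [rewrite g0 Cmod_0; lra|].
    specialize (Bq z Hz'). rewrite quot_ne // g0 in Bq.
    replace ((g z - 0) / (z - 0))%C with (g z / z)%C in Bq by (field; auto).
    rewrite Cmod_div // in Bq. pose proof (proj1 (Cmod_gt_0 _) N) as P.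
    apply (Rmult_le_compat_r (Cmod z)) in Bq; [|lra].
    unfold Rdiv in Bq. rewrite Rmult_assoc Rinv_l in Bq; [|lra].
    pose proof (sq_Cmod _ _ Hz). apply Rle_trans with (/ T * (2 * (T / 4))).
    - rewrite Rmult_1_r in Bq. apply (Rle_trans _ _ _ Bq). apply Rmult_le_compat_l; [|lra].
      left; apply Rinv_0_lt_compat; lra.
    - right; field; lra. }
  assert (E : L z = (g z * (2 * A - L z))%C) by (unfold g; field; now apply Nd).
  assert (Cmod (L z) <= 1 / 2 * (2 * A + Cmod (L z))).
  { rewrite {1}E Cmod_mult. apply Rmult_le_compat; auto using Cmod_ge_0.
    unfold Cminus. eapply Rle_trans; [apply Cmod_triangle|].
    rewrite Cmod_opp Cmod_mult !Cmod_R !Rabs_pos_eq; lra. }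
  lra.
Qed.

(** The logarithm [L] satisfies [Re L <= ln (M / q)], and Borel-Caratheodory turns this one-sided
    bound into a two-sided one. The [+ 1] keeps the constant positive when [M = q]. *)
Lemma zero_free_lower_bound (f : C -> C) T M q : 0 < T -> 0 < q -> q <= Cmod (f 0) ->
  (forall z, sq (2 * T) z -> holo f z /\ f z <> 0) -> (forall z, sq T z -> Cmod (f z) <= M) ->
  forall z, sq (T / 4) z -> q * exp (- (2 * (ln (M / q) + 1))) <= Cmod (f z).
Proof.
  intros HT Hq H0 Hf HM z Hz.
  destruct (holo_log f T HT Hf) as [L [L0 HL]].
  assert (S0 : sq T 0) by (apply sq_0; lra).
  assert (Mq : q <= M) by (specialize (HM 0 S0); lra).
  assert (MQ : 1 <= M / q).
  { apply (Rmult_le_reg_r q); [exact Hq|]. unfold Rdiv. rewrite Rmult_assoc Rinv_l; lra. }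
  assert (LN : 0 <= ln (M / q)).
  { rewrite -ln_1. destruct MQ as [MQ|<-]; [left; apply ln_increasing; lra|lra]. }
  assert (B : forall v, sq T v -> holo L v /\ fst (L v) <= ln (M / q) + 1).
  { intros v Hv. destruct (HL v Hv) as [A E]. split; [exact A|].
    specialize (HM v Hv). rewrite E Cmod_mult Cmod_Cexp in HM.
    apply Rnot_lt_le. intros N.
    assert (exp (ln (M / q)) < exp (fst (L v))) by (apply exp_increasing; lra).
    rewrite exp_ln in H; [|lra].
    assert (q * (M / q) < Cmod (f 0) * exp (fst (L v))).
    { apply Rlt_le_trans with (q * exp (fst (L v))); [now apply Rmult_lt_compat_l|].
      apply Rmult_le_compat_r; [left; apply exp_pos|exact H0]. }
    replace (q * (M / q)) with M in H1 by (field; lra). lra. }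
  pose proof (borel_caratheodory L T (ln (M / q) + 1) HT ltac:(lra) L0 B z Hz) as BC.
  assert (Hz' : sq T z) by (destruct Hz; split; lra).
  rewrite (proj2 (HL z Hz')) Cmod_mult Cmod_Cexp.
  apply Rmult_le_compat; [lra|left; apply exp_pos|exact H0|].
  pose proof (fst_le_Cmod (L z)) as P. pose proof (Rle_abs (- fst (L z))) as P2. rewrite Rabs_Ropp in P2.
  assert (X : - (2 * (ln (M / q) + 1)) <= fst (L z)) by lra.
  destruct X as [X|<-]; [left; now apply exp_increasing|lra].
Qed.

(* Zeros [a] of [f] near the origin are removed one by one: on the boundary
   [(3 / 4 * S) / |z - a| <= 1], while the value at the origin grows by 3/2. *)
Lemma quotient_bound n : forall (f F : C -> C) S M q, 0 < S -> 0 < q -> q <= Cmod (f 0) ->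
  (forall z, holo f z) -> (forall z, holo F z) ->
  (forall z, bdrect (- S) S (- S) S z -> Cmod (f z) <= M) ->
  (forall z, bdrect (- S) S (- S) S z -> Cmod (f z * F z) <= M) ->
  M <= q * (3 / 2) ^ n ->
  forall z, sq (S / 32) z -> Cmod (F z) <= exp 2 * (M / q) ^ 3.
Proof.
  (* The hypothesis [M <= q * (3 / 2) ^ n] limits the number of removals to [n], since the value at
     0 never exceeds [M]. Once no zero is left nearby, [zero_free_lower_bound] bounds [f] from
     below. *)
  induction n as [|n IH]; intros f F S M q HS Hq H0 Hf HF Bf BF Hn z Hz.
  all: assert (MP : forall z, sq S z -> Cmod (f z) <= M)
    by (intros v Hv; apply (max_principle _ (- S) S (- S) S); auto).
  all: assert (MP' : forall z, sq S z -> Cmod (f z * F z) <= M)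
    by (intros v Hv; apply (max_principle (fun w => f w * F w)%C (- S) S (- S) S); auto; intros; now apply holo_mult).
  all: assert (Mq : q <= M) by (specialize (MP 0 (sq_0 S ltac:(lra))); lra).
  all: assert (ST : forall a, sq (S / 4) a -> f a = 0 -> exists g, (forall z, holo g z) /\
     (forall z, bdrect (- S) S (- S) S z -> Cmod (g z) <= M) /\
     (forall z, bdrect (- S) S (- S) S z -> Cmod (g z * F z) <= M) /\ q * (3 / 2) <= Cmod (g 0)).
  (* Goals 1 and 3 are [ST] in the base and in the inductive case. The function replacing [f] is
     [(3 / 4 * S) * f z / (z - a)]. *)
  1, 3: intros a Ha Ea; destruct (entire_factor f a Hf Ea) as [g [Hg Eg]];
    exists (fun z => RtoC (3 / 4 * S) * g z)%C;
    assert (Da : forall w, bdrect (- S) S (- S) S w -> 3 / 4 * S <= Cmod (w - a));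
    [intros w [_ W]; destruct Ha as [A1 A2];
     pose proof (fst_le_Cmod (w - a)) as P; pose proof (snd_le_Cmod (w - a)) as Q; simpl in P, Q;
     destruct W as [W|[W|[W|W]]]; rewrite W in P, Q;
      [rewrite Rabs_left in P | rewrite Rabs_pos_eq in P |rewrite Rabs_left in Q | rewrite Rabs_pos_eq in Q ]; lra|];
    assert (K : forall w, bdrect (- S) S (- S) S w -> forall x : C, 
       Cmod (RtoC (3 / 4 * S) * x) <= Cmod ((w - a) * x));
    [intros w W x; rewrite !Cmod_mult Cmod_R Rabs_pos_eq; [|lra];
     apply Rmult_le_compat_r; [apply Cmod_ge_0|now apply Da]|];
    split; [intros; apply holo_mult; auto using holo_const|split; [|split]];
    [intros w W; eapply Rle_trans; [apply (K w W)|]; rewrite -Eg; auto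
    |intros w W; rewrite -Cmult_assoc; eapply Rle_trans; [apply (K w W)|]; rewrite Cmult_assoc -Eg; auto
    |rewrite Eg Cmod_mult in H0; rewrite Cmod_mult Cmod_R Rabs_pos_eq; [|lra];
     assert (Cmod (0 - a) <= S / 2)
      by (rewrite Cmod_sym; replace (a - 0)%C with a by ring; pose proof (sq_Cmod _ _ Ha); lra);
     pose proof (Cmod_ge_0 (g 0)); pose proof (Cmod_ge_0 (0 - a)); nra].
  all: destruct (classic (exists a, sq (S / 4) a /\ f a = 0)) as [[a [Ha Ea]]|NZ].
  1: { exfalso. destruct (ST a Ha Ea) as [g [Hg [Bg [_ G0]]]]. simpl in Hn.
    assert (Cmod (g 0) <= M); [|lra].
    apply (max_principle _ (- S) S (- S) S); auto. apply sq_0; lra. }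
  2: { destruct (ST a Ha Ea) as [g [Hg [Bg [BgF G0]]]].
    apply Rle_trans with (exp 2 * (M / (q * (3 / 2))) ^ 3).
    - apply (IH g F S M (q * (3 / 2))); auto; [lra|]. simpl in Hn. lra.
    - apply Rmult_le_compat_l; [left; apply exp_pos|]. apply pow_incr. split.
      + apply Rdiv_le_0_compat; lra.
      + apply Rmult_le_compat_l; [lra|]. apply Rinv_le_contravar; lra. }
  all: assert (T8 : forall v, sq (2 * (S / 8)) v -> sq (S / 4) v) by (intros v [V1 V2]; split; lra).
  all: assert (S8 : forall v, sq (S / 8) v -> sq S v) by (intros v [V1 V2]; split; lra).
  all: assert (S32 : forall v, sq (S / 32) v -> sq (S / 8 / 4) v) by (intros v [V1 V2]; split; lra).
  all: assert (LB := zero_free_lower_bound f (S / 8) M q ltac:(lra) Hq H0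
     (fun v Hv => conj (Hf v) (fun E => NZ (ex_intro _ v (conj (T8 v Hv) E)))) (fun v Hv => MP v (S8 v Hv)) z (S32 z Hz)).
  all: assert (MQ : 0 < M / q) by (apply Rdiv_lt_0_compat; lra).
  all: assert (EX : exp (- (2 * (ln (M / q) + 1))) = / (exp 2 * (M / q) ^ 2)) by
    (rewrite exp_Ropp; f_equal; replace (2 * (ln (M / q) + 1)) with (2 + (ln (M / q) + ln (M / q))) by ring;
     rewrite !exp_plus !exp_ln //; simpl; ring).
  all: rewrite EX in LB; assert (Hz' : sq S z) by (destruct Hz; split; lra); specialize (MP' z Hz').
  all: rewrite Cmod_mult in MP'.
  all: assert (E2 : 0 < exp 2 * (M / q) ^ 2) by (apply Rmult_lt_0_compat; [apply exp_pos|now apply pow_lt]).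
  all: apply (Rmult_le_reg_l (q * / (exp 2 * (M / q) ^ 2)));
    [apply Rmult_lt_0_compat; [exact Hq|now apply Rinv_0_lt_compat]|].
  all: apply Rle_trans with (Cmod (f z) * Cmod (F z)); [apply Rmult_le_compat_r; [apply Cmod_ge_0|exact LB]|].
  all: apply (Rle_trans _ _ _ MP'); right; field; split; [|split]; try lra; pose proof (exp_pos 2); lra.
Qed.

(** * Functions of finite order *)

Definition scale (rho : R) (z : C) : R := Rpower (1 + Cmod z) rho.

(** Order at most [s], in a form valid on the whole plane and stable under sums and products. The
    base [1 + |z|] of [scale] is at least 1, so the bound grows with [rho]. *)
Definition expbound (s : R) (f : C -> C) : Prop :=
  forall rho, s < rho -> exists A, 0 <= A /\ forall z, Cmod (f z) <= exp (A * scale rho z).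

Lemma scale_ge_1 rho z : 0 <= rho -> 1 <= scale rho z.
Proof.
  intros H. pose proof (Cmod_ge_0 z). apply Rle_trans with (Rpower (1 + Cmod z) 0).
  - rewrite Rpower_O; lra.
  - apply Rle_Rpower; [lra|exact H].
Qed.

Lemma exp_le x y : x <= y -> exp x <= exp y.
Proof. intros [H|<-]; [left; now apply exp_increasing|lra]. Qed.

Lemma le_exp x : x <= exp x.
Proof. pose proof (exp_ineq1_le x). lra. Qed.

Lemma expbound_mult s f g : expbound s f -> expbound s g -> expbound s (fun z => f z * g z)%C.
Proof.
  intros Hf Hg rho Hr. destruct (Hf rho Hr) as [A [A0 HA]]. destruct (Hg rho Hr) as [B [B0 HB]].
  exists (A + B); split; [lra|]. intros z. rewrite Cmod_mult Rmult_plus_distr_r exp_plus.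
  apply Rmult_le_compat; auto using Cmod_ge_0.
Qed.

Lemma expbound_plus s f g : 0 < s -> expbound s f -> expbound s g -> expbound s (fun z => f z + g z)%C.
Proof.
  intros Hs Hf Hg rho Hr. destruct (Hf rho Hr) as [A [A0 HA]]. destruct (Hg rho Hr) as [B [B0 HB]].
  exists (A + B + 1); split; [lra|]. intros z. eapply Rle_trans; [apply Cmod_triangle|].
  specialize (HA z). specialize (HB z). pose proof (scale_ge_1 rho z ltac:(lra)) as X.
  set (x := scale rho z) in *.
  assert (exp (A * x) <= exp ((A + B) * x)) by (apply exp_le; nra).
  assert (exp (B * x) <= exp ((A + B) * x)) by (apply exp_le; nra).
  replace ((A + B + 1) * x) with ((A + B) * x + x) by ring. rewrite exp_plus.
  assert (2 <= exp x) by (pose proof (exp_ineq1_le x); lra).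
  pose proof (exp_pos ((A + B) * x)). nra.
Qed.

Lemma expbound_const s c : 0 < s -> expbound s (fun _ => c).
Proof.
  intros Hs rho Hr. exists (Cmod c); split; [apply Cmod_ge_0|]. intros z.
  apply (Rle_trans _ _ _ (le_exp _)). apply exp_le. pose proof (scale_ge_1 rho z ltac:(lra)).
  pose proof (Cmod_ge_0 c). nra.
Qed.

Lemma expbound_id s : 0 < s -> expbound s (fun z => z).
Proof.
  intros Hs rho Hr. exists (/ rho).
  assert (P : 0 < / rho) by (apply Rinv_0_lt_compat; lra). split; [lra|]. intros z.
  pose proof (Cmod_ge_0 z) as Z. apply Rle_trans with (1 + Cmod z); [lra|].
  rewrite -{1}(exp_ln (1 + Cmod z)); [|lra]. apply exp_le.
  unfold scale, Rpower. pose proof (le_exp (rho * ln (1 + Cmod z))) as E.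
  apply (Rmult_le_compat_l (/ rho)) in E; [|lra]. rewrite -Rmult_assoc Rinv_l in E; lra.
Qed.

Lemma expbound_opp s f : 0 < s -> expbound s f -> expbound s (fun z => - f z)%C.
Proof.
  intros Hs H rho Hr. destruct (H rho Hr) as [A [A0 HA]]. exists A; split; [exact A0|].
  intros z. now rewrite Cmod_opp.
Qed.

Lemma expbound_minus s f g : 0 < s -> expbound s f -> expbound s g -> expbound s (fun z => f z - g z)%C.
Proof. intros; apply expbound_plus; auto. now apply expbound_opp. Qed.

Lemma expbound_ext s f g : (forall z, f z = g z) -> expbound s f -> expbound s g.
Proof.
  intros E H rho Hr. destruct (H rho Hr) as [A [A0 HA]]. exists A; split; [exact A0|].
  intros z. now rewrite -E.
Qed.

Lemma holo_bounded_sq f T : 0 <= T -> (forall z, holo f z) -> exists M, 0 <= M /\ forall z, sq T z -> Cmod (f z) <= M.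
Proof.
  intros HT Hf. destruct (bd_bounded f (- T) T (- T) T) as [M [M0 HM]]; try lra.
  { intros; now apply holo_cont. }
  exists M; split; [exact M0|]. intros z Hz. now apply (max_principle f (- T) T (- T) T).
Qed.

(** The infimum provides an exponent below [rho]; the disc on which its estimate is not known is
    absorbed in the constant. *)
Lemma growth_order_expbound f s : 0 < s -> (forall z, holo f z) ->
  Rbar_le (growth_order f) s -> expbound s f.
Proof.
  intros Hs Hf H rho Hr. unfold growth_order in H.
  set (E := fun rho => _) in H.
  destruct (Glb_Rbar_correct E) as [_ G].
  assert (X : exists r, E r /\ r < rho).
  { apply NNPP; intros N. assert (Y : Rbar_le rho (Glb_Rbar E)).
    { apply G. intros x Hx. simpl. apply Rnot_lt_le. intros L; apply N; now exists x. }
    assert (Z := Rbar_le_trans _ _ _ Y H). simpl in Z. lra. }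
  destruct X as [r [[Hr0 [r0 [Hr00 K]]] Hrr]].
  destruct (holo_bounded_sq f r0 ltac:(lra) Hf) as [M [M0 HM]].
  exists (1 + M); split; [lra|]. intros z. pose proof (scale_ge_1 rho z ltac:(lra)) as S1.
  destruct (Rle_dec r0 (Cmod z)) as [L|L].
  - apply (Rle_trans _ _ _ (K z L)). apply exp_le.
    apply Rle_trans with (scale rho z); [|nra]. unfold scale.
    apply Rle_trans with (Rpower (1 + Cmod z) r).
    + apply Rle_Rpower_l; lra.
    + apply Rle_Rpower; lra.
  - apply Rle_trans with M; [apply HM, Cmod_sq; lra|].
    apply (Rle_trans _ _ _ (le_exp M)). apply exp_le. nra.
Qed.

Lemma scale_mono rho c z w : 0 <= rho -> 0 < c -> 1 + Cmod w <= c * (1 + Cmod z) ->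
  scale rho w <= Rpower c rho * scale rho z.
Proof.
  intros Hr Hc H. unfold scale. pose proof (Cmod_ge_0 z). pose proof (Cmod_ge_0 w).
  rewrite Rpower_mult_distr //; [|lra]. apply Rle_Rpower_l; [lra|]. split; [lra|exact H].
Qed.

(** [quotient_bound] with the origin moved to [z0], on a square of half-side proportional to
    [|z - z0| + 1]. As [ln M] is a multiple of [scale rho z], the cube of [M / q] merely triples the
    exponent. *)
Lemma expbound_quotient s f F z0 : 0 < s -> (forall z, holo f z) -> (forall z, holo F z) ->
  f z0 <> 0 -> expbound s f -> expbound s (fun z => f z * F z)%C -> expbound s F.
Proof.
  intros Hs Hf HF N Ef Eh rho Hr. destruct (Ef rho Hr) as [A [A0 HA]]. destruct (Eh rho Hr) as [B [B0 HB]].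
  set (q := Cmod (f z0)). assert (Hq : 0 < q) by now apply Cmod_gt_0.
  pose proof (Cmod_ge_0 z0) as Z0.
  (* For [w] in the square [1 + |w + z0| <= 65 + 64 |z - z0| + |z0|], which [c0 * (1 + |z|)]
     dominates. *)
  set (c0 := 65 * (2 + Cmod z0)). assert (Hc0 : 0 < c0) by (unfold c0; lra).
  set (D := (A + B) * Rpower c0 rho).
  assert (HD : 0 <= D) by (apply Rmult_le_pos; [lra|left; apply exp_pos]).
  exists (2 + 3 * D + 3 * Rabs (ln q)). split; [pose proof (Rabs_pos (ln q)); lra|]. intros z.
  set (S := 32 * (Cmod (z - z0) + 1)). pose proof (Cmod_ge_0 (z - z0)) as ZZ.
  assert (HS : 0 < S) by (unfold S; lra).
  set (M := exp (D * scale rho z)).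
  assert (BD : forall w, bdrect (- S) S (- S) S w -> (A + B) * scale rho (w + z0) <= D * scale rho z).
  { intros w W. unfold D. rewrite Rmult_assoc. apply Rmult_le_compat_l; [lra|].
    apply scale_mono; [lra|exact Hc0|].
    pose proof (Cmod_triangle w z0). pose proof (sq_Cmod S w (proj1 W)).
    pose proof (Cmod_triangle z (- z0)) as T. rewrite Cmod_opp in T. pose proof (Cmod_ge_0 z).
    unfold S, c0 in *. unfold Cminus in *. nra. }
  assert (SC : forall w, 1 <= scale rho w) by (intros; apply scale_ge_1; lra).
  assert (Q : exists n, M <= q * (3 / 2) ^ n).
  { destruct (Pow_x_infinity (3 / 2)) with (b := M / q) as [n Hn]; [rewrite Rabs_pos_eq; lra|].
    exists n. specialize (Hn n (Nat.le_refl _)). rewrite Rabs_pos_eq in Hn; [|apply pow_le; lra].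
    apply (Rmult_ge_compat_l q) in Hn; [|lra]. replace (q * (M / q)) with M in Hn by (field; lra). lra. }
  destruct Q as [n Hn].
  assert (QB := quotient_bound n (fun w => f (w + z0)%C) (fun w => F (w + z0)%C) S M q HS Hq).
  assert (Shift : forall g, (forall z, holo g z) -> forall z, holo (fun w => g (w + z0)%C) z).
  { intros g Hg v. apply (holo_comp g (fun w => w + z0)%C); [|apply Hg].
    apply holo_plus; [apply holo_id|apply holo_const]. }
  cbv beta in QB. replace (0 + z0)%C with z0 in QB by ring.
  specialize (QB (Rle_refl _) (Shift f Hf) (Shift F HF)).
  assert (QB' := QB (fun w W => Rle_trans _ _ _ (HA (w + z0)%C) (exp_le _ _
       (Rle_trans _ _ _ (Rmult_le_compat_r _ A (A + B) (Rle_trans _ _ _ Rle_0_1 (SC _)) ltac:(lra)) (BD w W))))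
     (fun w W => Rle_trans _ _ _ (HB (w + z0)%C) (exp_le _ _
       (Rle_trans _ _ _ (Rmult_le_compat_r _ B (A + B) (Rle_trans _ _ _ Rle_0_1 (SC _)) ltac:(lra)) (BD w W)))) Hn (z - z0)%C).
  replace (z - z0 + z0)%C with z in QB' by ring.
  eapply Rle_trans; [apply QB'|].
  { apply Cmod_sq. unfold S. lra. }
  assert (E : M / q = exp (D * scale rho z - ln q)).
  { unfold Rminus. rewrite exp_plus exp_Ropp exp_ln //. }
  rewrite E. simpl. rewrite Rmult_1_r -!exp_plus. apply exp_le.
  specialize (SC z). pose proof (Rle_abs (- ln q)) as LQ. rewrite Rabs_Ropp in LQ. pose proof (Rabs_pos (ln q)).
  assert (Rabs (ln q) <= Rabs (ln q) * scale rho z) by nra. nra.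
Qed.

(** The maximum principle for [h w * (w^2 - S^2)]: on the boundary [weight_bound] supplies the
    missing factor [|Im w|], and [S = 2 (|z| + 1)] makes the weight at [z] at least [S^2 / 2]. *)
Lemma expbound_weighted s h : 0 < s -> (forall z, holo h z) ->
  (forall rho, s < rho -> exists A, 0 <= A /\
     forall z, Im z <> 0 -> Cmod (h z) * Rabs (Im z) <= exp (A * scale rho z)) ->
  expbound s h.
Proof.
  intros Hs Hh H rho Hr. destruct (H rho Hr) as [A [A0 HA]].
  (* On the square [1 + |w| <= 1 + 2 S <= 5 (1 + |z|)]; the summand 2 absorbs a final factor 3. *)
  exists (2 + A * Rpower 5 rho). assert (P5 : 0 < Rpower 5 rho) by apply exp_pos.
  split; [nra|]. intros z.
  set (S := 2 * (Cmod z + 1)). pose proof (Cmod_ge_0 z) as Z0. assert (HS : 2 <= S) by (unfold S; lra).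
  set (M := exp (A * Rpower 5 rho * scale rho z)).
  assert (B : Cmod (h z * ((z - 0) * (z - 0) - S * S)) <= 3 * S * M).
  { apply (max_principle (fun w => h w * ((w - 0) * (w - 0) - S * S))%C (- S) S (- S) S).
    - intros w _. apply holo_mult; auto. apply holo_minus; [|apply holo_const].
      apply holo_mult; apply holo_minus; (apply holo_id || apply holo_const).
    - intros w W. rewrite Cmod_mult.
      assert (WB := weight_bound 0 S w ltac:(lra)).
      replace (0 - S) with (- S) in WB by ring. rewrite Rplus_0_l in WB. specialize (WB W).
      destruct (Req_dec (Im w) 0) as [E0|E0].
      + unfold Im in E0. rewrite E0 Rabs_R0 Rmult_0_r in WB.
        pose proof (Cmod_ge_0 ((w - 0) * (w - 0) - S * S)).
        replace (Cmod ((w - 0) * (w - 0) - S * S)) with 0 by lra. rewrite Rmult_0_r.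
        pose proof (exp_pos (A * Rpower 5 rho * scale rho z)) as MP. fold M in MP. nra.
      + apply Rle_trans with (Cmod (h w) * (3 * S * Rabs (Im w))).
        { apply Rmult_le_compat_l; [apply Cmod_ge_0|exact WB]. }
        replace (Cmod (h w) * (3 * S * Rabs (Im w))) with (3 * S * (Cmod (h w) * Rabs (Im w))) by ring.
        apply Rmult_le_compat_l; [lra|]. apply (Rle_trans _ _ _ (HA w E0)). apply exp_le.
        rewrite Rmult_assoc. apply Rmult_le_compat_l; [lra|]. apply scale_mono; try lra.
        pose proof (sq_Cmod S w (proj1 W)). unfold S in *; lra.
    - apply Cmod_sq. unfold S; lra. }
  rewrite Cmod_mult in B.
  assert (L : S * S / 2 <= Cmod ((z - 0) * (z - 0) - S * S)).
  { pose proof (Cmod_triangle (S * S - (z - 0) * (z - 0)) ((z - 0) * (z - 0))) as T.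
    replace (S * S - (z - 0) * (z - 0) + (z - 0) * (z - 0))%C with (S * S)%C in T by ring.
    rewrite !Cmod_mult Cmod_R Rabs_pos_eq in T; [|lra]. rewrite Cmod_sym in T.
    replace (z - 0)%C with z in * by ring. 
    assert (Cmod z * Cmod z <= S * S / 4) by (unfold S; nra). nra. }
  assert (MP : 0 < M) by apply exp_pos.
  assert (B2 : Cmod (h z) <= 3 * M).
  { pose proof (Cmod_ge_0 (h z)).
    assert (Cmod (h z) * (S * S / 2) <= 3 * S * M).
    { eapply Rle_trans; [|exact B]. apply Rmult_le_compat_l; lra. }
    apply (Rmult_le_reg_r (S * S / 2)); [nra|]. assert (0 < S * M) by nra. assert (S * M * 2 <= S * M * S) by (apply Rmult_le_compat_l; lra). lra. }
  apply (Rle_trans _ _ _ B2).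
  rewrite Rmult_plus_distr_r exp_plus. fold M. apply Rmult_le_compat_r; [lra|].
  apply Rle_trans with (exp 2); [pose proof (exp_ineq1_le 2); lra|]. apply exp_le.
  pose proof (scale_ge_1 rho z ltac:(lra)). lra.
Qed.

(** * The Phragmen-Lindelof principle *)

Lemma exp_eventually_dominates A c rho rho' B : 0 <= A -> 0 < c -> 0 <= rho -> rho < rho' ->
  exists X0, 0 <= X0 /\ forall X, X0 <= X -> A * exp (rho * X) - c * exp (rho' * X) <= B.
Proof.
  intros HA Hc Hr Hrr.
  set (X0 := (A + Rabs B) / (c * (rho' - rho))). pose proof (Rabs_pos B) as BP.
  assert (D : 0 < c * (rho' - rho)) by (apply Rmult_lt_0_compat; lra).
  assert (HX0 : 0 <= X0) by (apply Rdiv_le_0_compat; lra).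
  exists X0; split; [exact HX0|]. intros X HX.
  replace (rho' * X) with (rho * X + (rho' - rho) * X) by ring. rewrite exp_plus.
  assert (E1 : 1 <= exp (rho * X)) by (pose proof (exp_ineq1_le (rho * X)); nra).
  assert (E2 : (rho' - rho) * X <= exp ((rho' - rho) * X)) by apply le_exp.
  assert (E3 : A + Rabs B <= c * exp ((rho' - rho) * X)).
  { apply Rle_trans with (c * ((rho' - rho) * X)); [|apply Rmult_le_compat_l; lra].
    apply (Rmult_le_compat_l (c * (rho' - rho))) in HX; [|lra].
    unfold X0 in HX. replace (c * (rho' - rho) * ((A + Rabs B) / (c * (rho' - rho)))) with (A + Rabs B) in HX by (field; nra).
    lra. }
  pose proof (Rle_abs (- B)) as BA. rewrite Rabs_Ropp in BA.
  set (e := exp (rho * X)) in *. set (g := exp ((rho' - rho) * X)) in *.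
  replace (c * (e * g)) with (e * (c * g)) by ring. nra.
Qed.

(** In the coordinate [log z] the sector outside the unit disc is a half strip, so the maximum
    principle on rectangles applies. The damping factor [exp (- eps z^rho')], rotated to the axis of
    the sector, beats [F] because [s < rho < rho'], and [rho' < PI / D] keeps its cosine above
    [c > 0]. *)
Lemma phragmen_lindelof F s th1 th2 B : 0 < s -> th1 < th2 -> th2 - th1 < PI / s ->
  (forall z, holo F z) -> expbound s F -> 0 < B ->
  (forall w, 0 <= fst w -> snd w = th1 \/ snd w = th2 -> Cmod (F (Cexp w)) <= B) ->
  (forall w, fst w = 0 -> Cmod (F (Cexp w)) <= B) ->
  forall w, 0 <= fst w -> th1 <= snd w <= th2 -> Cmod (F (Cexp w)) <= B.
Proof.
  intros Hs Hth Hop HF EF HB Hrays Hcirc w Hw1 Hw2.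
  set (D := th2 - th1) in *. assert (HD : 0 < D) by (unfold D; lra). pose proof PI_RGT_0 as HPI.
  assert (SP : s < PI / D).
  { apply (Rmult_lt_reg_r D); [exact HD|]. unfold Rdiv at 1. rewrite Rmult_assoc Rinv_l; [|lra].
    apply (Rmult_lt_compat_r s) in Hop; [|exact Hs]. unfold Rdiv in Hop. rewrite Rmult_assoc Rinv_l in Hop; lra. }
  set (rho := s + (PI / D - s) / 3). set (rho' := s + 2 * ((PI / D - s) / 3)).
  assert (R1 : s < rho) by (unfold rho; lra). assert (R2 : rho < rho') by (unfold rho, rho'; lra).
  assert (R3 : rho' < PI / D) by (unfold rho'; lra).
  destruct (EF rho R1) as [A [A0 HA]].
  set (thm := (th1 + th2) / 2). set (beta := rho' * (D / 2)).
  assert (HB1 : 0 < beta < PI / 2).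
  { unfold beta. split; [apply Rmult_lt_0_compat; lra|].
    apply (Rmult_lt_compat_r (D / 2)) in R3; [|lra].
    replace (PI / D * (D / 2)) with (PI / 2) in R3 by (field; lra). exact R3. }
  set (c := cos beta). assert (Hc : 0 < c) by (apply cos_gt_0; lra).
  assert (COS : forall y, th1 <= y <= th2 -> c <= cos (rho' * (y - thm))).
  { intros y Hy. assert (Ab : Rabs (rho' * (y - thm)) <= beta).
    { rewrite Rabs_mult Rabs_pos_eq; [|lra]. unfold beta. apply Rmult_le_compat_l; [lra|].
      apply Rabs_le. unfold D, thm. lra. }
    assert (E : cos (rho' * (y - thm)) = cos (Rabs (rho' * (y - thm)))).
    { unfold Rabs. destruct (Rcase_abs _); [now rewrite cos_neg|reflexivity]. }
    rewrite E. apply cos_decr_1; try lra. apply Rabs_pos. }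
  set (G := fun eps w => (F (Cexp w) * Cexp ((- eps)%R * Cexp (rho' * (w - (0, thm)))))%C).
  assert (EQ : forall eps v, Cmod (G eps v) = Cmod (F (Cexp v)) * exp (- eps * (exp (rho' * fst v) * cos (rho' * (snd v - thm))))).
  { intros eps v. unfold G. rewrite Cmod_mult Cmod_Cexp. do 2 f_equal. unfold Cexp; simpl.
    replace (rho' * (fst v + - 0) - 0 * (snd v + - thm)) with (rho' * fst v) by ring.
    replace (rho' * (snd v + - thm) + 0 * (fst v + - 0)) with (rho' * (snd v - thm)) by ring. ring. }
  assert (MAIN : forall eps, 0 < eps -> Cmod (G eps w) <= B).
  { intros eps He.
    destruct (exp_eventually_dominates (A * Rpower 2 rho) (eps * c) rho rho' (ln B)) as [X0 [HX0 HX]]; try lra.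
    { apply Rmult_le_pos; [lra|left; apply exp_pos]. }
    { apply Rmult_lt_0_compat; lra. }
    set (X := Rmax X0 (fst w)).
    assert (X1 : X0 <= X) by apply Rmax_l. assert (X2 : fst w <= X) by apply Rmax_r.
    assert (LE1 : forall v, 0 <= fst v -> th1 <= snd v <= th2 -> Cmod (F (Cexp v)) <= B -> Cmod (G eps v) <= B).
    { intros v V1 V2 V3. rewrite EQ. specialize (COS _ V2). pose proof (exp_pos (rho' * fst v)).
      assert (exp (- eps * (exp (rho' * fst v) * cos (rho' * (snd v - thm)))) <= 1).
      { rewrite -exp_0. apply exp_le. assert (0 <= exp (rho' * fst v) * cos (rho' * (snd v - thm))) by (apply Rmult_le_pos; lra).
        nra. }
      pose proof (Cmod_ge_0 (F (Cexp v))). pose proof (exp_pos (- eps * (exp (rho' * fst v) * cos (rho' * (snd v - thm))))). nra. }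
    apply (max_principle (G eps) 0 X th1 th2); [| |split; lra].
    - intros v _. apply holo_mult.
      + apply (holo_comp F Cexp); [apply Cexp_holo|apply HF].
      + apply (holo_comp Cexp); [|apply Cexp_holo]. apply holo_mult; [apply holo_const|].
        apply (holo_comp Cexp); [|apply Cexp_holo]. apply holo_mult; [apply holo_const|].
        apply holo_minus; [apply holo_id|apply holo_const].
    - intros v [[V1 V2] V]. destruct V as [V|[V|V]].
      + apply LE1; try lra. now apply Hcirc.
      + rewrite EQ V. specialize (HA (Cexp v)). specialize (HX X X1). specialize (COS _ V2).
        apply Rle_trans with (exp (A * scale rho (Cexp v)) * exp (- eps * (exp (rho' * X) * cos (rho' * (snd v - thm))))).
        { apply Rmult_le_compat_r; [left; apply exp_pos|exact HA]. }
        rewrite -exp_plus. apply Rle_trans with (exp (ln B)); [|rewrite exp_ln //; lra]. apply exp_le.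
        assert (SC : scale rho (Cexp v) <= Rpower 2 rho * exp (rho * X)).
        { unfold scale. rewrite Cmod_Cexp V.
          assert (E1 : 1 <= exp X) by (pose proof (exp_ineq1_le X); lra).
          replace (exp (rho * X)) with (Rpower (exp X) rho) by (unfold Rpower; now rewrite ln_exp).
          rewrite Rpower_mult_distr; [|lra|lra]. apply Rle_Rpower_l; lra. }
        apply (Rmult_le_compat_l A) in SC; [|exact A0].
        pose proof (exp_pos (rho' * X)) as EP.
        assert (exp (rho' * X) * c <= exp (rho' * X) * cos (rho' * (snd v - thm))) by (apply Rmult_le_compat_l; lra).
        nra.
      + apply LE1; try lra. apply Hrays; [lra|exact V]. }
  apply Rnot_lt_le. intros N.
  set (q := Cmod (F (Cexp w))) in *. set (K := exp (rho' * fst w) * cos (rho' * (snd w - thm))).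
  assert (HK : 0 < K).
  { apply Rmult_lt_0_compat; [apply exp_pos|]. specialize (COS _ Hw2). lra. }
  assert (LN : 0 < ln (q / B)).
  { rewrite -ln_1. apply ln_increasing; [lra|]. apply (Rmult_lt_reg_r B); [exact HB|].
    unfold Rdiv. rewrite Rmult_assoc Rinv_l; lra. }
  (* With this [eps] the damping factor at [w] is [sqrt (B / q)], too large for [MAIN] when
     [B < q]. *)
  set (eps := ln (q / B) / (2 * K)). assert (He : 0 < eps) by (apply Rdiv_lt_0_compat; lra).
  specialize (MAIN eps He). rewrite EQ in MAIN. fold q K in MAIN.
  replace (- eps * K) with (- (ln (q / B) / 2)) in MAIN by (unfold eps; field; lra).
  assert (E1 : exp (- ln (q / B)) < exp (- (ln (q / B) / 2))) by (apply exp_increasing; lra).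
  rewrite exp_Ropp exp_ln in E1; [|apply Rdiv_lt_0_compat; lra].
  apply (Rmult_lt_compat_l q) in E1; [|lra].
  replace (q * / (q / B)) with B in E1 by (field; lra). lra.
Qed.

Lemma polar_form (c s : R) : c * c + s * s = 1 -> exists th, cos th = c /\ sin th = s.
Proof.
  intros H. assert (Hc : -1 <= c <= 1) by nra.
  assert (Q : sqrt (1 - c²) = Rabs s).
  { rewrite -sqrt_Rsqr_abs. f_equal. unfold Rsqr. lra. }
  destruct (Rle_dec 0 s) as [S|S].
  - exists (acos c). split; [now apply cos_acos|]. rewrite sin_acos // Q Rabs_pos_eq //.
  - exists (- acos c). split; [rewrite cos_neg; now apply cos_acos|].
    rewrite sin_neg sin_acos // Q Rabs_left; lra.
Qed.

Lemma cos_sin_period_Z x k : cos (x + 2 * IZR k * PI) = cos x /\ sin (x + 2 * IZR k * PI) = sin x.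
Proof.
  assert (N : forall n y, cos (y + 2 * INR n * PI) = cos y /\ sin (y + 2 * INR n * PI) = sin y)
    by (intros; split; [apply cos_period|apply sin_period]).
  destruct (Z_le_gt_dec 0 k) as [H|H].
  - destruct (N (Z.to_nat k) x) as [A B]. rewrite INR_IZR_INZ Z2Nat.id // in A, B.
  - destruct (N (Z.to_nat (- k)) (x + 2 * IZR k * PI)) as [A B]. rewrite INR_IZR_INZ Z2Nat.id in A, B; [|lia].
    rewrite opp_IZR in A, B.
    replace (x + 2 * IZR k * PI + 2 * - IZR k * PI) with x in A, B by ring. auto.
Qed.

Lemma Cexp_onto th0 (z : C) : z <> 0 -> exists w, Cexp w = z /\ fst w = ln (Cmod z) /\ th0 <= snd w <= th0 + 2 * PI.
Proof.
  intros Hz. pose proof (proj1 (Cmod_gt_0 _) Hz) as P. set (r := Cmod z) in *. pose proof PI_RGT_0 as HPI.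
  assert (R2 : r * r = fst z * fst z + snd z * snd z).
  { unfold r, Cmod. rewrite sqrt_sqrt; [ring|]. simpl. nra. }
  destruct (polar_form (fst z / r) (snd z / r)) as [th [T1 T2]].
  { replace (fst z / r * (fst z / r) + snd z / r * (snd z / r)) with ((fst z * fst z + snd z * snd z) / (r * r)) by (field; lra).
    rewrite -R2. field; lra. }
  set (k := up ((th0 - th) / (2 * PI))).
  destruct (archimed ((th0 - th) / (2 * PI))) as [K1 K2]. fold k in K1, K2.
  exists (ln r, th + 2 * IZR k * PI). simpl. split; [|split; [reflexivity|]].
  - unfold Cexp. simpl. destruct (cos_sin_period_Z th k) as [-> ->]. rewrite exp_ln // T1 T2.
    destruct z as [x y]. simpl. f_equal; field; lra.
  - assert (E : (th0 - th) / (2 * PI) * (2 * PI) = th0 - th) by (field; lra).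
    apply (Rmult_lt_compat_r (2 * PI)) in K1; [|lra].
    assert (K2' : IZR k <= 1 + (th0 - th) / (2 * PI)) by lra.
    apply (Rmult_le_compat_r (2 * PI)) in K2'; [|lra]. lra.
Qed.

(** The maximum principle for [(F - F 0) / z] on squares of half-side [1 / e], with [e] tending to
    0. *)
Lemma liouville F B : (forall z, holo F z) -> (forall z, Cmod (F z) <= B) -> forall z, F z = F 0.
Proof.
  intros HF HB z.
  destruct (entire_factor (fun w => F w - F 0)%C 0) as [g [Hg Eg]].
  { intros; apply holo_minus; auto using holo_const. }
  { ring. }
  cbv beta in Eg. assert (G0 : Cmod (g z) <= 0).
  { apply (Rle_of_eps _ (2 * B) (/ (Cmod z + 1))).
    { apply Rinv_0_lt_compat. pose proof (Cmod_ge_0 z); lra. }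
    intros e [He1 He2]. pose proof (Cmod_ge_0 z).
    assert (HR : Cmod z + 1 < / e).
    { rewrite -(Rinv_inv (Cmod z + 1)). apply Rinv_lt_contravar; [|exact He2].
      apply Rmult_lt_0_compat; [exact He1|apply Rinv_0_lt_compat; lra]. }
    set (S := / e) in *. assert (Ee : e = / S) by (unfold S; now rewrite Rinv_inv). rewrite Ee.
    apply (max_principle g (- S) S (- S) S); [auto| |apply Cmod_sq; lra].
    intros w W. pose proof (bd_sq_Cmod _ _ W) as D.
    assert (N : w <> 0) by (apply (Cmod_pos_ne _ S); lra).
    replace (g w) with ((F w - F 0) / w)%C by (rewrite Eg; field; auto).
    rewrite Cmod_div //.
    assert (Cmod (F w - F 0) <= 2 * B).
    { unfold Cminus. eapply Rle_trans; [apply Cmod_triangle|]. rewrite Cmod_opp. pose proof (HB w). pose proof (HB 0). lra. }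
    apply Rmult_le_compat; [apply Cmod_ge_0| |lra|apply Rinv_le_contravar; lra].
    left; apply Rinv_0_lt_compat; lra. }
  pose proof (Cmod_ge_0 (g z)). assert (E0 : g z = 0) by (apply Cmod_eq_0; lra).
  transitivity (F z - F 0 + F 0)%C; [ring|]. rewrite Eg E0. ring.
Qed.

(** The uniform structure of [C] is that of pairs, so its balls are squares; passing to [Cmod] costs
    the factor in [eps / 2]. *)
Lemma filterlim_C0 {T} (f : T -> C) (G : (T -> Prop) -> Prop) : Filter G ->
  (filterlim f G (locally (RtoC 0)) <-> forall eps, 0 < eps -> G (fun x => Cmod (f x) < eps)).
Proof.
  intros FG. split.
  - intros H eps He. apply (H (fun z => Cmod z < eps)).
    assert (E2 : 0 < eps / 2) by lra. exists (mkposreal _ E2).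
    intros z [Z1 Z2]. simpl in Z1, Z2. 
    unfold ball in Z1, Z2; simpl in Z1, Z2. unfold AbsRing_ball, minus, plus, opp, abs in Z1, Z2; simpl in Z1, Z2.
    apply (Rle_lt_trans _ _ _ (Cmod_le_abs z)). rewrite Ropp_0 !Rplus_0_r in Z1, Z2. lra.
  - intros H P [eps HP]. unfold filtermap. apply (filter_imp (fun x => Cmod (f x) < eps)); [|apply H, cond_pos].
    intros x Hx. apply HP. split; unfold ball; simpl; unfold AbsRing_ball, minus, plus, opp, abs; simpl;
    rewrite Ropp_0 Rplus_0_r.
    + exact (Rle_lt_trans _ _ _ (fst_le_Cmod _) Hx).
    + exact (Rle_lt_trans _ _ _ (snd_le_Cmod _) Hx).
Qed.

Lemma tends_along_ray F th : tends_to_0_along_ray F th ->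
  forall eps, 0 < eps -> exists R0, forall r, R0 < r -> Cmod (F (ray_point th r)) < eps.
Proof.
  intros H eps He. unfold tends_to_0_along_ray in H. rewrite filterlim_C0 in H.
  destruct (H eps He) as [M HM]. exists M; auto.
Qed.

Lemma ray_point_Cexp th x : ray_point th (exp x) = Cexp (x, th).
Proof. unfold ray_point, Cexp, Cmult, RtoC; simpl. f_equal; ring. Qed.

(** Bounds on the finitely many rays and on the unit disc give, sector by sector, a bound on the
    plane. Then [F] is constant, and its limit along any one ray is 0. *)
Theorem vanishing_along_rays F s m theta : 0 < s -> (forall z, holo F z) -> expbound s F ->
  nonreal_rays m theta (PI / s) ->
  (forall k, (k < m)%nat -> tends_to_0_along_ray F (theta k)) -> forall z, F z = 0.
Proof.
  intros Hs HF EF [Hm Hth] Hray. pose proof PI_RGT_0 as HPI.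
  (* Without rays the closing condition would read [theta 0 = theta 0 + 2 PI]. *)
  assert (Pm : (0 < m)%nat) by (destruct m; [lra|lia]).
  assert (B1 : forall j, (j <= m)%nat -> exists B, 0 < B /\ forall k x, (k < j)%nat -> 0 <= x ->
      Cmod (F (Cexp (x, theta k))) <= B).
  { induction j as [|j IH]; intros Hj; [exists 1; split; [lra|intros; lia]|].
    destruct IH as [B [HB K]]; [lia|].
    destruct (tends_along_ray _ _ (Hray j ltac:(lia)) 1 ltac:(lra)) as [R0 HR].
    destruct (holo_bounded_sq F (Rabs R0) (Rabs_pos _) HF) as [M [M0 HM]].
    exists (B + 1 + M); split; [lra|]. intros k x Hk Hx.
    assert (C : (k < j \/ k = j)%nat) by lia. destruct C as [C | ->]; [specialize (K k x C Hx); lra|].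
    destruct (Rlt_dec R0 (exp x)) as [L|L].
    - specialize (HR _ L). rewrite ray_point_Cexp in HR. lra.
    - specialize (HM (Cexp (x, theta j))). assert (Cmod (F (Cexp (x, theta j))) <= M); [|lra].
      apply HM, Cmod_sq. rewrite Cmod_Cexp. simpl. pose proof (Rle_abs R0). lra. }
  destruct (B1 m (Nat.le_refl _)) as [B [HB HBr]].
  destruct (holo_bounded_sq F 1 ltac:(lra) HF) as [M [M0 HM]].
  set (BB := B + M). assert (HBB : 0 < BB) by (unfold BB; lra).
  (* The last sector ends at angle [theta m], which is the first ray again. *)
  assert (RAY : forall k x, (k <= m)%nat -> 0 <= x -> Cmod (F (Cexp (x, theta k))) <= BB).
  { intros k x Hk Hx. assert (C : (k < m \/ k = m)%nat) by lia. destruct C as [C | ->].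
    - specialize (HBr k x C Hx). unfold BB; lra.
    - rewrite Hm. replace (Cexp (x, theta 0%nat + 2 * PI)) with (Cexp (x, theta 0%nat)).
      + specialize (HBr O x Pm Hx). unfold BB; lra.
      + unfold Cexp; simpl. destruct (cos_sin_period_Z (theta 0%nat) 1) as [E1 E2].
        replace (theta 0%nat + 2 * 1 * PI) with (theta 0%nat + 2 * PI) in E1, E2 by ring. now rewrite E1 E2. }
  assert (COV : forall j y, (j <= m)%nat -> theta O <= y <= theta j -> (0 < j)%nat ->
     exists k, (k < m)%nat /\ theta k <= y <= theta (S k)).
  { induction j as [|j IH]; intros y Hj Hy Pj; [lia|].
    destruct (Rle_dec (theta j) y) as [L|L]; [exists j; split; [lia|lra]|].
    destruct j as [|j]; [lra|]. apply IH; [lia|lra|lia]. }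
  assert (BND : forall z, Cmod (F z) <= BB).
  { intros z. destruct (Rle_dec (Cmod z) 1) as [L|L].
    { specialize (HM z (Cmod_sq _ _ L)). unfold BB; lra. }
    destruct (Cexp_onto (theta O) z) as [w [<- [W1 W2]]].
    { intros ->. rewrite Cmod_0 in L. lra. }
    rewrite -Hm in W2. destruct (COV m (snd w) (Nat.le_refl _) W2 Pm) as [k [Hk1 Hk2]].
    destruct (Hth k Hk1) as [H1 [H2 _]].
    assert (W0 : 0 <= fst w). 
    { rewrite W1 -ln_1. left. apply ln_increasing; lra. }
    apply (phragmen_lindelof F s (theta k) (theta (S k)) BB); auto.
    - intros [x y] X Y. simpl in X, Y. destruct Y as [-> | ->]; apply RAY; auto; lia.
    - intros [x y] X. simpl in X. subst x. apply Rle_trans with M; [|unfold BB; lra].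
      apply HM, Cmod_sq. rewrite Cmod_Cexp. simpl. rewrite exp_0. lra. }
  intros z. rewrite (liouville F BB HF BND z). apply Cmod_eq_0. apply Rle_antisym; [|apply Cmod_ge_0].
  apply Rnot_lt_le. intros N.
  destruct (tends_along_ray _ _ (Hray O Pm) _ N) as [R0 HR].
  specialize (HR (R0 + 1) ltac:(lra)). rewrite (liouville F BB HF BND (ray_point _ _)) in HR. lra.
Qed.

(** * Square summable sequences near +oo *)

Definition rsum (u : nat -> R) (n : nat) : R := sum_n u n.

Lemma rsum_S (u : nat -> R) n : rsum u (S n) = rsum u n + u (S n).
Proof. exact (sum_Sn u n). Qed.

Lemma rsum_O (u : nat -> R) : rsum u 0 = u 0%nat.
Proof. exact (sum_O u). Qed.

Lemma ex_series_bounded (u : nat -> R) : (forall k, 0 <= u k) ->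
  (ex_series u <-> exists B, forall M, rsum u M <= B).
Proof.
  intros Hu. assert (Mono : forall n, rsum u n <= rsum u (S n)).
  { intros n. rewrite rsum_S. specialize (Hu (S n)). lra. }
  split.
  - intros [l Hl]. exists l. intros M.
    apply (is_lim_seq_incr_compare (rsum u)); [exact Hl|exact Mono].
  - intros [B HB]. destruct (ex_finite_lim_seq_incr (rsum u) B Mono HB) as [l Hl].
    exists l. exact Hl.
Qed.

Definition n2 (f : Z -> C) (n : Z) : R := Cmod (f n) ^ 2.

Lemma n2_pos f n : 0 <= n2 f n.
Proof. apply pow2_ge_0. Qed.

Lemma sqsum_plus_bounded f :
  sqsum_plus f <-> exists B, forall M, rsum (fun k => n2 f (Z.of_nat k)) M <= B.
Proof. apply ex_series_bounded. intros; apply pow2_ge_0. Qed.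

Lemma rsum_le_of (u v : nat -> R) M : (forall k, u k <= v k) -> rsum u M <= rsum v M.
Proof.
  intros H. induction M as [|M IH]; [rewrite !rsum_O; auto|]. rewrite !rsum_S. specialize (H (S M)). lra.
Qed.

Lemma rsum_scal_l (c : R) (u : nat -> R) M : rsum (fun k => c * u k) M = c * rsum u M.
Proof. induction M as [|M IH]; [now rewrite !rsum_O|]. rewrite !rsum_S IH. ring. Qed.

Lemma rsum_plus_R (u v : nat -> R) M : rsum (fun k => u k + v k) M = rsum u M + rsum v M.
Proof. induction M as [|M IH]; [now rewrite !rsum_O|]. rewrite !rsum_S IH. ring. Qed.

Lemma rsum_pos (u : nat -> R) M : (forall k, 0 <= u k) -> 0 <= rsum u M.
Proof.
  intros H. induction M as [|M IH]; [rewrite rsum_O; auto|]. rewrite rsum_S. specialize (H (S M)). lra.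
Qed.

Lemma Cmod_plus_sq (x y : C) : Cmod (x + y) ^ 2 <= 2 * Cmod x ^ 2 + 2 * Cmod y ^ 2.
Proof.
  pose proof (Cmod_triangle x y). pose proof (Cmod_ge_0 (x + y)). 
  apply Rle_trans with ((Cmod x + Cmod y) ^ 2).
  - apply pow_incr. lra.
  - pose proof (pow2_ge_0 (Cmod x - Cmod y)). nra.
Qed.

Lemma sqsum_plus_plus f g : sqsum_plus f -> sqsum_plus g -> sqsum_plus (fun n => f n + g n)%C.
Proof.
  rewrite !sqsum_plus_bounded. intros [A HA] [B HB]. exists (2 * A + 2 * B). intros M.
  eapply Rle_trans; [apply (rsum_le_of _ (fun k => 2 * n2 f (Z.of_nat k) + 2 * n2 g (Z.of_nat k)));
    intros k; apply Cmod_plus_sq|].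
  rewrite rsum_plus_R !rsum_scal_l. specialize (HA M). specialize (HB M). lra.
Qed.

Lemma sqsum_plus_scal c f : sqsum_plus f -> sqsum_plus (fun n => c * f n)%C.
Proof.
  rewrite !sqsum_plus_bounded. intros [A HA]. exists (Cmod c ^ 2 * A). intros M.
  eapply Rle_trans; [apply (rsum_le_of _ (fun k => Cmod c ^ 2 * n2 f (Z.of_nat k)));
    intros k; unfold n2; rewrite Cmod_mult Rpow_mult_distr; lra|].
  rewrite rsum_scal_l. apply Rmult_le_compat_l; [apply pow2_ge_0|auto].
Qed.

Lemma sqsum_plus_dominated f g n0 : (forall n, (n0 <= n)%Z -> Cmod (f n) <= Cmod (g n)) ->
  sqsum_plus g -> sqsum_plus f.
Proof.
  rewrite !sqsum_plus_bounded. intros E [A HA].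
  set (N := Z.to_nat n0).
  exists (A + rsum (fun k => n2 f (Z.of_nat k)) N). intros M.
  pose proof (rsum_pos (fun k => n2 f (Z.of_nat k)) N (fun k => n2_pos _ _)) as P0.
  pose proof (rsum_pos (fun k => n2 g (Z.of_nat k)) N (fun k => n2_pos _ _)) as P1.
  destruct (le_lt_dec M N) as [L|L].
  - assert (rsum (fun k => n2 f (Z.of_nat k)) M <= rsum (fun k => n2 f (Z.of_nat k)) N).
    { clear - L. induction L as [|m L IH]; [lra|]. rewrite rsum_S. pose proof (n2_pos f (Z.of_nat (S m))). lra. }
    specialize (HA M). pose proof (rsum_pos (fun k => n2 g (Z.of_nat k)) M (fun k => n2_pos _ _)). lra.
  - assert (rsum (fun k => n2 f (Z.of_nat k)) M - rsum (fun k => n2 f (Z.of_nat k)) N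
       <= rsum (fun k => n2 g (Z.of_nat k)) M - rsum (fun k => n2 g (Z.of_nat k)) N).
    { assert (L' : (N <= M)%nat) by lia. clear - L' E. induction L' as [|m L IH]; [lra|]. rewrite !rsum_S.
      assert (n2 f (Z.of_nat (S m)) <= n2 g (Z.of_nat (S m))); [|lra].
      apply pow_incr. split; [apply Cmod_ge_0|]. apply E. unfold N in L. lia. }
    specialize (HA M). lra.
Qed.

Lemma sqsum_plus_tail f g n0 : (forall n, (n0 <= n)%Z -> f n = g n) -> sqsum_plus f -> sqsum_plus g.
Proof. intros E. apply (sqsum_plus_dominated _ _ n0). intros n Hn. rewrite E //. lra. Qed.

Lemma sqsum_plus_ext f g : (forall n, f n = g n) -> sqsum_plus f -> sqsum_plus g.
Proof. intros E. apply (sqsum_plus_tail _ _ 0%Z). auto. Qed.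

Lemma sqsum_plus_conj f : sqsum_plus f -> sqsum_plus (fun n => Cconj (f n)).
Proof. apply (sqsum_plus_dominated _ _ 0%Z). intros n _. rewrite Cmod_conj. lra. Qed.

(** * Solutions and Wronskians *)

(** The equation at sites from [n0] on involves values from [n0 - 1] on; hence the [n0 - 1] in what
    follows. Columns of Green's function are such one-sided solutions. *)
Definition solves_from (a b : Z -> R) (z : C) (n0 : Z) (f : Z -> C) : Prop :=
  forall n, (n0 <= n)%Z -> tau a b f n = (z * f n)%C.

Lemma solution_solves_from a b z n0 f : solution a b z f -> solves_from a b z n0 f.
Proof. intros H n _; apply H. Qed.

Lemma green_identity a b f g n :
  (f n * tau a b g n - g n * tau a b f n)%C = (wronskian a f g n - wronskian a f g (n - 1))%C.
Proof.
  unfold tau, wronskian. replace (n - 1 + 1)%Z with n by lia. ring.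
Qed.

Lemma wronskian_const a b z n0 f g : solves_from a b z n0 f -> solves_from a b z n0 g ->
  forall n, (n0 - 1 <= n)%Z -> wronskian a f g n = wronskian a f g (n0 - 1).
Proof.
  intros Hf Hg. assert (K : forall k : nat, wronskian a f g (n0 - 1 + Z.of_nat k) = wronskian a f g (n0 - 1)).
  { induction k as [|k IH]; [f_equal; lia|]. rewrite -IH.
    pose proof (green_identity a b f g (n0 - 1 + Z.of_nat (S k))) as G.
    rewrite Hf in G; [|lia]. rewrite Hg in G; [|lia].
    replace (n0 - 1 + Z.of_nat (S k) - 1)%Z with (n0 - 1 + Z.of_nat k)%Z in G by lia.
    match type of G with _ = (?x - ?y)%C => transitivity ((x - y) + y)%C; [ring|rewrite -G; ring] end. }
  intros n Hn. rewrite -(K (Z.to_nat (n - (n0 - 1)))). f_equal. lia.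
Qed.

Lemma wronskian_const_all a b z f g : solution a b z f -> solution a b z g ->
  forall n m, wronskian a f g n = wronskian a f g m.
Proof.
  intros Hf Hg n m.
  rewrite (wronskian_const a b z (Z.min n m) f g (solution_solves_from _ _ _ _ _ Hf) (solution_solves_from _ _ _ _ _ Hg) n); [|lia].
  now rewrite (wronskian_const a b z (Z.min n m) f g (solution_solves_from _ _ _ _ _ Hf) (solution_solves_from _ _ _ _ _ Hg) m); [|lia].
Qed.

Lemma cramer a f s1 s2 n :
  (wronskian a f s2 n * s1 n + wronskian a s1 f n * s2 n)%C = (wronskian a s1 s2 n * f n)%C /\
  (wronskian a f s2 n * s1 (n + 1)%Z + wronskian a s1 f n * s2 (n + 1)%Z)%C = (wronskian a s1 s2 n * f (n + 1)%Z)%C.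
Proof. unfold wronskian. split; ring. Qed.

(** When [W(v, w)] is a nonzero constant, [W(f, g)] is thereby controlled by the Wronskians of [f]
    and [g] with [v] and [w]. *)
Lemma pluecker a v w f g n : (wronskian a v w n * wronskian a f g n)%C =
  (wronskian a v f n * wronskian a w g n - wronskian a v g n * wronskian a w f n)%C.
Proof. unfold wronskian. ring. Qed.

Section Coefficients.
Variables (a b : Z -> R).
Hypothesis (Ha : forall n, 0 < a n).

Lemma RtoC_a_neq_0 n : RtoC (a n) <> 0.
Proof. intros X. apply RtoC_inj in X. specialize (Ha n). lra. Qed.

Lemma solution_exists z n0 c0 c1 :
  exists u, solution a b z u /\ u n0 = c0 /\ u (n0 + 1)%Z = c1.
Proof.
  set (up := fix up k : C * C := match k with O => (c0, c1) | S k =>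
     (snd (up k), (((z - b (n0 + Z.of_nat k + 1)%Z) * snd (up k) - a (n0 + Z.of_nat k)%Z * fst (up k))
                      / a (n0 + Z.of_nat k + 1)%Z)%C) end).
  set (dn := fix dn k : C * C := match k with O => (c0, c1) | S k =>
     ((((z - b (n0 - Z.of_nat k)%Z) * fst (dn k) - a (n0 - Z.of_nat k)%Z * snd (dn k))
                      / a (n0 - Z.of_nat k - 1)%Z)%C, fst (dn k)) end).
  set (u := fun n => if Z_le_dec n0 n then fst (up (Z.to_nat (n - n0))) else fst (dn (Z.to_nat (n0 - n)))).
  assert (U : forall k, u (n0 + Z.of_nat k)%Z = fst (up k)).
  { intros k. unfold u. destruct (Z_le_dec _ _) as [L|L]; [|lia]. do 2 f_equal. lia. }
  assert (D : forall k, u (n0 - Z.of_nat k)%Z = fst (dn k)).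
  { intros k. unfold u. destruct (Z_le_dec _ _) as [L|L].
    - assert (k = O) by lia. subst k. replace (Z.to_nat (n0 - Z.of_nat 0 - n0)) with O by lia. reflexivity.
    - do 2 f_equal. lia. }
  assert (D1 : forall k, u (n0 - Z.of_nat k + 1)%Z = snd (dn k)).
  { intros [|k].
    - replace (n0 - Z.of_nat 0 + 1)%Z with (n0 + Z.of_nat 1)%Z by lia. rewrite U. reflexivity.
    - replace (n0 - Z.of_nat (S k) + 1)%Z with (n0 - Z.of_nat k)%Z by lia. rewrite D. reflexivity. }
  exists u. split; [|split].
  - intros n. unfold tau. destruct (Z_le_gt_dec n n0) as [L|L].
    + set (k := Z.to_nat (n0 - n)). assert (En : n = (n0 - Z.of_nat k)%Z) by lia. rewrite En.
      rewrite D1 D. replace (n0 - Z.of_nat k - 1)%Z with (n0 - Z.of_nat (S k))%Z by lia. rewrite D.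
      simpl fst. replace (n0 - Z.of_nat (S k))%Z with (n0 - Z.of_nat k - 1)%Z by lia.
      field. apply RtoC_a_neq_0.
    + set (k := Z.to_nat (n - n0 - 1)). assert (En : n = (n0 + Z.of_nat (S k))%Z) by lia. rewrite En.
      replace (n0 + Z.of_nat (S k) + 1)%Z with (n0 + Z.of_nat (S (S k)))%Z by lia.
      replace (n0 + Z.of_nat (S k) - 1)%Z with (n0 + Z.of_nat k)%Z by lia. rewrite !U.
      simpl fst. simpl snd.
      replace (n0 + Z.of_nat k + 1)%Z with (n0 + Z.of_nat (S k))%Z by lia.
      field. apply RtoC_a_neq_0.
  - replace n0 with (n0 + Z.of_nat 0)%Z at 1 by lia. now rewrite U.
  - replace (n0 + 1)%Z with (n0 + Z.of_nat 1)%Z by lia. now rewrite U.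
Qed.

Lemma solution_unique_up z n0 u v : solves_from a b z n0 u -> solves_from a b z n0 v ->
  u (n0 - 1)%Z = v (n0 - 1)%Z -> u n0 = v n0 -> forall n, (n0 - 1 <= n)%Z -> u n = v n.
Proof.
  intros Hu Hv E0 E1.
  assert (K : forall k : nat, u (n0 - 1 + Z.of_nat k)%Z = v (n0 - 1 + Z.of_nat k)%Z /\
     u (n0 + Z.of_nat k)%Z = v (n0 + Z.of_nat k)%Z).
  { induction k as [|k [IH1 IH2]]; [rewrite Z.add_0_r Z.add_0_r; auto|].
    replace (n0 - 1 + Z.of_nat (S k))%Z with (n0 + Z.of_nat k)%Z by lia. split; [exact IH2|].
    pose proof (Hu (n0 + Z.of_nat k)%Z ltac:(lia)) as Au. pose proof (Hv (n0 + Z.of_nat k)%Z ltac:(lia)) as Av.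
    unfold tau in Au, Av.
    replace (n0 + Z.of_nat k - 1)%Z with (n0 - 1 + Z.of_nat k)%Z in Au, Av by lia.
    replace (n0 + Z.of_nat k + 1)%Z with (n0 + Z.of_nat (S k))%Z in Au, Av by lia.
    rewrite IH1 IH2 in Au. rewrite -Au in Av.
    set (A := RtoC (a (n0 + Z.of_nat k)%Z)) in *. assert (HA : A <> 0) by apply RtoC_a_neq_0.
    set (x := u (n0 + Z.of_nat (S k))%Z) in *. set (y := v (n0 + Z.of_nat (S k))%Z) in *.
    assert (E : (A * y)%C = (A * x)%C).
    { match type of Av with (A * y + ?p + ?q = _)%C => transitivity ((A * y + p + q) - p - q)%C; [ring|rewrite Av; ring] end. }
    replace x with (A * x / A)%C by (field; auto). rewrite -E. field; auto. }
  intros n Hn. replace n with (n0 - 1 + Z.of_nat (Z.to_nat (n - (n0 - 1))))%Z by lia. apply K.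
Qed.

(** The increments of the Wronskian are [f tau g - g tau f], absolutely summable because products
    are dominated by squares. *)
Lemma wronskian_bounded f g : sqsum_plus f -> sqsum_plus g -> sqsum_plus (tau a b f) -> sqsum_plus (tau a b g) ->
  exists B, forall k : nat, Cmod (wronskian a f g (Z.of_nat k)) <= B.
Proof.
  rewrite !sqsum_plus_bounded. intros [F HF] [G HG] [F' HF'] [G' HG'].
  exists (Cmod (wronskian a f g (-1)) + F + G + F' + G'). intros k.
  assert (S0 : Cmod (wronskian a f g (Z.of_nat k)) <= Cmod (wronskian a f g (-1)) +
     rsum (fun k => (n2 f (Z.of_nat k) + n2 (tau a b g) (Z.of_nat k)) + (n2 g (Z.of_nat k) + n2 (tau a b f) (Z.of_nat k))) k).
  { assert (ST : forall n, Cmod (wronskian a f g n) <= Cmod (wronskian a f g (n - 1)) +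
       ((n2 f n + n2 (tau a b g) n) + (n2 g n + n2 (tau a b f) n))).
    { intros n. pose proof (green_identity a b f g n) as E.
      replace (wronskian a f g n) with (wronskian a f g (n - 1) + (f n * tau a b g n - g n * tau a b f n))%C
        by (rewrite E; ring).
      eapply Rle_trans; [apply Cmod_triangle|]. apply Rplus_le_compat_l.
      unfold Cminus. eapply Rle_trans; [apply Cmod_triangle|]. rewrite Cmod_opp !Cmod_mult. unfold n2.
      pose proof (pow2_ge_0 (Cmod (f n) - Cmod (tau a b g n))). pose proof (pow2_ge_0 (Cmod (g n) - Cmod (tau a b f n))).
      pose proof (pow2_ge_0 (Cmod (f n))). pose proof (pow2_ge_0 (Cmod (g n))).
      pose proof (pow2_ge_0 (Cmod (tau a b f n))). pose proof (pow2_ge_0 (Cmod (tau a b g n))). nra. }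
    induction k as [|k IH].
    - rewrite rsum_O. exact (ST 0%Z).
    - rewrite rsum_S. specialize (ST (Z.of_nat (S k))).
      replace (Z.of_nat (S k) - 1)%Z with (Z.of_nat k) in ST by lia. lra. }
  rewrite !rsum_plus_R in S0. specialize (HF k). specialize (HG k). specialize (HF' k). specialize (HG' k). lra.
Qed.

Lemma sqsum_plus_solves z n0 u : solves_from a b z n0 u -> sqsum_plus u -> sqsum_plus (tau a b u).
Proof.
  intros Hu H. apply (sqsum_plus_tail (fun n => z * u n)%C _ n0); [intros; symmetry; auto|].
  now apply sqsum_plus_scal.
Qed.

(* Variation of constants with a discrete Gronwall estimate. *)
Lemma limit_circle_plus_all : limit_circle_plus a b -> forall z u, solution a b z u -> sqsum_plus u.
Proof.
  intros [z0 H0] z u Hu.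
  destruct (solution_exists z0 0 1 0) as [s1 [S1 [S10 S11]]].
  destruct (solution_exists z0 0 0 1) as [s2 [S2 [S20 S21]]].
  set (w := wronskian a s1 s2 0).
  assert (Hw : w <> 0).
  { unfold w, wronskian. rewrite S10 S11 S20 S21. replace (a 0%Z * (1 * 1 - 0 * 0))%C with (RtoC (a 0%Z)) by ring.
    apply RtoC_a_neq_0. }
  assert (Ww : forall n, wronskian a s1 s2 n = w) by (intros; now apply (wronskian_const_all a b z0)).
  set (t := fun n => Cmod (s1 n) + Cmod (s2 n)).
  (* [m] measures the coefficients of [u] in the basis [s1], [s2]. They vary with [n] by terms
     proportional to [z0 - z], so that [m] grows at most by factors [1 + K t^2]. *)
  set (m := fun n => Cmod (wronskian a u s2 n) + Cmod (wronskian a s1 u n)).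
  pose proof (proj1 (Cmod_gt_0 _) Hw) as Pw.
  assert (U : forall n, Cmod w * Cmod (u (n + 1)%Z) <= m n * t (n + 1)%Z).
  { intros n. destruct (cramer a u s1 s2 n) as [_ E]. rewrite Ww in E. rewrite -Cmod_mult -E.
    eapply Rle_trans; [apply Cmod_triangle|].
    rewrite (Cmod_mult _ (s1 _)) (Cmod_mult _ (s2 _)). unfold m, t.
    pose proof (Cmod_ge_0 (wronskian a u s2 n)). pose proof (Cmod_ge_0 (wronskian a s1 u n)).
    pose proof (Cmod_ge_0 (s1 (n + 1)%Z)). pose proof (Cmod_ge_0 (s2 (n + 1)%Z)). nra. }
  set (K := Cmod (z0 - z) / Cmod w).
  assert (HK : 0 <= K) by (apply Rdiv_le_0_compat; [apply Cmod_ge_0|lra]).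
  assert (ST : forall n, m (n + 1)%Z <= m n * (1 + K * (t (n + 1)%Z * t (n + 1)%Z))).
  { intros n. set (n' := (n + 1)%Z).
    assert (E1 : wronskian a u s2 n' = (wronskian a u s2 n + (z0 - z) * (u n' * s2 n'))%C).
    { pose proof (green_identity a b u s2 n') as G. rewrite Hu S2 in G. replace (n' - 1)%Z with n in G by (unfold n'; lia).
      transitivity ((wronskian a u s2 n' - wronskian a u s2 n) + wronskian a u s2 n)%C; [ring|rewrite -G; ring]. }
    assert (E2 : wronskian a s1 u n' = (wronskian a s1 u n + - ((z0 - z) * (u n' * s1 n')))%C).
    { pose proof (green_identity a b s1 u n') as G. rewrite Hu S1 in G. replace (n' - 1)%Z with n in G by (unfold n'; lia).
      transitivity ((wronskian a s1 u n' - wronskian a s1 u n) + wronskian a s1 u n)%C; [ring|rewrite -G; ring]. }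
    pose proof (Cmod_triangle (wronskian a u s2 n) ((z0 - z) * (u n' * s2 n'))) as T1. rewrite -E1 in T1.
    pose proof (Cmod_triangle (wronskian a s1 u n) (- ((z0 - z) * (u n' * s1 n')))) as T2. rewrite -E2 in T2.
    rewrite Cmod_opp in T2.
    rewrite (Cmod_mult (z0 - z)) (Cmod_mult (u n')) in T1. rewrite (Cmod_mult (z0 - z)) (Cmod_mult (u n')) in T2.
    assert (Q : m n' <= m n + Cmod (z0 - z) * (Cmod (u n') * t n')) by (unfold m, t; lra).
    apply (Rle_trans _ _ _ Q).
    assert (Cmod (z0 - z) * (Cmod (u n') * t n') <= m n * (K * (t n' * t n'))); [|lra].
    replace (Cmod (z0 - z)) with (K * Cmod w) by (unfold K; field; lra).
    assert (Tp : 0 <= t n') by (unfold t; pose proof (Cmod_ge_0 (s1 n')); pose proof (Cmod_ge_0 (s2 n')); lra).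
    specialize (U n). fold n' in U.
    apply Rle_trans with (K * t n' * (Cmod w * Cmod (u n'))); [right; ring|].
    apply Rle_trans with (K * t n' * (m n * t n')); [|right; ring].
    apply Rmult_le_compat_l; [now apply Rmult_le_pos|exact U]. }
  assert (Hs1 := H0 s1 S1). assert (Hs2 := H0 s2 S2). rewrite sqsum_plus_bounded in Hs1. rewrite sqsum_plus_bounded in Hs2.
  destruct Hs1 as [B1 HB1]. destruct Hs2 as [B2 HB2].
  set (Tt := fun k => n2 s1 (Z.of_nat k) + n2 s2 (Z.of_nat k)).
  assert (M0 : 0 <= m 0%Z).
  { unfold m. pose proof (Cmod_ge_0 (wronskian a u s2 0)). pose proof (Cmod_ge_0 (wronskian a s1 u 0)). lra. }
  (* The product of these factors is at most the exponential of the sum of the [K t^2], and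
     [t^2 <= 2 Tt]. *)
  assert (MB : forall k, m (Z.of_nat k) <= m 0%Z * exp (2 * K * rsum Tt k)).
  { induction k as [|k IH].
    - apply Rle_trans with (m 0%Z * 1); [right; simpl; ring|]. apply Rmult_le_compat_l; [exact M0|].
      rewrite -exp_0. apply exp_le. apply Rmult_le_pos; [lra|]. apply rsum_pos. intros j. unfold Tt.
      pose proof (n2_pos s1 (Z.of_nat j)). pose proof (n2_pos s2 (Z.of_nat j)). lra.
    - replace (Z.of_nat (S k)) with (Z.of_nat k + 1)%Z by lia. apply (Rle_trans _ _ _ (ST (Z.of_nat k))).
      rewrite rsum_S (Rmult_plus_distr_l (2 * K)) exp_plus -(Rmult_assoc (m 0%Z)).
      replace (Z.of_nat k + 1)%Z with (Z.of_nat (S k)) by lia.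
      apply Rmult_le_compat; [| |exact IH|].
      + unfold m. pose proof (Cmod_ge_0 (wronskian a u s2 (Z.of_nat k))). pose proof (Cmod_ge_0 (wronskian a s1 u (Z.of_nat k))). lra.
      + assert (0 <= K * (t (Z.of_nat (S k)) * t (Z.of_nat (S k)))) by (apply Rmult_le_pos; [exact HK|nra]). lra.
      + eapply Rle_trans; [|apply exp_ineq1_le]. apply Rplus_le_compat_l.
        replace (2 * K * Tt (S k)) with (K * (2 * Tt (S k))) by ring. apply Rmult_le_compat_l; [exact HK|].
        unfold t, Tt, n2. pose proof (pow2_ge_0 (Cmod (s1 (Z.of_nat (S k))) - Cmod (s2 (Z.of_nat (S k))))). nra. }
  set (MM := m 0%Z * exp (2 * K * (B1 + B2))).
  assert (MB' : forall k, m (Z.of_nat k) <= MM).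
  { intros k. apply (Rle_trans _ _ _ (MB k)). apply Rmult_le_compat_l; [exact M0|]. apply exp_le.
    apply Rmult_le_compat_l; [lra|]. unfold Tt. rewrite rsum_plus_R. specialize (HB1 k). specialize (HB2 k). lra. }
  assert (MM0 : 0 <= MM) by (apply Rmult_le_pos; [exact M0|left; apply exp_pos]).
  apply (sqsum_plus_dominated _ (fun n => RtoC (MM / Cmod w) * (RtoC (Cmod (s1 n)) + RtoC (Cmod (s2 n))))%C 1%Z).
  - intros n Hn. specialize (U (n - 1)%Z). replace (n - 1 + 1)%Z with n in U by lia.
    specialize (MB' (Z.to_nat (n - 1))). replace (Z.of_nat (Z.to_nat (n - 1))) with (n - 1)%Z in MB' by lia.
    rewrite Cmod_mult -RtoC_plus !Cmod_R. fold (t n).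
    assert (Tp : 0 <= t n) by (unfold t; pose proof (Cmod_ge_0 (s1 n)); pose proof (Cmod_ge_0 (s2 n)); lra).
    rewrite (Rabs_pos_eq (t n)) // Rabs_pos_eq; [|apply Rdiv_le_0_compat; lra].
    apply (Rmult_le_reg_l (Cmod w)); [exact Pw|].
    replace (Cmod w * (MM / Cmod w * t n)) with (MM * t n) by (field; lra).
    apply (Rle_trans _ _ _ U). now apply Rmult_le_compat_r.
  - apply sqsum_plus_scal, sqsum_plus_plus.
    + apply (sqsum_plus_dominated _ s1 0%Z); [|now apply H0].
      intros n _. rewrite Cmod_R Rabs_pos_eq; [lra|apply Cmod_ge_0].
    + apply (sqsum_plus_dominated _ s2 0%Z); [|now apply H0].
      intros n _. rewrite Cmod_R Rabs_pos_eq; [lra|apply Cmod_ge_0].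
Qed.

End Coefficients.

(** * Boundary conditions at the right endpoint *)

Definition vanishes (u : nat -> C) : Prop :=
  forall eps, 0 < eps -> exists N, forall k, (N <= k)%nat -> Cmod (u k) < eps.

Lemma filterlim_vanishes u : filterlim u eventually (locally (RtoC 0)) <-> vanishes u.
Proof. rewrite filterlim_C0. reflexivity. Qed.

Lemma vanishes_ext u v n0 : (forall k, (n0 <= k)%nat -> u k = v k) -> vanishes u -> vanishes v.
Proof.
  intros E H eps He. destruct (H eps He) as [N HN]. exists (max N n0). intros k Hk.
  rewrite -E; [apply HN; lia|lia].
Qed.

Lemma vanishes_const (c : C) u : (exists N, forall k, (N <= k)%nat -> u k = c) -> vanishes u -> c = 0.
Proof.
  intros [N E] H. apply NNPP; intros X. apply Cmod_gt_0 in X.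
  destruct (H _ X) as [M HM]. specialize (HM (max N M) ltac:(lia)). rewrite E in HM; [lra|lia].
Qed.

Lemma pluecker_limit a v w f g (d : C) Bf Bg :
  d <> 0 -> (forall k : nat, wronskian a v w (Z.of_nat k) = d) ->
  vanishes (fun k => wronskian a v f (Z.of_nat k)) -> vanishes (fun k => wronskian a v g (Z.of_nat k)) ->
  (forall k : nat, Cmod (wronskian a w f (Z.of_nat k)) <= Bf) ->
  (forall k : nat, Cmod (wronskian a w g (Z.of_nat k)) <= Bg) ->
  vanishes (fun k => wronskian a f g (Z.of_nat k)).
Proof.
  intros Hd Ed Hf Hg HBf HBg eps He. apply Cmod_gt_0 in Hd as Pd.
  pose proof (Rle_trans _ _ _ (Cmod_ge_0 _) (HBf O)) as F0. pose proof (Rle_trans _ _ _ (Cmod_ge_0 _) (HBg O)) as G0.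
  set (e := eps * Cmod d / (Bf + Bg + 1)).
  assert (E0 : 0 < e) by (apply Rdiv_lt_0_compat; [apply Rmult_lt_0_compat; lra|lra]).
  destruct (Hf e E0) as [N1 H1]. destruct (Hg e E0) as [N2 H2].
  exists (max N1 N2). intros k Hk. specialize (H1 k ltac:(lia)). specialize (H2 k ltac:(lia)).
  pose proof (pluecker a v w f g (Z.of_nat k)) as P. rewrite Ed in P.
  assert (Q : Cmod d * Cmod (wronskian a f g (Z.of_nat k)) <= e * (Bf + Bg)).
  { rewrite -Cmod_mult P. unfold Cminus. eapply Rle_trans; [apply Cmod_triangle|].
    rewrite Cmod_opp (Cmod_mult _ (wronskian a w g _)) (Cmod_mult _ (wronskian a w f _)).
    specialize (HBf k). specialize (HBg k).
    pose proof (Cmod_ge_0 (wronskian a v f (Z.of_nat k))). pose proof (Cmod_ge_0 (wronskian a v g (Z.of_nat k))).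
    pose proof (Cmod_ge_0 (wronskian a w f (Z.of_nat k))). pose proof (Cmod_ge_0 (wronskian a w g (Z.of_nat k))).
    nra. }
  apply (Rmult_lt_reg_l (Cmod d)); [exact Pd|]. apply (Rle_lt_trans _ _ _ Q).
  apply Rlt_le_trans with (e * (Bf + Bg + 1)); [nra|]. unfold e. right. field. lra.
Qed.

Lemma companion a b z v : (forall n, 0 < a n) -> solution a b z v -> (exists n, v n <> 0) ->
  exists w (d : C), solution a b z w /\ d <> 0 /\ forall n, wronskian a v w n = d.
Proof.
  intros Ha Hv [n Hn]. destruct (solution_exists a b Ha z n 0 1) as [w [Hw [W0 W1]]].
  exists w, (wronskian a v w n). split; [exact Hw|split].
  - unfold wronskian. rewrite W0 W1. replace (a n * (v n * 1 - v (n + 1)%Z * 0))%C with (a n * v n)%C by ring.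
    apply Cmult_neq_0; [now apply RtoC_a_neq_0|exact Hn].
  - intros m. now apply (wronskian_const_all a b z).
Qed.

Definition max_plus (a b : Z -> R) (f : Z -> C) : Prop := sqsum_plus f /\ sqsum_plus (tau a b f).

Lemma limit_circle_max_plus a b z u : (forall n, 0 < a n) -> limit_circle_plus a b -> solution a b z u -> max_plus a b u.
Proof.
  intros Ha L Hu. assert (S : sqsum_plus u) by now apply (limit_circle_plus_all a b Ha L z).
  split; [exact S|]. apply (sqsum_plus_solves a b z 0%Z); auto. now apply solution_solves_from.
Qed.

(** At a limit circle endpoint the boundary condition defines an isotropic subspace. With a second
    solution [w], [W(v, w)] is a nonzero constant and [W(w, f)], [W(w, g)] are bounded, so by
    [pluecker] the vanishing of [W(v, f)] and [W(v, g)] passes to [W(f, g)]. *)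
Lemma boundary_form_rank_one a b z (v : Z -> C) f g : (forall n, 0 < a n) -> limit_circle_plus a b ->
  solution a b z v -> (exists n, v n <> 0) -> max_plus a b f -> max_plus a b g ->
  vanishes (fun k => wronskian a v f (Z.of_nat k)) -> vanishes (fun k => wronskian a v g (Z.of_nat k)) ->
  vanishes (fun k => wronskian a f g (Z.of_nat k)).
Proof.
  intros Ha L Hv Nv [F1 F2] [G1 G2] Hf Hg.
  destruct (companion a b z v Ha Hv Nv) as [w [d [Hw [Hd Ed]]]].
  destruct (limit_circle_max_plus a b z w Ha L Hw) as [W1 W2].
  destruct (wronskian_bounded a b w f W1 F1 W2 F2) as [Bf HBf].
  destruct (wronskian_bounded a b w g W1 G1 W2 G2) as [Bg HBg].
  exact (pluecker_limit a v w f g d Bf Bg Hd (fun k => Ed _) Hf Hg HBf HBg).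
Qed.

Lemma wronskian_antisym a f g n : wronskian a f g n = (- wronskian a g f n)%C.
Proof. unfold wronskian. ring. Qed.

Lemma vanishes_wronskian_antisym a f g : vanishes (fun k => wronskian a f g (Z.of_nat k)) ->
  vanishes (fun k => wronskian a g f (Z.of_nat k)).
Proof.
  intros H eps He. destruct (H eps He) as [N HN]. exists N. intros k Hk.
  rewrite wronskian_antisym Cmod_opp. auto.
Qed.

Lemma bc_plus_iff H f : bc_plus H f <-> (limit_circle_plus (coef_a H) (coef_b H) ->
  vanishes (fun k => wronskian (coef_a H) (fun n => RtoC (bv_plus H n)) f (Z.of_nat k))).
Proof. unfold bc_plus. rewrite filterlim_vanishes. reflexivity. Qed.

Lemma boundary_sequence_C a b v : boundary_sequence a b v ->
  exists l, solution a b (RtoC l) (fun n => RtoC (v n)) /\ exists n, RtoC (v n) <> 0.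
Proof.
  intros [[l Hl] [n Hn]]. exists l; split; [exact Hl|]. exists n. intros X. apply RtoC_inj in X. auto.
Qed.

Lemma wronskian_tail a f f' g g' n0 : (forall n, (n0 <= n)%Z -> f n = f' n) ->
  (forall n, (n0 <= n)%Z -> g n = g' n) -> forall n, (n0 <= n)%Z -> wronskian a f g n = wronskian a f' g' n.
Proof. intros Ef Eg n Hn. unfold wronskian. rewrite !Ef ?Eg //; lia. Qed.

Lemma bc_plus_tail H f g n0 : (forall n, (n0 <= n)%Z -> f n = g n) -> bc_plus H f -> bc_plus H g.
Proof.
  rewrite !bc_plus_iff. intros E Hf L. specialize (Hf L). revert Hf.
  apply (vanishes_ext _ _ (Z.to_nat n0)). intros k Hk. apply (wronskian_tail _ _ _ _ _ n0); auto. lia.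
Qed.

Lemma vanishes_plus u v : vanishes u -> vanishes v -> vanishes (fun k => u k + v k)%C.
Proof.
  intros Hu Hv eps He. destruct (Hu (eps / 2) ltac:(lra)) as [N1 H1]. destruct (Hv (eps / 2) ltac:(lra)) as [N2 H2].
  exists (max N1 N2). intros k Hk. specialize (H1 k ltac:(lia)). specialize (H2 k ltac:(lia)).
  apply (Rle_lt_trans _ _ _ (Cmod_triangle _ _)). lra.
Qed.

Lemma vanishes_scal c u : vanishes u -> vanishes (fun k => c * u k)%C.
Proof.
  intros Hu eps He. pose proof (Cmod_ge_0 c). 
  destruct (Hu (eps / (Cmod c + 1)) ltac:(apply Rdiv_lt_0_compat; lra)) as [N HN].
  exists N. intros k Hk. specialize (HN k Hk). rewrite Cmod_mult.
  apply Rle_lt_trans with ((Cmod c + 1) * Cmod (u k)).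
  - pose proof (Cmod_ge_0 (u k)). nra.
  - apply (Rmult_lt_compat_l (Cmod c + 1)) in HN; [|lra].
    replace ((Cmod c + 1) * (eps / (Cmod c + 1))) with eps in HN by (field; lra). exact HN.
Qed.

Lemma bc_plus_lin H c f g : bc_plus H f -> bc_plus H g -> bc_plus H (fun n => f n + c * g n)%C.
Proof.
  rewrite !bc_plus_iff. intros Hf Hg L.
  apply (vanishes_ext (fun k => wronskian (coef_a H) (fun n => RtoC (bv_plus H n)) f (Z.of_nat k)
     + c * wronskian (coef_a H) (fun n => RtoC (bv_plus H n)) g (Z.of_nat k))%C _ O).
  - intros k _. unfold wronskian. ring.
  - apply vanishes_plus; [auto|]. apply vanishes_scal. auto.
Qed.

Lemma bc_plus_conj H f : bc_plus H f -> bc_plus H (fun n => Cconj (f n)).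
Proof.
  rewrite !bc_plus_iff. intros Hf L eps He. destruct (Hf L eps He) as [N HN]. exists N. intros k Hk.
  rewrite -Cmod_conj. rewrite -{1}(Cconj_conj (wronskian _ _ _ _)) Cmod_conj.
  replace (Cconj (wronskian (coef_a H) (fun n => RtoC (bv_plus H n)) (fun n => Cconj (f n)) (Z.of_nat k)))
    with (wronskian (coef_a H) (fun n => RtoC (bv_plus H n)) f (Z.of_nat k)).
  - rewrite Cmod_conj. auto.
  - unfold wronskian. rewrite Cmult_conj Cminus_conj !Cmult_conj !Cconj_conj.
    assert (R : forall r : R, Cconj (RtoC r) = RtoC r) by (intros; unfold Cconj, RtoC; simpl; f_equal; ring).
    rewrite !R. reflexivity.
Qed.

Lemma bc_plus_finite H (f : Z -> C) n0 : (forall n, (n0 <= n)%Z -> f n = 0) -> bc_plus H f.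
Proof.
  intros E. apply (bc_plus_tail H (fun _ => RtoC 0) f n0); [intros; symmetry; auto|].
  apply bc_plus_iff. intros _ eps He. exists O. intros k _. unfold wronskian.
  match goal with |- Cmod ?x < _ => replace x with (RtoC 0) by ring end. now rewrite Cmod_0.
Qed.

(* In the limit circle case this is the boundary condition; in the limit point
   case two independent square summable solutions would span all of them. *)
Lemma domain_solutions_dependent H z n0 f g :
  solves_from (coef_a H) (coef_b H) z n0 f -> solves_from (coef_a H) (coef_b H) z n0 g ->
  sqsum_plus f -> sqsum_plus g -> bc_plus H f -> bc_plus H g ->
  forall n, (n0 - 1 <= n)%Z -> wronskian (coef_a H) f g n = 0.
Proof.
  intros Hf Hg Sf Sg Bf Bg. set (a := coef_a H) in *. set (b := coef_b H) in *.
  assert (Ha : forall n, 0 < a n) by apply coef_a_pos.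
  set (d := wronskian a f g (n0 - 1)).
  assert (Cd : forall n, (n0 - 1 <= n)%Z -> wronskian a f g n = d) by (intros; now apply (wronskian_const a b z n0)).
  assert (D0 : d = 0).
  { destruct (classic (limit_circle_plus a b)) as [L|L].
    - rewrite bc_plus_iff in Bf. rewrite bc_plus_iff in Bg.
      destruct (boundary_sequence_C _ _ _ (bv_plus_ok H L)) as [l [Hl Nl]].
      apply (vanishes_const d (fun k => wronskian a f g (Z.of_nat k))).
      { exists (Z.to_nat n0). intros k Hk. apply Cd. lia. }
      apply (boundary_form_rank_one a b (RtoC l) (fun n => RtoC (bv_plus H n))); auto; split; auto;
       apply (sqsum_plus_solves a b z n0); auto.
    - apply NNPP; intros N. apply L. exists z. intros u Hu.
      assert (Hu' := solution_solves_from a b z n0 u Hu).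
      apply (sqsum_plus_tail (fun n => (wronskian a u g (n0 - 1) / d) * f n + (wronskian a f u (n0 - 1) / d) * g n)%C _ n0).
      + intros n Hn. destruct (cramer a u f g n) as [E _].
        rewrite (Cd n ltac:(lia)) in E.
        rewrite (wronskian_const a b z n0 u g Hu' Hg n ltac:(lia)) in E.
        rewrite (wronskian_const a b z n0 f u Hf Hu' n ltac:(lia)) in E.
        replace (u n) with (d * u n / d)%C by (field; auto). rewrite -E. field; auto.
      + apply sqsum_plus_plus; now apply sqsum_plus_scal. }
  intros n Hn. now rewrite Cd.
Qed.

(** [H] and [K] share their coefficients but perhaps not their boundary sequences. If one nontrivial
    solution near [+oo] satisfies both conditions, each condition amounts to a vanishing Wronskian
    with that solution, so the first implies the second. *)
Lemma bc_plus_transfer H K (u : Z -> C) z n0 f :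
  coef_a H = coef_a K -> coef_b H = coef_b K ->
  solves_from (coef_a H) (coef_b H) z n0 u -> (exists n, (n0 <= n)%Z /\ u n <> 0) ->
  sqsum_plus u -> bc_plus H u -> bc_plus K u ->
  sqsum_plus f -> sqsum_plus (jtau H f) -> bc_plus H f -> bc_plus K f.
Proof.
  intros Ea Eb Hu [n1 [Hn1 Nu]] Su BHu BKu Sf Tf BHf.
  rewrite bc_plus_iff in BHu. rewrite bc_plus_iff in BKu. rewrite bc_plus_iff in BHf. rewrite bc_plus_iff.
  rewrite -Ea -Eb in BKu |- *. intros L. specialize (BHu L). specialize (BKu L). specialize (BHf L).
  unfold jtau in Tf. assert (Ha : forall n, 0 < coef_a H n) by apply coef_a_pos.
  assert (LK : limit_circle_plus (coef_a K) (coef_b K)) by now rewrite -Ea -Eb.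
  destruct (boundary_sequence_C _ _ _ (bv_plus_ok H L)) as [l [Hl Nl]].
  destruct (boundary_sequence_C _ _ _ (bv_plus_ok K LK)) as [m [Hm Nm]]. rewrite -Ea -Eb in Hm.
  set (a := coef_a H) in *. set (b := coef_b H) in *.
  assert (Mu : max_plus a b u) by (split; [exact Su|apply (sqsum_plus_solves a b z n0); auto]).
  assert (Muf : vanishes (fun k => wronskian a u f (Z.of_nat k))).
  { apply (boundary_form_rank_one a b (RtoC l) (fun n => RtoC (bv_plus H n))); auto. now split. }
  (* [boundary_form_rank_one] asks for a solution on all of Z; [y] continues the tail of [u]. *)
  destruct (solution_exists a b Ha z n1 (u n1) (u (n1 + 1)%Z)) as [y [Hy [Y0 Y1]]].
  assert (Ey : forall n, (n1 <= n)%Z -> u n = y n).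
  { intros n Hn. apply (solution_unique_up a b Ha z (n1 + 1)).
    - intros k Hk. apply Hu. lia.
    - now apply solution_solves_from.
    - replace (n1 + 1 - 1)%Z with n1 by lia. auto.
    - auto.
    - lia. }
  assert (T : forall h, vanishes (fun k => wronskian a u h (Z.of_nat k)) -> vanishes (fun k => wronskian a y h (Z.of_nat k))).
  { intros h. apply (vanishes_ext _ _ (Z.to_nat n1)). intros k Hk. apply (wronskian_tail _ _ _ _ _ n1); auto. lia. }
  apply (boundary_form_rank_one a b z y (fun n => RtoC (bv_plus K n)) f); auto.
  - exists n1. now rewrite Y0.
  - now apply (limit_circle_max_plus a b (RtoC m)).
  - now split.
  - apply T, vanishes_wronskian_antisym, BKu.
Qed.

(** * Reflection *)

Definition refl (f : Z -> C) : Z -> C := fun n => f (- n)%Z.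

Lemma refl_refl f : refl (refl f) = f.
Proof. extensionality n. unfold refl. f_equal. lia. Qed.

(** [a n] joins the sites [n] and [n + 1], whose reflections are [- n] and [- n - 1]; hence the
    shift by one. *)
Definition refl_a (a : Z -> R) : Z -> R := fun n => a (- n - 1)%Z.
Definition refl_b (b : Z -> R) : Z -> R := fun n => b (- n)%Z.

Lemma tau_refl a b f n : tau (refl_a a) (refl_b b) (refl f) n = tau a b f (- n)%Z.
Proof.
  unfold tau, refl, refl_a, refl_b.
  replace (- (n - 1) - 1)%Z with (- n)%Z by lia. replace (- (n - 1))%Z with (- n + 1)%Z by lia.
  replace (- (n + 1))%Z with (- n - 1)%Z by lia. ring.
Qed.

Lemma wronskian_refl a f g n : wronskian (refl_a a) (refl f) (refl g) n = (- wronskian a f g (- n - 1)%Z)%C.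
Proof.
  unfold wronskian, refl, refl_a. replace (- n - 1 + 1)%Z with (- n)%Z by lia.
  replace (- (n + 1))%Z with (- n - 1)%Z by lia. ring.
Qed.

Lemma refl_a_a a : refl_a (refl_a a) = a.
Proof. extensionality n. unfold refl_a. f_equal. lia. Qed.
Lemma refl_b_b b : refl_b (refl_b b) = b.
Proof. extensionality n. unfold refl_b. f_equal. lia. Qed.

Lemma solution_refl a b z u : solution a b z u -> solution (refl_a a) (refl_b b) z (refl u).
Proof. intros H n. rewrite tau_refl H. reflexivity. Qed.

Lemma limit_circle_refl a b : limit_circle_plus (refl_a a) (refl_b b) <-> limit_circle_minus a b.
Proof.
  split; intros [z H]; exists z; intros u Hu.
  - exact (H _ (solution_refl _ _ _ _ Hu)).
  - apply solution_refl in Hu. rewrite refl_a_a refl_b_b in Hu. specialize (H _ Hu).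
    unfold sqsum_minus in H. rewrite -(refl_refl u). exact H.
Qed.

Lemma limit_circle_refl_plus a b : limit_circle_minus (refl_a a) (refl_b b) <-> limit_circle_plus a b.
Proof. rewrite -limit_circle_refl refl_a_a refl_b_b. reflexivity. Qed.

Lemma boundary_sequence_refl a b v : boundary_sequence a b v ->
  boundary_sequence (refl_a a) (refl_b b) (fun n => v (- n)%Z).
Proof.
  intros [[l Hl] [n Hn]]. split.
  - exists l. exact (solution_refl _ _ _ _ Hl).
  - exists (- n)%Z. now rewrite Z.opp_involutive.
Qed.

(** Exchanging the endpoints allows statements near [-oo] to be read off from those near [+oo]. *)
Definition refl_jacobi (H : jacobi) : jacobi := Jacobi (refl_a (coef_a H)) (refl_b (coef_b H))
  (fun n => coef_a_pos H (- n - 1)%Z) (fun n => bv_plus H (- n)%Z) (fun n => bv_minus H (- n)%Z)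
  (fun L => boundary_sequence_refl _ _ _ (bv_plus_ok H (proj1 (limit_circle_refl_plus _ _) L)))
  (fun L => boundary_sequence_refl _ _ _ (bv_minus_ok H (proj1 (limit_circle_refl _ _) L))).

Lemma vanishes_shift u : vanishes (fun k => u (S k)) <-> vanishes u.
Proof.
  split; intros H eps He; destruct (H eps He) as [N HN].
  - exists (S N). intros [|k] Hk; [lia|]. apply HN. lia.
  - exists N. intros k Hk. apply HN. lia.
Qed.

Lemma bc_minus_iff H f : bc_minus H f <-> (limit_circle_minus (coef_a H) (coef_b H) ->
  vanishes (fun k => wronskian (coef_a H) (fun n => RtoC (bv_minus H n)) f (- Z.of_nat k))).
Proof. unfold bc_minus. rewrite filterlim_vanishes. reflexivity. Qed.

(** Reflection changes the sign of the Wronskian and shifts its index by one; neither affects a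
    limit 0. *)
Lemma bc_minus_refl H f : bc_minus H f <-> bc_plus (refl_jacobi H) (refl f).
Proof.
  rewrite bc_minus_iff bc_plus_iff. simpl. rewrite limit_circle_refl.
  assert (E : forall k, wronskian (refl_a (coef_a H)) (fun n => RtoC (bv_minus H (- n)%Z)) (refl f) (Z.of_nat k) =
     (- wronskian (coef_a H) (fun n => RtoC (bv_minus H n)) f (- Z.of_nat (S k)))%C).
  { intros k. change (fun n => RtoC (bv_minus H (- n)%Z)) with (refl (fun n => RtoC (bv_minus H n))).
    rewrite wronskian_refl. do 2 f_equal. lia. }
  assert (V : vanishes (fun k => wronskian (coef_a H) (fun n => RtoC (bv_minus H n)) f (- Z.of_nat k)) <->
    vanishes (fun k => wronskian (refl_a (coef_a H)) (fun n => RtoC (bv_minus H (- n)%Z)) (refl f) (Z.of_nat k))).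
  { rewrite -(vanishes_shift (fun k => wronskian (coef_a H) (fun n => RtoC (bv_minus H n)) f (- Z.of_nat k))).
    split; intros X eps He; destruct (X eps He) as [N HN]; exists N; intros k Hk; specialize (HN k Hk).
    - now rewrite E Cmod_opp.
    - now rewrite E Cmod_opp in HN. }
  tauto.
Qed.

Lemma sqsum_minus_refl f : sqsum_minus f <-> sqsum_plus (refl f).
Proof. reflexivity. Qed.

Lemma bc_minus_tail H f g n0 : (forall n, (n <= n0)%Z -> f n = g n) -> bc_minus H f -> bc_minus H g.
Proof.
  intros E. rewrite !bc_minus_refl. apply (bc_plus_tail _ _ _ (- n0)%Z). intros n Hn. apply E. lia.
Qed.

Lemma bc_minus_lin H c f g : bc_minus H f -> bc_minus H g -> bc_minus H (fun n => f n + c * g n)%C.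
Proof. rewrite !bc_minus_refl. apply bc_plus_lin. Qed.

Lemma bc_minus_conj H f : bc_minus H f -> bc_minus H (fun n => Cconj (f n)).
Proof. rewrite !bc_minus_refl. apply bc_plus_conj. Qed.

Lemma bc_minus_finite H (f : Z -> C) n0 : (forall n, (n <= n0)%Z -> f n = 0) -> bc_minus H f.
Proof.
  intros E. apply bc_minus_refl, (bc_plus_finite _ _ (- n0)%Z). intros n Hn. apply E. lia.
Qed.

Definition solves_upto (a b : Z -> R) (z : C) (n0 : Z) (f : Z -> C) : Prop :=
  forall n, (n <= n0)%Z -> tau a b f n = (z * f n)%C.

Lemma solves_upto_refl a b z n0 f : solves_upto a b z n0 f ->
  solves_from (refl_a a) (refl_b b) z (- n0) (refl f).
Proof. intros H n Hn. rewrite tau_refl H; [reflexivity|lia]. Qed.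

Lemma domain_solutions_dependent_minus H z n0 f g :
  solves_upto (coef_a H) (coef_b H) z n0 f -> solves_upto (coef_a H) (coef_b H) z n0 g ->
  sqsum_minus f -> sqsum_minus g -> bc_minus H f -> bc_minus H g ->
  forall n, (n <= n0)%Z -> wronskian (coef_a H) f g n = 0.
Proof.
  intros Hf Hg Sf Sg Bf Bg n Hn. rewrite bc_minus_refl in Bf. rewrite bc_minus_refl in Bg.
  assert (E := domain_solutions_dependent (refl_jacobi H) z (- n0) (refl f) (refl g)
    (solves_upto_refl _ _ _ _ _ Hf) (solves_upto_refl _ _ _ _ _ Hg) Sf Sg Bf Bg (- n - 1)%Z ltac:(lia)).
  simpl in E. rewrite wronskian_refl in E. replace (- (- n - 1) - 1)%Z with n in E by lia.
  transitivity (- - wronskian (coef_a H) f g n)%C; [ring|rewrite E; ring].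
Qed.

(** * The space l2 and symmetric operators *)

(** The range is [- M - 1 <= n <= M]: 0 is counted once, and the split agrees with that of
    [l2norm]. *)
Definition zs (p : Z -> R) (M : nat) : R :=
  rsum (fun k => p (Z.of_nat k)) M + rsum (fun k => p (- Z.of_nat (S k))%Z) M.

Definition zc (p : Z -> C) (M : nat) : C := (zs (fun n => fst (p n)) M, zs (fun n => snd (p n)) M).

Lemma zs_O p : zs p 0 = p 0%Z + p (-1)%Z.
Proof. unfold zs. now rewrite !rsum_O. Qed.

Lemma zs_S p M : zs p (S M) = zs p M + (p (Z.of_nat (S M)) + p (- Z.of_nat (S (S M)))%Z).
Proof. unfold zs. rewrite !rsum_S. ring. Qed.

Lemma zc_O p : zc p 0 = (p 0%Z + p (-1)%Z)%C.
Proof. unfold zc. rewrite !zs_O. reflexivity. Qed.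

Lemma zc_S p M : zc p (S M) = (zc p M + (p (Z.of_nat (S M)) + p (- Z.of_nat (S (S M)))%Z))%C.
Proof. unfold zc. rewrite !zs_S. reflexivity. Qed.

Lemma zs_le p q M : (forall n, p n <= q n) -> zs p M <= zs q M.
Proof. intros H. unfold zs. apply Rplus_le_compat; apply rsum_le_of; auto. Qed.

Lemma zs_plus p q M : zs (fun n => p n + q n) M = zs p M + zs q M.
Proof. unfold zs. rewrite !rsum_plus_R. ring. Qed.

Lemma zs_scal c p M : zs (fun n => c * p n) M = c * zs p M.
Proof. unfold zs. rewrite !rsum_scal_l. ring. Qed.

Lemma zs_pos p M : (forall n, 0 <= p n) -> 0 <= zs p M.
Proof. intros H. apply Rplus_le_le_0_compat; apply rsum_pos; auto. Qed.

Lemma zs_ext p q M : (forall n, p n = q n) -> zs p M = zs q M.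
Proof. intros H. apply Rle_antisym; apply zs_le; intros n; rewrite H; lra. Qed.

Lemma zc_ext p q M : (forall n, p n = q n) -> zc p M = zc q M.
Proof. intros H. unfold zc. f_equal; apply zs_ext; intros; now rewrite H. Qed.

Lemma zs_mono p M N : (forall n, 0 <= p n) -> (M <= N)%nat -> zs p M <= zs p N.
Proof.
  intros H L. induction L as [|m L IH]; [lra|]. rewrite zs_S.
  pose proof (H (Z.of_nat (S m))). pose proof (H (- Z.of_nat (S (S m)))%Z). lra.
Qed.

Lemma zc_plus p q M : zc (fun n => p n + q n)%C M = (zc p M + zc q M)%C.
Proof. unfold zc. simpl. rewrite !zs_plus. reflexivity. Qed.

Lemma Cmod_zc p M : Cmod (zc p M) <= zs (fun n => Cmod (p n)) M.
Proof.
  induction M as [|M IH].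
  - rewrite zc_O zs_O. apply Cmod_triangle.
  - rewrite zc_S zs_S. eapply Rle_trans; [apply Cmod_triangle|]. apply Rplus_le_compat; [exact IH|apply Cmod_triangle].
Qed.

Lemma zc_green a b f g M : zc (fun n => f n * tau a b g n - g n * tau a b f n)%C M =
  (wronskian a f g (Z.of_nat M) - wronskian a f g (- Z.of_nat M - 2))%C.
Proof.
  induction M as [|M IH].
  - rewrite zc_O !green_identity. simpl Z.of_nat. simpl Z.sub. simpl Z.opp. ring.
  - rewrite zc_S IH !green_identity.
    replace (Z.of_nat (S M) - 1)%Z with (Z.of_nat M) by lia.
    replace (- Z.of_nat (S (S M)))%Z with (- Z.of_nat M - 2)%Z by lia.
    replace (- Z.of_nat (S M) - 2)%Z with (- Z.of_nat M - 2 - 1)%Z by lia. ring.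
Qed.

Lemma l2_bounded f : l2 f <-> exists B, forall M, zs (n2 f) M <= B.
Proof.
  unfold l2, sqsum_minus. rewrite sqsum_plus_bounded.
  rewrite ex_series_bounded; [|intros; apply pow2_ge_0].
  fold (rsum (fun k => n2 f (- Z.of_nat k)%Z)).
  assert (P : forall (u : nat -> R) M, rsum u (S M) = u O + rsum (fun k => u (S k)) M).
  { intros u M. induction M as [|M IH]; [now rewrite rsum_S !rsum_O|]. rewrite rsum_S IH rsum_S. ring. }
  split.
  - intros [[A HA] [B HB]]. exists (B + A). intros M. unfold zs. specialize (HB M). specialize (HA (S M)).
    change (rsum (fun k => n2 f (- Z.of_nat k)%Z) (S M) <= A) in HA. rewrite P in HA.
    pose proof (n2_pos f (- Z.of_nat 0)%Z). lra.
  - intros [B HB]. split.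
    + exists (n2 f 0%Z + B). intros M. change (rsum (fun k => n2 f (- Z.of_nat k)%Z) M <= n2 f 0%Z + B).
      specialize (HB M). unfold zs in HB. pose proof (rsum_pos (fun k => n2 f (Z.of_nat k)) M (fun k => n2_pos _ _)).
      assert (rsum (fun k => n2 f (- Z.of_nat k)%Z) M <= rsum (fun k => n2 f (- Z.of_nat k)%Z) (S M)).
      { rewrite rsum_S. pose proof (n2_pos f (- Z.of_nat (S M))%Z). lra. }
      rewrite P in H0. change (n2 f (- Z.of_nat 0)%Z) with (n2 f 0%Z) in H0. lra.
    + exists B. intros M. specialize (HB M). unfold zs in HB.
      pose proof (rsum_pos (fun k => n2 f (- Z.of_nat (S k))%Z) M (fun k => n2_pos _ _)). lra.
Qed.

Lemma l2norm_lim f : l2 f -> exists L, l2norm f = sqrt L /\ 0 <= L /\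
  (forall M, zs (n2 f) M <= L) /\ is_lim_seq (zs (n2 f)) L.
Proof.
  intros Hf. pose proof Hf as Hb. rewrite l2_bounded in Hb. destruct Hb as [B HB].
  set (u := fun k => n2 f (- Z.of_nat (S k))%Z). set (v := fun k => n2 f (Z.of_nat k)).
  assert (Hu : ex_series u).
  { apply ex_series_bounded; [intros k; exact (n2_pos f (- Z.of_nat (S k))%Z)|]. exists B. intros M. specialize (HB M). unfold zs in HB.
    pose proof (rsum_pos v M (fun k => n2_pos f (Z.of_nat k))). change (rsum u M <= B). unfold v, u in *. lra. }
  assert (Hv : ex_series v).
  { apply ex_series_bounded; [intros k; exact (n2_pos f (Z.of_nat k))|]. exists B. intros M. specialize (HB M). unfold zs in HB.
    pose proof (rsum_pos u M (fun k => n2_pos f (- Z.of_nat (S k))%Z)). change (rsum v M <= B). unfold v, u in *. lra. }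
  pose proof (Series_correct _ Hu) as Lu. pose proof (Series_correct _ Hv) as Lv.
  exists (Series u + Series v). split; [reflexivity|].
  assert (L : is_lim_seq (zs (n2 f)) (Series u + Series v)).
  { rewrite Rplus_comm. exact (is_lim_seq_plus' _ _ _ _ Lv Lu). }
  assert (M : forall M, zs (n2 f) M <= Series u + Series v).
  { apply (is_lim_seq_incr_compare _ _ L). intros n. apply zs_mono; [apply n2_pos|lia]. }
  repeat split; auto. apply Rle_trans with (zs (n2 f) 0); [|auto]. apply zs_pos, n2_pos.
Qed.

Lemma l2norm_pos f : 0 <= l2norm f.
Proof. apply sqrt_pos. Qed.

Lemma l2norm_ub f M : l2 f -> zs (n2 f) M <= l2norm f * l2norm f.
Proof. intros H. destruct (l2norm_lim f H) as [L [-> [L0 [HL _]]]]. rewrite sqrt_sqrt //. Qed.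

Lemma l2norm_sq_le f K : l2 f -> (forall M, zs (n2 f) M <= K) -> l2norm f * l2norm f <= K.
Proof.
  intros H HK. destruct (l2norm_lim f H) as [L [-> [L0 [_ HL]]]]. rewrite sqrt_sqrt //.
  apply (is_lim_seq_le _ _ L K HK HL). apply is_lim_seq_const.
Qed.

Lemma l2norm_le f K : l2 f -> 0 <= K -> (forall M, zs (n2 f) M <= K * K) -> l2norm f <= K.
Proof.
  intros H K0 HK. pose proof (l2norm_sq_le f _ H HK). pose proof (l2norm_pos f). nra.
Qed.

Lemma l2norm_coord f n : l2 f -> Cmod (f n) <= l2norm f.
Proof.
  intros H. pose proof (l2norm_ub f (Z.to_nat (Z.abs n)) H) as U.
  pose proof (l2norm_pos f). pose proof (Cmod_ge_0 (f n)).
  assert (n2 f n <= zs (n2 f) (Z.to_nat (Z.abs n))); [|unfold n2 in *; nra].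
  assert (P : forall M, n2 f (Z.of_nat M) <= zs (n2 f) M /\ n2 f (- Z.of_nat M) <= zs (n2 f) M).
  { intros [|M].
    - rewrite zs_O. pose proof (n2_pos f 0%Z). pose proof (n2_pos f (-1)%Z). simpl. lra.
    - rewrite zs_S. pose proof (zs_pos (n2 f) M (n2_pos f)). pose proof (n2_pos f (Z.of_nat (S M))).
      pose proof (n2_pos f (- Z.of_nat (S (S M)))%Z).
      assert (n2 f (- Z.of_nat (S M))%Z <= zs (n2 f) M).
      { destruct M as [|M]; [rewrite zs_O; pose proof (n2_pos f 0%Z); simpl; lra|].
        rewrite zs_S. pose proof (zs_pos (n2 f) M (n2_pos f)). pose proof (n2_pos f (Z.of_nat (S M))). lra. }
      lra. }
  destruct (P (Z.to_nat (Z.abs n))) as [P1 P2]. destruct (Z_le_dec 0 n).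
  - replace (Z.of_nat (Z.to_nat (Z.abs n))) with n in P1 by lia. exact P1.
  - replace (- Z.of_nat (Z.to_nat (Z.abs n)))%Z with n in P2 by lia. exact P2.
Qed.

Lemma l2_plus f g : l2 f -> l2 g -> l2 (fun n => f n + g n)%C.
Proof.
  intros [A B] [A' B']. split; [|now apply sqsum_plus_plus].
  rewrite sqsum_minus_refl in A. rewrite sqsum_minus_refl in A'. exact (sqsum_plus_plus _ _ A A').
Qed.

Lemma l2_scal c f : l2 f -> l2 (fun n => c * f n)%C.
Proof.
  intros [A B]. split; [|now apply sqsum_plus_scal].
  rewrite sqsum_minus_refl in A. exact (sqsum_plus_scal c _ A).
Qed.

Lemma l2_conj f : l2 f -> l2 (fun n => Cconj (f n)).
Proof.
  intros [A B]. split; [|now apply sqsum_plus_conj].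
  rewrite sqsum_minus_refl in A. exact (sqsum_plus_conj _ A).
Qed.

Lemma l2_ext f g : (forall n, f n = g n) -> l2 f -> l2 g.
Proof. intros E. replace g with f; [auto|]. extensionality n. auto. Qed.

Lemma l2_lin c f g : l2 f -> l2 g -> l2 (fun n => f n + c * g n)%C.
Proof. intros Hf Hg. apply l2_plus; [exact Hf|now apply l2_scal]. Qed.

Lemma l2_minus f g : l2 f -> l2 g -> l2 (fun n => f n - g n)%C.
Proof. intros Hf Hg. apply (l2_ext (fun n => f n + (-(1)) * g n)%C); [intros; ring|]. now apply l2_lin. Qed.

Lemma cauchy_schwarz f g M : l2 f -> l2 g -> zs (fun n => Cmod (f n) * Cmod (g n)) M <= l2norm f * l2norm g.
Proof.
  intros Hf Hg. pose proof (l2norm_pos f) as F0. pose proof (l2norm_pos g) as G0.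
  pose proof (l2norm_ub f M Hf) as F1. pose proof (l2norm_ub g M Hg) as G1.
  set (F := l2norm f) in *. set (G := l2norm g) in *. set (S := zs _ M).
  assert (X : S - F * G <= 0); [|lra].
  apply (Rle_of_eps _ ((F + G) / 2) 1 ltac:(lra)). intros e He.
  (* For [2 x y <= t x^2 + y^2 / t] the optimal [t] is the ratio of the norms; [e] keeps it defined
     and positive when a norm is 0. *)
  set (t := (G + e) / (F + e)). assert (Ht : 0 < t) by (apply Rdiv_lt_0_compat; lra).
  assert (B : 2 * S <= t * zs (n2 f) M + / t * zs (n2 g) M).
  { rewrite -!zs_scal -zs_plus. unfold S. apply zs_le. intros n. unfold n2.
    pose proof (pow2_ge_0 (t * Cmod (f n) - Cmod (g n))) as P.
    apply (Rmult_le_reg_l t); [exact Ht|]. rewrite Rmult_plus_distr_l -(Rmult_assoc t (/ t)) Rinv_r; [|lra]. nra. }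
  assert (T1 : t * zs (n2 f) M <= (G + e) * F).
  { apply Rle_trans with (t * (F * F)); [apply Rmult_le_compat_l; lra|].
    unfold t. apply (Rmult_le_reg_r (F + e)); [lra|].
    replace ((G + e) / (F + e) * (F * F) * (F + e)) with ((G + e) * (F * F)) by (field; lra).
    assert (0 <= (G + e) * F) by nra. nra. }
  assert (T2 : / t * zs (n2 g) M <= (F + e) * G).
  { apply Rle_trans with (/ t * (G * G)); [apply Rmult_le_compat_l; [left; now apply Rinv_0_lt_compat|lra]|].
    unfold t. apply (Rmult_le_reg_r (G + e)); [lra|].
    replace (/ ((G + e) / (F + e)) * (G * G) * (G + e)) with ((F + e) * (G * G)) by (field; lra).
    assert (0 <= (F + e) * G) by nra. nra. }
  lra.
Qed.

Lemma l2norm_triangle f g : l2 f -> l2 g -> l2norm (fun n => f n + g n)%C <= l2norm f + l2norm g.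
Proof.
  intros Hf Hg. pose proof (l2norm_pos f). pose proof (l2norm_pos g).
  apply l2norm_le; [now apply l2_plus|lra|]. intros M.
  apply Rle_trans with (zs (fun n => n2 f n + (n2 g n + 2 * (Cmod (f n) * Cmod (g n)))) M).
  - apply zs_le. intros n. unfold n2. pose proof (Cmod_triangle (f n) (g n)). pose proof (Cmod_ge_0 (f n + g n)). nra.
  - rewrite !zs_plus zs_scal. pose proof (l2norm_ub f M Hf). pose proof (l2norm_ub g M Hg).
    pose proof (cauchy_schwarz f g M Hf Hg). lra.
Qed.

Lemma l2norm_scal c f : l2 f -> l2norm (fun n => c * f n)%C <= Cmod c * l2norm f.
Proof.
  intros Hf. pose proof (l2norm_pos f). pose proof (Cmod_ge_0 c).
  apply l2norm_le; [now apply l2_scal|nra|]. intros M.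
  rewrite (zs_ext _ (fun n => (Cmod c * Cmod c) * n2 f n)).
  - rewrite zs_scal. pose proof (l2norm_ub f M Hf). assert (0 <= Cmod c * Cmod c) by nra. nra.
  - intros n. unfold n2. rewrite Cmod_mult. ring.
Qed.

Lemma l2norm_ext f g : (forall n, f n = g n) -> l2norm f = l2norm g.
Proof. intros E. f_equal. extensionality n. auto. Qed.

Lemma l2norm_eq_0 f n : l2 f -> l2norm f <= 0 -> f n = 0.
Proof. intros Hf H. pose proof (l2norm_coord f n Hf). pose proof (Cmod_ge_0 (f n)). apply Cmod_eq_0. lra. Qed.

Definition trunc (N : nat) (h : Z -> C) (n : Z) : C :=
  if Z_le_dec (- Z.of_nat N - 1) n then if Z_le_dec n (Z.of_nat N) then h n else 0 else 0.

Lemma trunc_out N h n : (n < - Z.of_nat N - 1)%Z \/ (Z.of_nat N < n)%Z -> trunc N h n = 0.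
Proof. intros H. unfold trunc. destruct (Z_le_dec (- Z.of_nat N - 1) n), (Z_le_dec n (Z.of_nat N)); auto; lia. Qed.

Lemma trunc_in N h n : (- Z.of_nat N - 1 <= n <= Z.of_nat N)%Z -> trunc N h n = h n.
Proof. intros H. unfold trunc. destruct (Z_le_dec (- Z.of_nat N - 1) n), (Z_le_dec n (Z.of_nat N)); auto; lia. Qed.

Lemma trunc_approx h eps : l2 h -> 0 < eps -> exists N,
  l2 (fun n => h n - trunc N h n)%C /\ l2norm (fun n => h n - trunc N h n)%C <= eps.
Proof.
  intros Hh He. destruct (l2norm_lim h Hh) as [L [_ [L0 [UB LIM]]]].
  assert (E2 : 0 < eps * eps) by nra.
  apply is_lim_seq_spec in LIM. destruct (LIM (mkposreal _ E2)) as [N HN]. specialize (HN N (Nat.le_refl _)).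
  simpl in HN. apply Rabs_def2 in HN. exists N.
  set (r := fun n => (h n - trunc N h n)%C).
  assert (IN : forall k, (k <= N)%nat -> n2 r (Z.of_nat k) = 0 /\ n2 r (- Z.of_nat (S k)) = 0).
  { intros k Hk. unfold n2, r. rewrite !trunc_in; try lia. rewrite !Cmod_minus_diag. split; ring. }
  assert (OUT : forall k, (N < k)%nat -> n2 r (Z.of_nat k) = n2 h (Z.of_nat k) /\
      n2 r (- Z.of_nat (S k)) = n2 h (- Z.of_nat (S k))).
  { intros k Hk. unfold n2, r. rewrite !trunc_out; try lia. split; do 2 f_equal; ring. }
  assert (Z0 : forall M, (M <= N)%nat -> zs (n2 r) M = 0).
  { induction M as [|M IH]; intros HM.
    - rewrite zs_O. destruct (IN O ltac:(lia)) as [A B]. simpl in A, B. rewrite A B. ring.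
    - rewrite zs_S IH; [|lia]. destruct (IN (S M) ltac:(lia)) as [A B]. rewrite A B. ring. }
  assert (B : forall M, zs (n2 r) M <= eps * eps).
  { intros M. destruct (le_lt_dec M N) as [LE|LT]; [rewrite Z0 //; lra|].
    assert (E : zs (n2 r) M = zs (n2 h) M - zs (n2 h) N).
    { assert (LE : (N <= M)%nat) by lia. clear LT. induction LE as [|m LE IH].
      - rewrite Z0 //. ring.
      - rewrite !zs_S IH. destruct (OUT (S m) ltac:(lia)) as [-> ->]. ring. }
    specialize (UB M). lra. }
  assert (Hr : l2 r) by (apply l2_bounded; now exists (eps * eps)).
  split; [exact Hr|]. apply l2norm_le; auto. lra.
Qed.

(** * Jacobi operators *)

Lemma tau_lin a b c f g n : tau a b (fun n => f n + c * g n)%C n = (tau a b f n + c * tau a b g n)%C.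
Proof. unfold tau. ring. Qed.

Lemma tau_conj a b f n : tau a b (fun n => Cconj (f n)) n = Cconj (tau a b f n).
Proof.
  assert (R : forall r : R, Cconj (RtoC r) = RtoC r) by (intros; unfold Cconj, RtoC; simpl; f_equal; ring).
  unfold tau. rewrite !Cplus_conj !Cmult_conj !R. reflexivity.
Qed.

Lemma domain_lin H c f g : domain H f -> domain H g -> domain H (fun n => f n + c * g n)%C.
Proof.
  intros [A [B [D E]]] [A' [B' [D' E']]]. split; [|split; [|split]].
  - now apply l2_lin.
  - unfold jtau in *. apply (l2_ext (fun n => tau (coef_a H) (coef_b H) f n + c * tau (coef_a H) (coef_b H) g n)%C).
    + intros n. now rewrite tau_lin.
    + now apply l2_lin.
  - now apply bc_minus_lin.
  - now apply bc_plus_lin.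
Qed.

Lemma domain_ext H f g : (forall n, f n = g n) -> domain H f -> domain H g.
Proof. intros E. replace g with f; [auto|]. extensionality n. auto. Qed.

Lemma domain_conj H f : domain H f -> domain H (fun n => Cconj (f n)).
Proof.
  intros [A [B [D E]]]. split; [|split; [|split]].
  - now apply l2_conj.
  - apply (l2_ext (fun n => Cconj (jtau H f n))); [intros n; unfold jtau; now rewrite tau_conj|]. now apply l2_conj.
  - now apply bc_minus_conj.
  - now apply bc_plus_conj.
Qed.

Lemma domain_minus H f g : domain H f -> domain H g -> domain H (fun n => f n - g n)%C.
Proof. intros Hf Hg. apply (domain_ext H (fun n => f n + (-(1)) * g n)%C); [intros; ring|]. now apply domain_lin. Qed.

Lemma l2_finite (f : Z -> C) N : (forall n, (N < Z.abs n)%Z -> f n = 0) -> l2 f.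
Proof.
  intros E. assert (S0 : sqsum_plus (fun _ => RtoC 0)).
  { apply sqsum_plus_bounded. exists 0. intros M. unfold n2. rewrite Cmod_0.
    induction M as [|M IH]; [rewrite rsum_O; simpl; lra|rewrite rsum_S; simpl in *; lra]. }
  split.
  - apply sqsum_minus_refl. apply (sqsum_plus_tail (fun _ => RtoC 0) _ (Z.abs N + 1)); [|exact S0].
    intros n Hn. symmetry. apply E. lia.
  - apply (sqsum_plus_tail (fun _ => RtoC 0) _ (Z.abs N + 1)); [|exact S0]. intros n Hn. symmetry. apply E. lia.
Qed.

Lemma domain_finite_support H (f : Z -> C) N : (forall n, (N < Z.abs n)%Z -> f n = 0) -> domain H f.
Proof.
  intros E. split; [|split; [|split]].
  - exact (l2_finite f N E).
  - apply (l2_finite _ (N + 1)). intros n Hn. unfold jtau, tau. rewrite !E; try lia. ring.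
  - apply (bc_minus_finite _ _ (- Z.abs N - 1)). intros n Hn. apply E. lia.
  - apply (bc_plus_finite _ _ (Z.abs N + 1)). intros n Hn. apply E. lia.
Qed.

Lemma resolvent_bound H z : resolvent_set H z -> exists K, 1 <= K /\ forall f, domain H f ->
  l2norm f <= K * l2norm (fun n => jtau H f n - z * f n)%C.
Proof.
  intros [_ [K HK]]. exists (Rmax 1 K). split; [apply Rmax_l|]. intros f Hf.
  apply (Rle_trans _ _ _ (HK f Hf)). apply Rmult_le_compat_r; [apply l2norm_pos|apply Rmax_r].
Qed.

Lemma domain_residual_l2 H z f : domain H f -> l2 (fun n => jtau H f n - z * f n)%C.
Proof. intros [A [B _]]. apply l2_minus; [exact B|now apply l2_scal]. Qed.

(* [f] is approximated in the graph norm by [R (trunc N h)], [h = (H - z) f],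
   which solves the equation near both endpoints. *)
Lemma graph_approx H z f eps : resolvent_set H z -> domain H f -> 0 < eps ->
  exists g N, domain H g /\ (forall n, (N < Z.abs n)%Z -> jtau H g n = (z * g n)%C) /\
   l2norm (fun n => f n - g n)%C <= eps /\ l2norm (fun n => jtau H f n - jtau H g n)%C <= eps.
Proof.
  intros Hz Hf He. destruct (resolvent_bound H z Hz) as [K [K1 HK]].
  set (h := fun n => (jtau H f n - z * f n)%C). assert (Hh : l2 h) by now apply domain_residual_l2.
  set (e := eps / (K * (Cmod z + 1) + 1)). pose proof (Cmod_ge_0 z).
  assert (PK : 0 <= K * (Cmod z + 1)) by nra.
  assert (E0 : 0 < e) by (apply Rdiv_lt_0_compat; lra).
  assert (Ee : e * (K * (Cmod z + 1) + 1) = eps) by (unfold e; field; lra).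
  destruct (trunc_approx h e Hh E0) as [N [L2 B]].
  destruct (proj1 Hz _ L2) as [r [[Dr Er] _]].
  exists (fun n => f n - r n)%C, (Z.of_nat N + 1)%Z.
  assert (Br : l2norm r <= K * e).
  { eapply Rle_trans; [apply HK, Dr|]. apply Rmult_le_compat_l; [lra|].
    rewrite (l2norm_ext _ _ Er). exact B. }
  assert (Tr : forall n, jtau H (fun n => f n - r n)%C n = (jtau H f n - jtau H r n)%C) by (intros; unfold jtau, tau; ring).
  assert (Ke : K * e <= eps) by (rewrite -Ee; assert (0 <= K * Cmod z) by nra; nra).
  split; [now apply domain_minus|]. split; [|split].
  - intros n Hn. rewrite Tr. specialize (Er n). rewrite trunc_out in Er; [|lia]. unfold h in Er.
    transitivity (jtau H f n - (jtau H r n - z * r n) - z * r n)%C; [ring|rewrite Er; ring].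
  - rewrite (l2norm_ext _ r); [lra|]. intros n. ring.
  - rewrite (l2norm_ext _ (fun n => (h n - trunc N h n) + z * r n)%C).
    + eapply Rle_trans; [apply l2norm_triangle; [exact L2|apply l2_scal, Dr]|].
      pose proof (l2norm_scal z r (proj1 Dr)).
      assert (Cmod z * l2norm r <= Cmod z * (K * e)) by (apply Rmult_le_compat_l; lra).
      rewrite -Ee. nra.
    + intros n. rewrite Tr -(Er n). ring.
Qed.

(** Beyond [N] both sequences solve the same equation and satisfy the boundary conditions. The two
    Wronskians left by Green's formula therefore vanish exactly, not only in the limit. *)
Lemma solutions_green_zero H z f g N : domain H f -> domain H g ->
  (forall n, (N < Z.abs n)%Z -> jtau H f n = (z * f n)%C) ->
  (forall n, (N < Z.abs n)%Z -> jtau H g n = (z * g n)%C) ->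
  forall M, (Z.abs N + 2 <= Z.of_nat M)%Z -> zc (fun n => f n * jtau H g n - g n * jtau H f n)%C M = 0.
Proof.
  intros [[Fm Fp] [_ [BFm BFp]]] [[Gm Gp] [_ [BGm BGp]]] Ef Eg M HM. unfold jtau in *. rewrite zc_green.
  rewrite (domain_solutions_dependent H z (Z.abs N + 1) f g); auto; try lia.
  - rewrite (domain_solutions_dependent_minus H z (- Z.abs N - 1) f g); auto; try lia.
    + ring.
    + intros n Hn. apply Ef. lia.
    + intros n Hn. apply Eg. lia.
  - intros n Hn. apply Ef. lia.
  - intros n Hn. apply Eg. lia.
Qed.

(** Symmetry is not built into [domain]; it follows from a single resolvent point through
    [graph_approx]. The form is bilinear, and the sesquilinear version is obtained by conjugating
    one argument with [domain_conj]. *)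
Theorem symmetric H z f g : resolvent_set H z -> domain H f -> domain H g ->
  vanishes (zc (fun n => f n * jtau H g n - g n * jtau H f n)%C).
Proof.
  intros Hz Hf Hg eps He.
  (* [Q] collects the norms that multiply the four approximation errors; the 2 pays for bounding the
     norms of [f'] and [g'] by those of [f] and [g] plus 1. *)
  set (Q := l2norm (jtau H g) + l2norm f + l2norm (jtau H f) + l2norm g + 2).
  pose proof (l2norm_pos (jtau H g)). pose proof (l2norm_pos (jtau H f)). pose proof (l2norm_pos f). pose proof (l2norm_pos g).
  assert (HQ : 0 < Q) by (unfold Q; lra).
  set (e := Rmin 1 (eps / (2 * Q))).
  assert (E0 : 0 < e) by (apply Rmin_pos; [lra|apply Rdiv_lt_0_compat; lra]).
  assert (E1 : e <= 1) by apply Rmin_l.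
  assert (E2 : e * Q <= eps / 2).
  { assert (X : e <= eps / (2 * Q)) by apply Rmin_r. apply (Rmult_le_compat_r Q) in X; [|lra].
    replace (eps / (2 * Q) * Q) with (eps / 2) in X by (field; lra). exact X. }
  destruct (graph_approx H z f e Hz Hf E0) as [f' [Nf [Df [Ef [Af Bf]]]]].
  destruct (graph_approx H z g e Hz Hg E0) as [g' [Ng [Dg [Eg [Ag Bg]]]]].
  set (N := Z.max (Z.abs Nf) (Z.abs Ng)).
  exists (Z.to_nat (Z.abs N + 2)). intros M HM.
  assert (Z0 : zc (fun n => f' n * jtau H g' n - g' n * jtau H f' n)%C M = 0).
  { apply (solutions_green_zero H z f' g' N); auto; try lia; intros n Hn; [apply Ef|apply Eg]; lia. }
  assert (Lf : l2 (fun n => f n - f' n)%C) by (apply l2_minus; [apply Hf|apply Df]).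
  assert (Lg : l2 (fun n => g n - g' n)%C) by (apply l2_minus; [apply Hg|apply Dg]).
  assert (Ltf : l2 (fun n => jtau H f n - jtau H f' n)%C) by (apply l2_minus; [apply Hf|apply Df]).
  assert (Ltg : l2 (fun n => jtau H g n - jtau H g' n)%C) by (apply l2_minus; [apply Hg|apply Dg]).
  assert (Nf' : l2norm f' <= l2norm f + 1).
  { rewrite (l2norm_ext f' (fun n => f n + (-(1)) * (f n - f' n))%C); [|intros; ring].
    eapply Rle_trans; [apply l2norm_triangle; [apply Hf|now apply l2_scal]|].
    pose proof (l2norm_scal (-(1)) _ Lf) as X. rewrite Cmod_opp Cmod_1 in X. lra. }
  assert (Ng' : l2norm g' <= l2norm g + 1).
  { rewrite (l2norm_ext g' (fun n => g n + (-(1)) * (g n - g' n))%C); [|intros; ring].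
    eapply Rle_trans; [apply l2norm_triangle; [apply Hg|now apply l2_scal]|].
    pose proof (l2norm_scal (-(1)) _ Lg) as X. rewrite Cmod_opp Cmod_1 in X. lra. }
  assert (EQ : zc (fun n => f n * jtau H g n - g n * jtau H f n)%C M =
    zc (fun n => ((f n - f' n) * jtau H g n + f' n * (jtau H g n - jtau H g' n))
       + (- ((g n - g' n) * jtau H f n) + - (g' n * (jtau H f n - jtau H f' n))))%C M).
  { transitivity (zc (fun n => f n * jtau H g n - g n * jtau H f n)%C M - 0)%C; [ring|]. rewrite -Z0.
    rewrite (zc_ext (fun n => f n * jtau H g n - g n * jtau H f n)%C (fun n => (((f n - f' n) * jtau H g n + f' n * (jtau H g n - jtau H g' n))
       + (- ((g n - g' n) * jtau H f n) + - (g' n * (jtau H f n - jtau H f' n)))) + (f' n * jtau H g' n - g' n * jtau H f' n))%C).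
    - rewrite zc_plus. ring.
    - intros n. ring. }
  rewrite EQ !zc_plus.
  assert (CS : forall p q, l2 p -> l2 q -> Cmod (zc (fun n => p n * q n)%C M) <= l2norm p * l2norm q).
  { intros p q Hp Hq. eapply Rle_trans; [apply Cmod_zc|].
    rewrite (zs_ext _ (fun n => Cmod (p n) * Cmod (q n))); [|intros; apply Cmod_mult]. now apply cauchy_schwarz. }
  assert (CSo : forall p q, l2 p -> l2 q -> Cmod (zc (fun n => - (p n * q n))%C M) <= l2norm p * l2norm q).
  { intros p q Hp Hq. eapply Rle_trans; [apply Cmod_zc|].
    rewrite (zs_ext _ (fun n => Cmod (p n) * Cmod (q n))); [|intros; rewrite Cmod_opp; apply Cmod_mult]. now apply cauchy_schwarz. }
  pose proof (CS _ _ Lf (proj1 (proj2 Hg))) as C1. pose proof (CS _ _ (proj1 Df) Ltg) as C2.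
  pose proof (CSo _ _ Lg (proj1 (proj2 Hf))) as C3. pose proof (CSo _ _ (proj1 Dg) Ltf) as C4.
  apply Rle_lt_trans with (e * Q); [|lra].
  eapply Rle_trans; [apply Cmod_triangle|].
  eapply Rle_trans; [apply Rplus_le_compat; apply Cmod_triangle|].
  pose proof (l2norm_pos f'). pose proof (l2norm_pos g').
  assert (l2norm (fun n => f n - f' n)%C * l2norm (jtau H g) <= e * l2norm (jtau H g)) by (apply Rmult_le_compat_r; lra).
  assert (l2norm (fun n => g n - g' n)%C * l2norm (jtau H f) <= e * l2norm (jtau H f)) by (apply Rmult_le_compat_r; lra).
  assert (l2norm f' * l2norm (fun n => jtau H g n - jtau H g' n)%C <= (l2norm f + 1) * e)
    by (apply Rmult_le_compat; auto using l2norm_pos).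
  assert (l2norm g' * l2norm (fun n => jtau H f n - jtau H f' n)%C <= (l2norm g + 1) * e)
    by (apply Rmult_le_compat; auto using l2norm_pos).
  unfold Q. lra.
Qed.

(** * Non-real points and the spectrum *)

Lemma snd_zc p M : snd (zc p M) = zs (fun n => snd (p n)) M.
Proof. reflexivity. Qed.

(** For symmetric [H] the imaginary part of [<(H - z) u, u>] is [- Im z |u|^2]; here this appears as
    a limit of partial sums. [symmetric], applied to the conjugate of [u] and [u], yields twice the
    imaginary part, whence the [2 * eps]. *)
Lemma energy H z0 z u : resolvent_set H z0 -> domain H u ->
  forall eps, 0 < eps -> exists N, forall M, (N <= M)%nat ->
   Rabs (Im z * zs (n2 u) M + snd (zc (fun n => (jtau H u n - z * u n) * Cconj (u n))%C M)) < eps.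
Proof.
  intros Hz0 Hu eps He.
  destruct (symmetric H z0 (fun n => Cconj (u n)) u Hz0 (domain_conj H u Hu) Hu (2 * eps) ltac:(lra)) as [N HN].
  exists N. intros M HM. specialize (HN M HM).
  pose proof (Rle_lt_trans _ _ _ (snd_le_Cmod _) HN) as K. rewrite snd_zc in K.
  rewrite (zs_ext _ (fun n => 2 * (Im z * n2 u n + snd ((jtau H u n - z * u n) * Cconj (u n))%C))) in K.
  - rewrite zs_scal zs_plus zs_scal in K. rewrite snd_zc.
    rewrite Rabs_mult (Rabs_pos_eq 2) in K; [|lra]. apply (Rmult_lt_reg_l 2); [lra|exact K].
  - intros n. unfold jtau. rewrite tau_conj. fold (jtau H u n).
    set (t := jtau H u n). set (x := u n).
    assert (E : n2 u n = fst x * fst x + snd x * snd x).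
    { unfold n2, Cmod. fold x. rewrite pow2_sqrt; [ring|]. simpl. nra. }
    rewrite E. destruct x as [x1 x2]. destruct t as [t1 t2]. destruct z as [z1 z2].
    unfold Cconj, Im; simpl. ring.
Qed.

Section Resolvent.
Variable (H : jacobi).
Hypothesis (NE : exists z0, resolvent_set H z0).

Lemma nonreal_bound z u : domain H u ->
  Rabs (Im z) * l2norm u <= l2norm (fun n => jtau H u n - z * u n)%C.
Proof.
  intros Hu. destruct NE as [z0 Hz0]. set (g := fun n => (jtau H u n - z * u n)%C).
  assert (Hg : l2 g) by now apply domain_residual_l2.
  pose proof (l2norm_pos u) as U0. pose proof (l2norm_pos g) as G0. set (I := Rabs (Im z)). assert (I0 : 0 <= I) by apply Rabs_pos.
  assert (B : forall M, I * zs (n2 u) M <= l2norm g * l2norm u).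
  { intros M. assert (X : I * zs (n2 u) M - l2norm g * l2norm u <= 0); [|lra].
    apply (Rle_of_eps _ 1 1 ltac:(lra)). intros e He.
    destruct (energy H z0 z u Hz0 Hu e ltac:(lra)) as [N HN].
    specialize (HN (max N M) ltac:(lia)). set (M' := max N M) in *.
    assert (Mono : zs (n2 u) M <= zs (n2 u) M') by (apply zs_mono; [apply n2_pos|lia]).
    pose proof (zs_pos (n2 u) M' (n2_pos u)) as P.
    assert (C0 : Cmod (zc (fun n => g n * Cconj (u n))%C M') <= l2norm g * l2norm u).
    { eapply Rle_trans; [apply Cmod_zc|]. rewrite (zs_ext _ (fun n => Cmod (g n) * Cmod (u n))).
      - apply cauchy_schwarz; [exact Hg|apply Hu].
      - intros n. now rewrite Cmod_mult Cmod_conj. }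
    pose proof (snd_le_Cmod (zc (fun n => g n * Cconj (u n))%C M')) as S0. fold g in HN.
    change (fun n => ((jtau H u n - z * u n) * Cconj (u n))%C) with (fun n => (g n * Cconj (u n))%C) in HN.
    set (y := snd (zc (fun n => g n * Cconj (u n))%C M')) in *.
    pose proof (Rabs_triang (Im z * zs (n2 u) M' + y) (- y)) as T.
    replace (Im z * zs (n2 u) M' + y + - y) with (Im z * zs (n2 u) M') in T by ring.
    rewrite Rabs_Ropp Rabs_mult (Rabs_pos_eq (zs (n2 u) M')) // in T. fold I in T.
    assert (I * zs (n2 u) M <= I * zs (n2 u) M') by now apply Rmult_le_compat_l. lra. }
  destruct (Req_dec I 0) as [E|N]; [rewrite E; lra|]. assert (IP : 0 < I) by lra.
  assert (Q : l2norm u * l2norm u <= l2norm g * l2norm u / I).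
  { apply l2norm_sq_le; [apply Hu|]. intros M. specialize (B M). apply (Rmult_le_reg_l I); [exact IP|].
    replace (I * (l2norm g * l2norm u / I)) with (l2norm g * l2norm u) by (field; lra). exact B. }
  apply (Rmult_le_compat_l I) in Q; [|lra].
  replace (I * (l2norm g * l2norm u / I)) with (l2norm g * l2norm u) in Q by (field; lra).
  destruct (Req_dec (l2norm u) 0) as [E|NN]; [rewrite E; lra|]. nra.
Qed.

(** Suits sequences cut off at a zero: the equation fails only at that site, where [u] vanishes, so
    every term of the sum is 0. *)
Lemma energy_zero z u : domain H u -> Im z <> 0 ->
  (exists N, forall M, (N <= M)%nat -> zc (fun n => (jtau H u n - z * u n) * Cconj (u n))%C M = 0) ->
  forall n, u n = 0.
Proof.
  intros Hu Hz [N0 E0] n. destruct NE as [z0 Hz0].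
  apply l2norm_eq_0; [apply Hu|]. assert (IP : 0 < Rabs (Im z)) by now apply Rabs_pos_lt.
  assert (B : l2norm u * l2norm u <= 0).
  { apply l2norm_sq_le; [apply Hu|]. intros M. apply (Rle_of_eps _ (/ Rabs (Im z)) 1 ltac:(lra)). intros e He.
    destruct (energy H z0 z u Hz0 Hu e ltac:(lra)) as [N HN].
    specialize (HN (max (max N N0) M) ltac:(lia)). set (M' := max (max N N0) M) in *.
    rewrite E0 in HN; [|lia]. simpl in HN. rewrite Rplus_0_r Rabs_mult in HN.
    pose proof (zs_pos (n2 u) M' (n2_pos u)) as P. rewrite (Rabs_pos_eq (zs _ _)) // in HN.
    assert (zs (n2 u) M <= zs (n2 u) M') by (apply zs_mono; [apply n2_pos|lia]).
    apply (Rmult_le_reg_l (Rabs (Im z))); [exact IP|]. rewrite -Rmult_assoc Rinv_r; [|lra]. nra. }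
  pose proof (l2norm_pos u). nra.
Qed.

End Resolvent.

(** If every point belonged to the spectrum, none would be isolated. *)
Lemma discrete_resolvent_nonempty H : purely_discrete_spectrum H -> exists z0, resolvent_set H z0.
Proof.
  intros PD. apply NNPP; intros N.
  assert (A : forall z, spectrum H z) by (intros z Hz; apply N; now exists z).
  destruct (PD 0 (A 0)) as [[_ [eps [He K]]] _].
  assert (B := K (RtoC (eps / 2)) (A _)).
  assert (X : RtoC (eps / 2) <> 0) by (intros X; apply RtoC_inj in X; lra). specialize (B X).
  replace (RtoC (eps / 2) - 0)%C with (RtoC (eps / 2)) in B by ring.
  rewrite Cmod_R Rabs_pos_eq in B; lra.
Qed.

Lemma eigenvector_real H z f : (exists z0, resolvent_set H z0) -> eigenvector H z f -> (exists n, f n <> 0) -> Im z = 0.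
Proof.
  intros NE [Df Ef] [n Hn]. apply NNPP; intros Hz. apply Hn.
  apply (energy_zero H NE z f Df Hz). exists O. intros M _.
  rewrite (zc_ext _ (fun _ => RtoC 0)).
  - induction M as [|M IH]; [rewrite zc_O; ring|rewrite zc_S IH; ring].
  - intros k. rewrite Ef. ring.
Qed.

Lemma discrete_nonreal_resolvent H z : purely_discrete_spectrum H -> Im z <> 0 -> resolvent_set H z.
Proof.
  intros PD Hz. apply NNPP; intros N. destruct (PD z N) as [_ [[f [Ef Nf]] _]].
  apply Hz. exact (eigenvector_real H z f (discrete_resolvent_nonempty H PD) Ef Nf).
Qed.

(** In place of a Neumann series: a point of the spectrum is an eigenvalue, and an eigenvector for
    [z] close to [w] would violate the resolvent bound at [w]. *)
Lemma discrete_resolvent_open H w : purely_discrete_spectrum H -> resolvent_set H w -> near w (resolvent_set H).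
Proof.
  intros PD Hw. destruct (resolvent_bound H w Hw) as [K [K1 HK]].
  exists (/ K). split; [apply Rinv_0_lt_compat; lra|]. intros z Hz. apply NNPP; intros N.
  destruct (PD z N) as [_ [[f [[Df Ef] [n Nf]]] _]]. apply Nf. apply l2norm_eq_0; [apply Df|].
  specialize (HK f Df). rewrite (l2norm_ext (fun n => jtau H f n - w * f n)%C (fun n => (z - w) * f n)%C) in HK; [|intros k; rewrite Ef; ring].
  pose proof (l2norm_scal (z - w) f (proj1 Df)) as S0. pose proof (l2norm_pos f) as P.
  apply Rnot_lt_le. intros Q.
  assert (K * Cmod (z - w) < 1).
  { apply (Rmult_lt_compat_l K) in Hz; [|lra]. rewrite Rinv_r in Hz; lra. }
  assert (K * l2norm (fun n => (z - w) * f n)%C <= K * (Cmod (z - w) * l2norm f)) by (apply Rmult_le_compat_l; lra).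
  nra.
Qed.

(** * Green's function *)

Definition delta (k n : Z) : C := if Z.eq_dec n k then 1 else 0.

Lemma delta_eq k : delta k k = 1.
Proof. unfold delta. destruct (Z.eq_dec k k); tauto. Qed.

Lemma delta_ne k n : n <> k -> delta k n = 0.
Proof. unfold delta. destruct (Z.eq_dec n k); tauto. Qed.

Lemma delta_l2 k : l2 (delta k).
Proof. apply (l2_finite _ (Z.abs k)). intros n Hn. apply delta_ne. lia. Qed.

Lemma delta_domain H k : domain H (delta k).
Proof. apply (domain_finite_support _ _ (Z.abs k)). intros n Hn. apply delta_ne. lia. Qed.

Lemma delta_zs k p M : (Z.abs k <= Z.of_nat M)%Z -> zc (fun n => delta k n * p n)%C M = p k.
Proof.
  intros HM.
  assert (P : forall M, ((Z.of_nat M < k)%Z \/ (k < - Z.of_nat M - 1)%Z) -> zc (fun n => delta k n * p n)%C M = 0).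
  { induction M0 as [|M0 IH]; intros X.
    - rewrite zc_O !delta_ne; try lia. ring.
    - rewrite zc_S IH; [|lia]. rewrite !delta_ne; try lia. ring. }
  assert (Q : forall M, (- Z.of_nat M - 1 <= k <= Z.of_nat M)%Z -> zc (fun n => delta k n * p n)%C M = p k).
  { induction M0 as [|M0 IH]; intros X.
    - rewrite zc_O. destruct (Z.eq_dec k 0) as [-> | N].
      + rewrite delta_eq delta_ne; [ring|lia].
      + assert (k = (-1)%Z) by (simpl in X; lia). subst k. rewrite delta_eq delta_ne; [ring|lia].
    - rewrite zc_S. destruct (Z.eq_dec k (Z.of_nat (S M0))) as [E|N].
      + rewrite P; [|lia]. rewrite -E delta_eq delta_ne; [ring|lia].
      + destruct (Z.eq_dec k (- Z.of_nat (S (S M0)))) as [E|N'].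
        * rewrite P; [|lia]. rewrite -E delta_eq delta_ne; [ring|lia].
        * rewrite IH; [|lia]. rewrite !delta_ne; try lia. ring. }
  apply Q. lia.
Qed.

(** Column [k] of the resolvent matrix. It is a total function of [z] by [epsilon], with an
    arbitrary value where the resolvent does not exist. *)
Definition green (H : jacobi) (z : C) (k : Z) : Z -> C :=
  epsilon (inhabits (fun _ => RtoC 0)) (fun u => domain H u /\ forall n, (jtau H u n - z * u n)%C = delta k n).

Lemma green_spec H z k : resolvent_set H z ->
  domain H (green H z k) /\ forall n, (jtau H (green H z k) n - z * green H z k n)%C = delta k n.
Proof.
  intros Hz. unfold green. apply epsilon_spec. destruct (proj1 Hz (delta k) (delta_l2 k)) as [u [Hu _]]. now exists u.
Qed.

(** [symmetric] for two columns: the sums are eventually constant, equal to the difference of the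
    two entries, and tend to 0. *)
Lemma green_sym H z k m : resolvent_set H z -> green H z k m = green H z m k.
Proof.
  intros Hz. destruct (green_spec H z k Hz) as [Dk Ek]. destruct (green_spec H z m Hz) as [Dm Em].
  set (u := green H z k) in *. set (v := green H z m) in *.
  pose proof (symmetric H z u v Hz Dk Dm) as S0.
  assert (E : (u m - v k)%C = 0).
  { apply (vanishes_const _ _ ) with (2 := S0). exists (Z.to_nat (Z.max (Z.abs k) (Z.abs m))). intros M HM.
    rewrite (zc_ext _ (fun n => delta m n * u n + delta k n * - v n)%C).
    - rewrite zc_plus !delta_zs; try lia. ring.
    - intros n. rewrite -Em -Ek. ring. }
  transitivity (u m - v k + v k)%C; [ring|rewrite E; ring].
Qed.

Lemma green_bound H z k n : resolvent_set H z -> Im z <> 0 -> Cmod (green H z k n) <= 1 / Rabs (Im z).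
Proof.
  intros Hz Iz. destruct (green_spec H z k Hz) as [D E].
  pose proof (nonreal_bound H (ex_intro _ z Hz) z _ D) as B. rewrite (l2norm_ext (fun n => jtau H (green H z k) n - z * green H z k n)%C _ E) in B.
  assert (IP : 0 < Rabs (Im z)) by now apply Rabs_pos_lt.
  assert (N1 : l2norm (delta k) <= 1).
  { apply l2norm_le; [apply delta_l2|lra|]. intros M.
    assert (P01 : forall n, 0 <= fst (delta k n * 1)%C) by (intros m; unfold delta; destruct (Z.eq_dec m k); simpl; lra).
    rewrite (zs_ext _ (fun n => fst (delta k n * 1)%C)).
    - assert (X : (M <= max M (Z.to_nat (Z.abs k)))%nat) by lia.
      eapply Rle_trans; [apply (zs_mono _ _ _ P01 X)|].
      pose proof (delta_zs k (fun _ => RtoC 1) (max M (Z.to_nat (Z.abs k))) ltac:(lia)) as Q.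
      assert (Q2 : zs (fun n => fst (delta k n * 1)%C) (max M (Z.to_nat (Z.abs k))) = 1) by exact (f_equal fst Q).
      rewrite Q2. lra.
    - intros m. unfold n2, delta. destruct (Z.eq_dec m k); rewrite ?Cmod_1 ?Cmod_0; simpl; ring. }
  pose proof (l2norm_coord _ n (proj1 D)) as P.
  apply (Rmult_le_reg_l (Rabs (Im z))); [exact IP|]. unfold Rdiv. rewrite Rmult_1_l Rinv_r; [|lra].
  assert (Rabs (Im z) * Cmod (green H z k n) <= Rabs (Im z) * l2norm (green H z k)) by (apply Rmult_le_compat_l; lra). lra.
Qed.

(* [z u + delta k] is the resolvent applied to [H (delta k)]. *)
Lemma green_asymptotic H k : (forall z, Im z <> 0 -> resolvent_set H z) ->
  exists K, forall z n, Im z <> 0 -> Cmod (z * green H z k n + delta k n) <= K / Rabs (Im z).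
Proof.
  intros NR. exists (l2norm (jtau H (delta k))). intros z n Iz. assert (Hz := NR z Iz).
  destruct (green_spec H z k Hz) as [D E]. assert (IP : 0 < Rabs (Im z)) by now apply Rabs_pos_lt.
  set (v := fun n => (delta k n + z * green H z k n)%C).
  assert (Dv : domain H v) by (apply domain_lin; [apply delta_domain|exact D]).
  pose proof (nonreal_bound H (ex_intro _ z Hz) z v Dv) as B.
  rewrite (l2norm_ext (fun n => jtau H v n - z * v n)%C (jtau H (delta k))) in B.
  - pose proof (l2norm_coord v n (proj1 Dv)) as P. replace (z * green H z k n + delta k n)%C with (v n) by (unfold v; ring).
    apply (Rmult_le_reg_l (Rabs (Im z))); [exact IP|].
    replace (Rabs (Im z) * (l2norm (jtau H (delta k)) / Rabs (Im z))) with (l2norm (jtau H (delta k))) by (field; lra).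
    assert (Rabs (Im z) * Cmod (v n) <= Rabs (Im z) * l2norm v) by (apply Rmult_le_compat_l; lra). lra.
  - intros m. unfold v, jtau. rewrite tau_lin. specialize (E m). unfold jtau in E.
    rewrite -E. ring.
Qed.

(** The derivative is [v], the resolvent at [w] applied to the column itself. The resolvent bound at
    [w] shows first that the increment [e] is of order [|z - w|], and then that [d = e - (z - w) v]
    is of order [|z - w|^2]. *)
Lemma green_holo H w k n : resolvent_set H w -> near w (resolvent_set H) -> holo (fun z => green H z k n) w.
Proof.
  intros Hw Nw. destruct (resolvent_bound H w Hw) as [K [K1 HK]].
  destruct (green_spec H w k Hw) as [Dw Ew]. destruct (proj1 Hw _ (proj1 Dw)) as [v [[Dv Ev] _]].
  exists (v n). apply hasd_eps. intros eps He.
  set (U := l2norm (green H w k)). pose proof (l2norm_pos (green H w k)) as U0. fold U in U0.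
  set (r := Rmin (/ (2 * K)) (eps / (2 * K * K * U + 1))).
  assert (PK : 0 <= 2 * K * K * U) by (apply Rmult_le_pos; nra).
  assert (Hr : 0 < r) by (apply Rmin_pos; [apply Rinv_0_lt_compat; lra|apply Rdiv_lt_0_compat; lra]).
  eapply near_imp; [|exact (near_and _ _ _ Nw (near_ball w r Hr))]. cbv beta; intros z [Hz Bz].
  destruct (green_spec H z k Hz) as [Dz Ez]. set (uz := green H z k) in *. set (uw := green H w k) in *.
  set (h := Cmod (z - w)) in *. assert (H0 : 0 <= h) by apply Cmod_ge_0.
  assert (R1 : r <= / (2 * K)) by apply Rmin_l. assert (R2 : r <= eps / (2 * K * K * U + 1)) by apply Rmin_r.
  assert (KH : K * h <= 1 / 2).
  { apply Rle_trans with (K * / (2 * K)); [apply Rmult_le_compat_l; lra|]. right; field; lra. }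
  set (e := fun n => (uz n - uw n)%C). assert (De : domain H e) by now apply domain_minus.
  assert (Te : forall m, (jtau H e m - w * e m)%C = ((z - w) * uz m)%C).
  { intros m. transitivity ((jtau H uz m - z * uz m) - (jtau H uw m - w * uw m) + (z - w) * uz m)%C.
    - unfold e, jtau, tau. ring.
    - rewrite Ez Ew. ring. }
  assert (Be : l2norm e <= K * (h * l2norm uz)).
  { eapply Rle_trans; [apply HK, De|]. apply Rmult_le_compat_l; [lra|]. rewrite (l2norm_ext _ _ Te).
    apply l2norm_scal, Dz. }
  assert (Buz : l2norm uz <= U + l2norm e).
  { rewrite (l2norm_ext uz (fun n => uw n + e n)%C); [|intros; unfold e; ring]. apply l2norm_triangle; [apply Dw|apply De]. }
  pose proof (l2norm_pos e) as E0. pose proof (l2norm_pos uz) as UZ0.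
  assert (Be2 : l2norm e <= 2 * K * h * U).
  { assert (K * h * l2norm e <= 1 / 2 * l2norm e) by (apply Rmult_le_compat_r; lra).
    assert (K * (h * l2norm uz) <= K * h * (U + l2norm e)).
    { rewrite -Rmult_assoc. apply Rmult_le_compat_l; [nra|lra]. }
    nra. }
  set (d := fun n => (e n + - (z - w) * v n)%C). assert (Dd : domain H d) by now apply domain_lin.
  assert (Td : forall m, (jtau H d m - w * d m)%C = ((z - w) * e m)%C).
  { intros m. transitivity ((jtau H e m - w * e m) - (z - w) * (jtau H v m - w * v m))%C.
    - unfold d, jtau. rewrite tau_lin. ring.
    - rewrite Te Ev. unfold e. ring. }
  assert (Bd : l2norm d <= K * (h * l2norm e)).
  { eapply Rle_trans; [apply HK, Dd|]. apply Rmult_le_compat_l; [lra|]. rewrite (l2norm_ext _ _ Td).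
    apply l2norm_scal, De. }
  replace (uz n - uw n - v n * (z - w))%C with (d n) by (unfold d, e; ring).
  eapply Rle_trans; [apply l2norm_coord, Dd|]. eapply Rle_trans; [exact Bd|].
  apply Rle_trans with (K * (h * (2 * K * h * U))).
  - apply Rmult_le_compat_l; [lra|]. now apply Rmult_le_compat_l.
  - assert (HR : h <= eps / (2 * K * K * U + 1)) by lra.
    apply (Rmult_le_compat_r (2 * K * K * U + 1)) in HR; [|lra].
    replace (eps / (2 * K * K * U + 1) * (2 * K * K * U + 1)) with eps in HR by (field; lra).
    replace (K * (h * (2 * K * h * U))) with (h * (2 * K * K * U) * h) by ring.
    apply Rmult_le_compat_r; [exact H0|]. nra.
Qed.

Lemma Ceq_of_minus (x y : C) : (x - y)%C = 0 -> x = y.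
Proof. intros E. transitivity (x - y + y)%C; [ring|rewrite E; ring]. Qed.

Lemma Cmult_cancel_l (c x y : C) : c <> 0 -> (c * x)%C = (c * y)%C -> x = y.
Proof. intros N E. replace x with (c * x / c)%C by (field; auto). rewrite E. field; auto. Qed.

Lemma RtoC_neq_0 r : r <> 0 -> RtoC r <> 0.
Proof. intros N X. apply RtoC_inj in X. auto. Qed.

(** * Green's function in terms of the left and right solutions *)

Definition minus_solution (H : jacobi) (z : C) (phi : Z -> C) : Prop :=
  solution (coef_a H) (coef_b H) z phi /\ sqsum_minus phi /\ bc_minus H phi.

Definition plus_solution (H : jacobi) (z : C) (chi : Z -> C) : Prop :=
  solution (coef_a H) (coef_b H) z chi /\ sqsum_plus chi /\ bc_plus H chi.

Lemma sqsum_minus_tail f g n0 : (forall n, (n <= n0)%Z -> f n = g n) -> sqsum_minus f -> sqsum_minus g.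
Proof.
  intros E. rewrite !sqsum_minus_refl. apply (sqsum_plus_tail _ _ (- n0)%Z). intros n Hn. apply E. lia.
Qed.

Lemma sqsum_plus_finite (f : Z -> C) n0 : (forall n, (n0 <= n)%Z -> f n = 0) -> sqsum_plus f.
Proof.
  intros E. apply (sqsum_plus_tail (fun _ => RtoC 0) _ n0); [intros; symmetry; auto|].
  exact (proj2 (l2_finite (fun _ => RtoC 0) 0 (fun _ _ => eq_refl))).
Qed.

Lemma solution_zero a b z u N : (forall n, 0 < a n) -> solution a b z u -> u (N - 1)%Z = 0 -> u N = 0 ->
  forall n, (N - 1 <= n)%Z -> u n = 0.
Proof.
  intros Ha Hu E0 E1. apply (solution_unique_up a b Ha z N u (fun _ => RtoC 0)); auto.
  - now apply solution_solves_from.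
  - intros n _. unfold tau. ring.
Qed.

(* Cutting [phi] off at a zero would give a formal eigenvector of a self-adjoint
   half-line operator with non-real eigenvalue. *)
Lemma minus_solution_nonzero H z phi N : (exists z0, resolvent_set H z0) -> Im z <> 0 ->
  minus_solution H z phi -> (exists n, phi n <> 0) -> phi N <> 0.
Proof.
  intros NE Iz [Hs [Hq Hb]] [n1 Hn1] E.
  set (a := coef_a H) in *. set (b := coef_b H) in *.
  assert (Ha : forall n, 0 < a n) by apply coef_a_pos.
  set (f := fun n => if Z_le_dec n N then phi n else 0).
  assert (F1 : forall n, (n <= N)%Z -> f n = phi n) by (intros n Hn; unfold f; destruct (Z_le_dec n N); [auto|lia]).
  assert (F2 : forall n, (N <= n)%Z -> f n = 0).
  { intros n Hn. unfold f. destruct (Z_le_dec n N); [|auto]. assert (n = N) by lia. subst n. exact E. }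
  assert (T1 : forall n, n <> N -> jtau H f n = (z * f n)%C).
  { intros n Hn. unfold jtau. destruct (Z_le_gt_dec n N) as [L|L].
    - rewrite F1 //. rewrite -(Hs n). unfold tau. rewrite !F1 //; lia.
    - unfold tau. rewrite !F2; try lia. ring. }
  assert (FN : f N = 0) by (apply F2; lia).
  assert (Lf : l2 f).
  { split.
    - apply (sqsum_minus_tail phi f N); [intros; symmetry; auto|exact Hq].
    - apply (sqsum_plus_finite f N). exact F2. }
  assert (Df : domain H f).
  { split; [exact Lf|split; [|split]].
    - apply (l2_ext (fun n => z * f n + jtau H f N * delta N n)%C).
      + intros n. destruct (Z.eq_dec n N) as [-> | NN].
        * rewrite FN delta_eq. ring.
        * rewrite (T1 n NN) delta_ne //. ring.
      + apply l2_lin; [now apply l2_scal|apply delta_l2].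
    - apply (bc_minus_tail H phi f N); [intros; symmetry; auto|exact Hb].
    - apply (bc_plus_finite H f N). exact F2. }
  assert (Z0 : forall n, f n = 0).
  { apply (energy_zero H NE z f Df Iz). exists O. intros M _.
    rewrite (zc_ext _ (fun _ => RtoC 0)).
    - induction M as [|M IH]; [rewrite zc_O; ring|rewrite zc_S IH; ring].
    - intros k. destruct (Z.eq_dec k N) as [-> | NN].
      + rewrite FN. replace (Cconj 0) with (RtoC 0) by (unfold Cconj, RtoC; simpl; f_equal; ring). ring.
      + rewrite T1 //. ring. }
  apply Hn1. destruct (Z_le_gt_dec n1 N) as [L|L]; [rewrite -F1 //|].
  apply (solution_zero a b z phi N Ha Hs); [|exact E|lia].
  rewrite -F1; [apply Z0|lia].
Qed.

Lemma green_tau H z k n : resolvent_set H z -> tau (coef_a H) (coef_b H) (green H z k) n = (z * green H z k n + delta k n)%C.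
Proof. intros Hz. destruct (green_spec H z k Hz) as [_ E]. rewrite -(E n). unfold jtau. ring. Qed.

(** Left of the diagonal a column is a left solution, hence dependent on [phi]. The cross-multiplied
    form avoids dividing by values of [phi]. *)
Lemma green_minus H z k phi n : resolvent_set H z -> minus_solution H z phi -> (n < k)%Z ->
  (green H z k n * phi (n + 1)%Z)%C = (green H z k (n + 1)%Z * phi n)%C.
Proof.
  intros Hz [Hs [Hq Hb]] Hn. destruct (green_spec H z k Hz) as [D _].
  assert (W := domain_solutions_dependent_minus H z (k - 1) (green H z k) phi).
  assert (E : wronskian (coef_a H) (green H z k) phi n = 0).
  { apply W; auto; try lia.
    - intros m Hm. rewrite green_tau // delta_ne; [ring|lia].
    - intros m _; apply Hs.
    - apply D.
    - apply D. }
  unfold wronskian in E. apply Ceq_of_minus. apply (Cmult_cancel_l (RtoC (coef_a H n))).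
  - apply RtoC_neq_0. pose proof (coef_a_pos H n). lra.
  - rewrite E. ring.
Qed.

Lemma green_plus H z k chi n : resolvent_set H z -> plus_solution H z chi -> (k <= n)%Z ->
  (green H z k n * chi (n + 1)%Z)%C = (green H z k (n + 1)%Z * chi n)%C.
Proof.
  intros Hz [Hs [Hq Hb]] Hn. destruct (green_spec H z k Hz) as [D _].
  assert (W := domain_solutions_dependent H z (k + 1) (green H z k) chi).
  assert (E : wronskian (coef_a H) (green H z k) chi n = 0).
  { apply W; auto; try lia.
    - intros m Hm. rewrite green_tau // delta_ne; [ring|lia].
    - intros m _; apply Hs.
    - apply D.
    - apply D. }
  unfold wronskian in E. apply Ceq_of_minus. apply (Cmult_cancel_l (RtoC (coef_a H n))).
  - apply RtoC_neq_0. pose proof (coef_a_pos H n). lra.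
  - rewrite E. ring.
Qed.

Lemma solution_step a b z u n : solution a b z u ->
  (RtoC (a n) * u (n + 1)%Z)%C = (z * u n - RtoC (b n) * u n - RtoC (a (n - 1)%Z) * u (n - 1)%Z)%C.
Proof. intros Hu. rewrite -(Hu n). unfold tau. ring. Qed.

(** The formula [G = phi chi / W], obtained from the equation at the site [N] of the source and the
    proportionality to [phi] and [chi] on its two sides. *)
Lemma green_diagonal H z phi chi N : resolvent_set H z -> minus_solution H z phi -> plus_solution H z chi ->
  (green H z N N * wronskian (coef_a H) phi chi (N - 1))%C = (phi N * chi N)%C.
Proof.
  intros Hz Hp Hc. set (u := green H z N).
  pose proof (green_minus H z N phi (N - 1) Hz Hp ltac:(lia)) as E1. replace (N - 1 + 1)%Z with N in E1 by lia.
  pose proof (green_plus H z N chi N Hz Hc ltac:(lia)) as E2.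
  pose proof (green_tau H z N N Hz) as E3. rewrite delta_eq in E3. fold u in E1, E2, E3.
  rewrite (wronskian_const_all (coef_a H) (coef_b H) z phi chi (proj1 Hp) (proj1 Hc) (N - 1) N).
  pose proof (solution_step _ _ _ _ N (proj1 Hp)) as E4.
  unfold tau in E3. unfold wronskian.
  set (A := RtoC (coef_a H N)) in *. set (A' := RtoC (coef_a H (N - 1)%Z)) in *. set (B := RtoC (coef_b H N)) in *.
  set (u0 := u N) in *. set (u1 := u (N + 1)%Z) in *. set (um := u (N - 1)%Z) in *.
  set (p0 := phi N) in *. set (p1 := phi (N + 1)%Z) in *. set (pm := phi (N - 1)%Z) in *.
  set (c0 := chi N) in *. set (c1 := chi (N + 1)%Z) in *.
  transitivity (A * (u0 * c1) * p0 - u0 * c0 * (A * p1))%C; [ring|]. rewrite E2 E4.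
  transitivity ((A * u1 + B * u0 - z * u0) * (p0 * c0) + A' * (u0 * pm) * c0)%C; [ring|]. rewrite -E1.
  transitivity ((A * u1 + A' * um + B * u0) * (p0 * c0) - z * u0 * (p0 * c0))%C; [ring|]. rewrite E3. ring.
Qed.

(** Consecutive diagonal entries are linked through the left solution alone. This makes [N] and
    [N - 1] comparable for [H1], for which no right solution is given. *)
Lemma green_adjacent H z phi N : resolvent_set H z -> minus_solution H z phi ->
  (RtoC (coef_a H (N - 1)%Z) * (green H z N N * (phi (N - 1)%Z * phi (N - 1)%Z)
     - green H z (N - 1) (N - 1)%Z * (phi N * phi N)))%C = (phi N * phi (N - 1)%Z)%C.
Proof.
  intros Hz Hp. set (u := green H z N). set (v := green H z (N - 1)).
  pose proof (green_minus H z N phi (N - 1) Hz Hp ltac:(lia)) as E1. replace (N - 1 + 1)%Z with N in E1 by lia.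
  pose proof (green_minus H z (N - 1) phi (N - 1 - 1) Hz Hp ltac:(lia)) as E2.
  replace (N - 1 - 1 + 1)%Z with (N - 1)%Z in E2 by lia.
  pose proof (green_tau H z (N - 1) (N - 1) Hz) as E3. rewrite delta_eq in E3.
  pose proof (green_sym H z N (N - 1) Hz) as E5. fold u v in E1, E2, E3, E5.
  pose proof (solution_step _ _ _ _ (N - 1)%Z (proj1 Hp)) as E4.
  unfold tau in E3. replace (N - 1 + 1)%Z with N in E3, E4 by lia. rewrite -E5 in E3.
  set (A := RtoC (coef_a H (N - 1)%Z)) in *. set (A' := RtoC (coef_a H (N - 1 - 1)%Z)) in *. set (B := RtoC (coef_b H (N - 1)%Z)) in *.
  set (u0 := u N) in *. set (um := u (N - 1)%Z) in *. set (v0 := v (N - 1)%Z) in *. set (vm := v (N - 1 - 1)%Z) in *.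
  set (p0 := phi N) in *. set (pm := phi (N - 1)%Z) in *. set (pmm := phi (N - 1 - 1)%Z) in *.
  transitivity (A * (u0 * pm) * pm - v0 * p0 * (A * p0))%C; [ring|]. rewrite -E1 E4.
  transitivity ((A * um + B * v0 - z * v0) * (p0 * pm) + A' * (v0 * pmm) * p0)%C; [ring|]. rewrite -E2.
  transitivity ((A * um + A' * vm + B * v0) * (p0 * pm) - z * v0 * (p0 * pm))%C; [ring|]. rewrite E3. ring.
Qed.

(** Otherwise [chi] would be a multiple of [phi], and [phi] an eigenvector for a non-real
    eigenvalue. Division by [phi] is allowed because [phi] has no zeros for such [z]. *)
Lemma wronskian_nonzero H z phi chi n : (exists z0, resolvent_set H z0) -> Im z <> 0 ->
  minus_solution H z phi -> plus_solution H z chi -> (exists n, phi n <> 0) -> (exists n, chi n <> 0) ->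
  wronskian (coef_a H) phi chi n <> 0.
Proof.
  intros NE Iz Hp Hc Np [m Nc] W0.
  assert (W : forall k, wronskian (coef_a H) phi chi k = 0).
  { intros k. rewrite (wronskian_const_all _ (coef_b H) z phi chi (proj1 Hp) (proj1 Hc) k n). exact W0. }
  assert (P : forall k, phi k <> 0) by (intros; now apply (minus_solution_nonzero H z)).
  assert (R : forall k, (chi (k + 1)%Z / phi (k + 1)%Z)%C = (chi k / phi k)%C).
  { intros k. specialize (W k). unfold wronskian in W.
    assert (E : (phi k * chi (k + 1)%Z)%C = (phi (k + 1)%Z * chi k)%C).
    { apply Ceq_of_minus. apply (Cmult_cancel_l (RtoC (coef_a H k))).
      - apply RtoC_neq_0. pose proof (coef_a_pos H k). lra.
      - rewrite W. ring. }
    apply (Cmult_cancel_l (phi k * phi (k + 1)%Z)); [apply Cmult_neq_0; auto|].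
    transitivity (phi k * chi (k + 1)%Z)%C; [field; auto|]. rewrite E. field; auto. }
  set (c := (chi 0%Z / phi 0%Z)%C).
  assert (RC : forall k, chi k = (c * phi k)%C).
  { assert (X : forall j : nat, (chi (Z.of_nat j) / phi (Z.of_nat j))%C = c /\ (chi (- Z.of_nat j)%Z / phi (- Z.of_nat j)%Z)%C = c).
    { induction j as [|j [IH1 IH2]]; [split; reflexivity|]. split.
      - replace (Z.of_nat (S j)) with (Z.of_nat j + 1)%Z by lia. now rewrite R.
      - rewrite -R. replace (- Z.of_nat (S j) + 1)%Z with (- Z.of_nat j)%Z by lia. exact IH2. }
    intros k. destruct (X (Z.to_nat (Z.abs k))) as [X1 X2]. destruct (Z_le_gt_dec 0 k) as [L|L].
    - replace (Z.of_nat (Z.to_nat (Z.abs k))) with k in X1 by lia. rewrite -X1. field. auto.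
    - replace (- Z.of_nat (Z.to_nat (Z.abs k)))%Z with k in X2 by lia. rewrite -X2. field. auto. }
  assert (C0 : c <> 0) by (intros X; apply Nc; rewrite RC X; ring).
  destruct Hp as [Ps [Pq Pb]]. destruct Hc as [Cs [Cq Cb]].
  assert (Ep : forall k, phi k = (/ c * chi k)%C) by (intros k; rewrite RC; field; auto).
  assert (Lp : l2 phi).
  { split; [exact Pq|]. apply (sqsum_plus_ext (fun k => / c * chi k)%C); [intros; now rewrite -Ep|]. now apply sqsum_plus_scal. }
  assert (D : domain H phi).
  { split; [exact Lp|split; [|split]].
    - apply (l2_ext (fun k => z * phi k)%C); [intros; symmetry; apply Ps|]. now apply l2_scal.
    - exact Pb.
    - apply (bc_plus_tail H (fun k => 0 + / c * chi k)%C _ 0%Z); [intros k _; rewrite Ep; ring|].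
      apply bc_plus_lin; [|exact Cb]. now apply (bc_plus_finite H (fun _ => RtoC 0) 0%Z). }
  apply Iz. apply (eigenvector_real H z phi NE); [split; [exact D|exact Ps]|exact Np].
Qed.

(** An eigenvector satisfies both boundary conditions, so its Wronskians with [phi] and with [chi]
    vanish; [pluecker] then yields that of [phi] and [chi]. *)
Lemma wronskian_at_eigenvalue H z phi chi f n : minus_solution H z phi -> plus_solution H z chi ->
  eigenvector H z f -> (exists n, f n <> 0) -> wronskian (coef_a H) phi chi n = 0.
Proof.
  intros [Ps [Pq Pb]] [Cs [Cq Cb]] [Df Ef] Nf.
  assert (Sf : solution (coef_a H) (coef_b H) z f) by exact Ef.
  assert (W1 : wronskian (coef_a H) f phi n = 0).
  { rewrite (wronskian_const_all _ (coef_b H) z f phi Sf Ps n (-1)).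
    apply (domain_solutions_dependent_minus H z 0 f phi); auto; try apply Df; try lia; intros m _; auto. }
  assert (W2 : wronskian (coef_a H) f chi n = 0).
  { rewrite (wronskian_const_all _ (coef_b H) z f chi Sf Cs n 0).
    apply (domain_solutions_dependent H z 0 f chi); auto; try apply Df; try lia; intros m _; auto. }
  destruct (companion (coef_a H) (coef_b H) z f (coef_a_pos H) Sf Nf) as [w [d [_ [Hd Ed]]]].
  pose proof (pluecker (coef_a H) f w phi chi n) as P. rewrite W1 W2 Ed in P.
  apply (Cmult_cancel_l d); [exact Hd|]. rewrite P. ring.
Qed.

(** The equation at [N - 1] contains [u N] only through [a (N - 1) * u N]. Rescaling the value at
    [N] preserves this product, and the recursion continues from there. *)
Lemma solution_continuation a b a' b' z u N : (forall n, 0 < a' n) ->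
  (forall n, (n < N - 1)%Z -> a' n = a n) -> (forall n, (n < N)%Z -> b' n = b n) ->
  solution a b z u ->
  exists u', solution a' b' z u' /\ (forall n, (n <= N - 1)%Z -> u' n = u n) /\
    (RtoC (a' (N - 1)%Z) * u' N)%C = (RtoC (a (N - 1)%Z) * u N)%C.
Proof.
  intros Ha Ea Eb Hu.
  destruct (solution_exists a' b' Ha z (N - 1) (u (N - 1)%Z) (RtoC (a (N - 1)%Z) * u N / RtoC (a' (N - 1)%Z))%C)
    as [y [Hy [Y0 Y1]]].
  replace (N - 1 + 1)%Z with N in Y1 by lia.
  set (v := fun n => if Z_le_dec n (N - 1) then u n else y n).
  assert (V1 : forall n, (n <= N - 1)%Z -> v n = u n) by (intros n Hn; unfold v; destruct (Z_le_dec n (N - 1)); [auto|lia]).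
  assert (V2 : forall n, (N - 1 <= n)%Z -> v n = y n).
  { intros n Hn. unfold v. destruct (Z_le_dec n (N - 1)); [|auto]. assert (n = N - 1)%Z by lia. subst n. now rewrite Y0. }
  assert (EN : (RtoC (a' (N - 1)%Z) * v N)%C = (RtoC (a (N - 1)%Z) * u N)%C).
  { rewrite V2; [|lia]. rewrite Y1. field. apply RtoC_neq_0. specialize (Ha (N - 1)%Z). lra. }
  exists v. split; [|split; auto]. intros n.
  destruct (Z_lt_le_dec n (N - 1)) as [L|L].
  - rewrite V1; [|lia]. rewrite -(Hu n). unfold tau. rewrite !V1 ?Ea ?Eb //; lia.
  - destruct (Z.eq_dec n (N - 1)) as [-> | NE].
    + rewrite V1; [|lia]. rewrite -(Hu (N - 1)%Z). unfold tau.
      replace (N - 1 + 1)%Z with N by lia. rewrite EN. rewrite !V1 ?Eb ?Ea //; lia.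
    + rewrite V2; [|lia]. rewrite -(Hy n). unfold tau. rewrite !V2 //; lia.
Qed.

Lemma tau_left_ext a b a' b' f N n : (forall n, (n < N - 1)%Z -> a' n = a n) -> (forall n, (n < N)%Z -> b' n = b n) ->
  (n < N - 1)%Z -> tau a' b' f n = tau a b f n.
Proof. intros Ea Eb Hn. unfold tau. rewrite !Ea ?Eb //; lia. Qed.

Lemma minus_solution_continuation H K z phi N :
  (forall n, (n < N - 1)%Z -> coef_a K n = coef_a H n) -> (forall n, (n < N)%Z -> coef_b K n = coef_b H n) ->
  same_bc_minus H K -> minus_solution H z phi ->
  exists psi, minus_solution K z psi /\ (forall n, (n <= N - 1)%Z -> psi n = phi n) /\
    (RtoC (coef_a K (N - 1)%Z) * psi N)%C = (RtoC (coef_a H (N - 1)%Z) * phi N)%C.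
Proof.
  intros Ea Eb Hbc [Ps [Pq Pb]].
  destruct (solution_continuation _ _ _ _ z phi N (coef_a_pos K) Ea Eb Ps) as [psi [Hs [E1 E2]]].
  exists psi. split; [|auto]. split; [exact Hs|]. split.
  - apply (sqsum_minus_tail phi psi (N - 1)); [intros; symmetry; auto|exact Pq].
  - apply bc_minus_iff. intros LK.
    (* Every solution for [H] continues to one for [K] with the same left tail, so the limit circle
       case passes from [K] to [H]. *)
    assert (LH : limit_circle_minus (coef_a H) (coef_b H)).
    { destruct LK as [w Hw]. exists w. intros u Hu.
      destruct (solution_continuation _ _ _ _ w u N (coef_a_pos K) Ea Eb Hu) as [v [Hv [V _]]].
      apply (sqsum_minus_tail v u (N - 1)); [exact V|now apply Hw]. }
    assert (S1 : sqsum_minus (jtau H phi)).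
    { apply (sqsum_minus_tail (fun n => z * phi n)%C _ 0%Z); [intros n _; symmetry; apply Ps|].
      rewrite sqsum_minus_refl in Pq. rewrite sqsum_minus_refl. exact (sqsum_plus_scal z _ Pq). }
    assert (S2 : sqsum_minus (jtau K phi)).
    { apply (sqsum_minus_tail (jtau H phi) _ (N - 2)%Z); [|exact S1]. intros n Hn. symmetry.
      apply (tau_left_ext _ _ _ _ _ N); auto. lia. }
    assert (BK : bc_minus K psi).
    { apply (bc_minus_tail K phi psi (N - 1)); [intros; symmetry; auto|]. now apply (Hbc LH LK). }
    rewrite bc_minus_iff in BK. auto.
Qed.

Lemma const_zero_of_decay (c : C) (K : R) : (forall z, Im z <> 0 -> 1 <= Cmod z -> Cmod c <= K / Rabs (Im z)) -> c = 0.
Proof.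
  intros H. apply Cmod_eq_0. apply Rle_antisym; [|apply Cmod_ge_0].
  apply (Rle_of_eps _ K 1 ltac:(lra)). intros e He.
  assert (P : 1 < / e) by (rewrite -Rinv_1; apply Rinv_lt_contravar; lra).
  specialize (H (0, / e)). simpl in H. rewrite (Rabs_pos_eq (/ e)) in H; [|lra].
  replace (K / / e) with (K * e) in H by (field; lra). apply H; [lra|].
  pose proof (snd_le_Cmod (0, / e)) as Q. simpl in Q. rewrite (Rabs_pos_eq (/ e)) in Q; lra.
Qed.

(** * Recovering the coefficients to the right *)

Section Recover.
Variables (H0 H1 : jacobi) (phi0 phi1 : C -> Z -> C).
Hypothesis (NR0 : forall z, Im z <> 0 -> resolvent_set H0 z).
Hypothesis (NR1 : forall z, Im z <> 0 -> resolvent_set H1 z).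
Hypothesis (P0 : forall z, Im z <> 0 -> minus_solution H0 z (phi0 z)).
Hypothesis (P1 : forall z, Im z <> 0 -> minus_solution H1 z (phi1 z)).
Hypothesis (NT : forall z, Im z <> 0 -> exists n, phi0 z n <> 0).

Lemma phi0_nonzero z n : Im z <> 0 -> phi0 z n <> 0.
Proof. intros Iz. apply (minus_solution_nonzero H0 z); auto. exists z; auto. Qed.

(** The induction hypothesis. [a (N - 1)] and [b N] are still unknown, so Green's functions at [N]
    can be compared only after multiplication by [a (N - 1)^2]. *)
Definition agree (N : Z) : Prop :=
  (forall n, (n < N - 1)%Z -> coef_a H1 n = coef_a H0 n) /\
  (forall n, (n < N)%Z -> coef_b H1 n = coef_b H0 n) /\
  (forall z n, Im z <> 0 -> (n <= N - 1)%Z -> phi1 z n = phi0 z n) /\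
  (forall z, Im z <> 0 -> (RtoC (coef_a H1 (N - 1)%Z) * RtoC (coef_a H1 (N - 1)%Z) * green H1 z N N)%C =
     (RtoC (coef_a H0 (N - 1)%Z) * RtoC (coef_a H0 (N - 1)%Z) * green H0 z N N)%C).

(* The leading asymptotics of Green's function as [z] tends to infinity along the
   imaginary axis give [a (N - 1)] and [b N]. *)
Lemma agree_step N : agree N -> coef_a H1 (N - 1)%Z = coef_a H0 (N - 1)%Z /\
  (forall z, Im z <> 0 -> green H1 z N N = green H0 z N N) /\
  (forall z, Im z <> 0 -> (RtoC (coef_a H1 N) * green H1 z N (N + 1)%Z)%C = (RtoC (coef_a H0 N) * green H0 z N (N + 1)%Z)%C) /\
  agree (N + 1).
Proof.
  intros [Ea [Eb [Ep Eg]]].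
  destruct (green_asymptotic H0 N NR0) as [K0 A0]. destruct (green_asymptotic H1 N NR1) as [K1 A1].
  set (a0 := coef_a H0 (N - 1)%Z) in *. set (a1 := coef_a H1 (N - 1)%Z) in *.
  assert (Pa0 : 0 < a0) by apply coef_a_pos. assert (Pa1 : 0 < a1) by apply coef_a_pos.
  (* Multiplied by [z], the identity in [agree] tends to [a1^2 = a0^2]. *)
  assert (Q : RtoC (a1 * a1 - a0 * a0) = 0).
  { apply (const_zero_of_decay _ (a1 * a1 * K1 + a0 * a0 * K0)). intros z Iz _.
    specialize (A0 z N Iz). specialize (A1 z N Iz). specialize (Eg z Iz). rewrite delta_eq in A0. rewrite delta_eq in A1.
    replace (RtoC (a1 * a1 - a0 * a0)) with (RtoC (a1 * a1) * (z * green H1 z N N + 1) - RtoC (a0 * a0) * (z * green H0 z N N + 1))%C.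
    - unfold Cminus. eapply Rle_trans; [apply Cmod_triangle|]. rewrite Cmod_opp !Cmod_mult !Cmod_R (Rabs_pos_eq (a1 * a1)); [|nra]. rewrite ?(Rabs_pos_eq (a0 * a0)); [|nra].
      assert (a1 * a1 * Cmod (z * green H1 z N N + 1) <= a1 * a1 * (K1 / Rabs (Im z))) by (apply Rmult_le_compat_l; nra).
      assert (a0 * a0 * Cmod (z * green H0 z N N + 1) <= a0 * a0 * (K0 / Rabs (Im z))) by (apply Rmult_le_compat_l; nra).
      unfold Rdiv in *. lra.
    - rewrite RtoC_minus !RtoC_mult.
      transitivity (z * (a1 * a1 * green H1 z N N) + a1 * a1 - (z * (a0 * a0 * green H0 z N N) + a0 * a0))%C; [ring|].
      rewrite Eg. ring. }
  apply RtoC_inj in Q. assert (E1 : a1 = a0) by (apply Rsqr_inj; unfold Rsqr; lra).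
  assert (E2 : forall z, Im z <> 0 -> green H1 z N N = green H0 z N N).
  { intros z Iz. specialize (Eg z Iz). rewrite E1 in Eg. apply (Cmult_cancel_l (a0 * a0)); [|exact Eg].
    apply Cmult_neq_0; apply RtoC_neq_0; lra. }
  assert (Ep' : forall z n, Im z <> 0 -> (n <= N)%Z -> phi1 z n = phi0 z n).
  { intros z n Iz Hn. destruct (Z.eq_dec n N) as [-> | NE]; [|apply Ep; [auto|lia]].
    pose proof (solution_step _ _ _ _ (N - 1)%Z (proj1 (P0 z Iz))) as S0.
    pose proof (solution_step _ _ _ _ (N - 1)%Z (proj1 (P1 z Iz))) as S1.
    replace (N - 1 + 1)%Z with N in S0, S1 by lia. rewrite (Ep z (N - 1)%Z) ?(Ep z (N - 1 - 1)%Z) // in S1; try lia.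
    rewrite (Ea (N - 1 - 1)%Z) in S1; [|lia]. rewrite (Eb (N - 1)%Z) in S1; [|lia]. rewrite -S0 in S1. fold a0 a1 in S0, S1. rewrite E1 in S1.
    apply (Cmult_cancel_l a0); [apply RtoC_neq_0; lra|exact S1]. }
  assert (E3 : forall z, Im z <> 0 -> green H1 z N (N - 1) = green H0 z N (N - 1)).
  { intros z Iz.
    pose proof (green_minus H0 z N (phi0 z) (N - 1) (NR0 z Iz) (P0 z Iz) ltac:(lia)) as G0.
    pose proof (green_minus H1 z N (phi1 z) (N - 1) (NR1 z Iz) (P1 z Iz) ltac:(lia)) as G1.
    replace (N - 1 + 1)%Z with N in G0, G1 by lia. rewrite !Ep' // in G1; try lia.
    rewrite E2 // -G0 in G1. apply (Cmult_cancel_l (phi0 z N)); [now apply phi0_nonzero|].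
    rewrite !(Cmult_comm (phi0 z N)). exact G1. }
  set (b0 := coef_b H0 N). set (b1 := coef_b H1 N).
  set (c0 := coef_a H0 N). set (c1 := coef_a H1 N).
  assert (Pc0 : 0 < c0) by apply coef_a_pos. assert (Pc1 : 0 < c1) by apply coef_a_pos.
  (* The difference of the equations at [N] for the two columns. Off-diagonal entries tend to 0 even
     after multiplication by [z], which isolates [b1 - b0]. *)
  assert (D : forall z, Im z <> 0 -> (c1 * green H1 z N (N + 1)%Z - c0 * green H0 z N (N + 1)%Z + (b1 - b0) * green H0 z N N)%C = 0).
  { intros z Iz. pose proof (green_tau H0 z N N (NR0 z Iz)) as T0. pose proof (green_tau H1 z N N (NR1 z Iz)) as T1.
    unfold tau in T0, T1. rewrite E2 // E3 // in T1. fold a0 a1 b0 b1 c0 c1 in T0, T1. rewrite E1 in T1. rewrite -T0 in T1.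
    match type of T1 with ?x = ?y => transitivity (x - y)%C; [ring|rewrite T1; ring] end. }
  assert (Q2 : RtoC (b1 - b0) = 0).
  { apply (const_zero_of_decay _ (c1 * K1 + c0 * K0 + Rabs (b1 - b0) * K0)). intros z Iz _.
    pose proof (A0 z N Iz) as B0. pose proof (A0 z (N + 1)%Z Iz) as B1. pose proof (A1 z (N + 1)%Z Iz) as B2.
    rewrite delta_eq in B0. rewrite delta_ne in B1; [|lia]. rewrite delta_ne in B2; [|lia]. specialize (D z Iz).
    replace (RtoC (b1 - b0)) with (RtoC (b1 - b0) * (z * green H0 z N N + 1)
       + (c1 * (z * green H1 z N (N + 1)%Z + 0) + - (c0 * (z * green H0 z N (N + 1)%Z + 0))))%C.
    - eapply Rle_trans; [apply Cmod_triangle|].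
      pose proof (Cmod_triangle (c1 * (z * green H1 z N (N + 1)%Z + 0)) (- (c0 * (z * green H0 z N (N + 1)%Z + 0)))) as TT.
      rewrite Cmod_opp (Cmod_mult c1) (Cmod_mult c0) !Cmod_R (Rabs_pos_eq c0) ?(Rabs_pos_eq c1) in TT; try lra.
      rewrite Cmod_mult Cmod_R.
      assert (c1 * Cmod (z * green H1 z N (N + 1)%Z + 0) <= c1 * (K1 / Rabs (Im z))) by (apply Rmult_le_compat_l; lra).
      assert (c0 * Cmod (z * green H0 z N (N + 1)%Z + 0) <= c0 * (K0 / Rabs (Im z))) by (apply Rmult_le_compat_l; lra).
      assert (Rabs (b1 - b0) * Cmod (z * green H0 z N N + 1) <= Rabs (b1 - b0) * (K0 / Rabs (Im z)))
        by (apply Rmult_le_compat_l; [apply Rabs_pos|lra]).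
      unfold Rdiv in *. lra.
    - rewrite RtoC_minus.
      transitivity (z * (c1 * green H1 z N (N + 1)%Z - c0 * green H0 z N (N + 1)%Z + (b1 - b0) * green H0 z N N) + (b1 - b0))%C; [ring|].
      rewrite D. ring. }
  apply RtoC_inj in Q2. assert (E4 : b1 = b0) by lra.
  assert (E5 : forall z, Im z <> 0 -> (c1 * green H1 z N (N + 1)%Z)%C = (c0 * green H0 z N (N + 1)%Z)%C).
  { intros z Iz. specialize (D z Iz). rewrite E4 in D. apply Ceq_of_minus. rewrite -D. ring. }
  split; [exact E1|split; [exact E2|split; [exact E5|]]].
  unfold agree. replace (N + 1 - 1)%Z with N by lia.
  split; [|split; [|split]].
  - intros n Hn. destruct (Z.eq_dec n (N - 1)) as [-> | NE]; [exact E1|apply Ea; lia].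
  - intros n Hn. destruct (Z.eq_dec n N) as [-> | NE]; [exact E4|apply Eb; lia].
  - intros z n Iz Hn. auto.
  (* By [green_minus] and symmetry, [c^2 G(N + 1, N + 1) phi N] is the product of [c G(N, N + 1)]
     and [c phi (N + 1)], and both factors are already known to agree. *)
  - intros z Iz. fold c0 c1.
    pose proof (green_minus H0 z (N + 1) (phi0 z) N (NR0 z Iz) (P0 z Iz) ltac:(lia)) as G0.
    pose proof (green_minus H1 z (N + 1) (phi1 z) N (NR1 z Iz) (P1 z Iz) ltac:(lia)) as G1.
    rewrite (green_sym H0 z (N + 1) N (NR0 z Iz)) in G0. rewrite (green_sym H1 z (N + 1) N (NR1 z Iz)) in G1.
    rewrite (Ep' z N Iz) in G1; [|lia].
    pose proof (solution_step _ _ _ _ N (proj1 (P0 z Iz))) as S0. pose proof (solution_step _ _ _ _ N (proj1 (P1 z Iz))) as S1.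
    rewrite (Ep' z N) ?(Ep' z (N - 1)%Z) // in S1; try lia. fold a0 b0 c0 in S0. fold a1 b1 c1 in S1. rewrite E1 E4 -S0 in S1.
    apply (Cmult_cancel_l (phi0 z N)); [now apply phi0_nonzero|].
    transitivity (c1 * c1 * (green H1 z (N + 1) (N + 1) * phi0 z N))%C; [ring|]. rewrite -G1.
    transitivity ((c1 * green H1 z N (N + 1)%Z) * (c1 * phi1 z (N + 1)%Z))%C; [ring|]. rewrite E5 // S1.
    transitivity (c0 * c0 * (green H0 z (N + 1) (N + 1) * phi0 z N))%C; [rewrite -G0; ring|ring].
Qed.

Lemma agree_all N : agree N -> (forall n, coef_a H1 n = coef_a H0 n) /\ (forall n, coef_b H1 n = coef_b H0 n).
Proof.
  intros HA. assert (K : forall k : nat, agree (N + Z.of_nat k)).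
  { induction k as [|k IH]; [now rewrite Z.add_0_r|].
    replace (N + Z.of_nat (S k))%Z with (N + Z.of_nat k + 1)%Z by lia. now apply agree_step. }
  split; intros n; destruct (K (Z.to_nat (Z.abs N + Z.abs n + 2))) as [A [B _]]; [apply A|apply B]; lia.
Qed.

(** Once the coefficients coincide, the condition at [+oo] remains. The columns of the two
    resolvents agree from [N] on, so this common tail satisfies both conditions and
    [bc_plus_transfer] applies in either direction. *)
Lemma agree_same_operator N : agree N -> same_bc_minus H0 H1 -> same_operator H1 H0.
Proof.
  intros HA Hbc. destruct (agree_all N HA) as [Ea' Eb'].
  assert (Ea : coef_a H1 = coef_a H0) by (extensionality n; auto).
  assert (Eb : coef_b H1 = coef_b H0) by (extensionality n; auto).
  assert (Et : jtau H1 = jtau H0) by (unfold jtau; now rewrite Ea Eb).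
  destruct (agree_step N HA) as [_ [E2 [E5 _]]].
  destruct (green_asymptotic H0 N NR0) as [K0 A0].
  (* At a height above [K0] the asymptotics force [G(N, N)] to be nonzero, so the tail is
     nontrivial. *)
  set (z := (0, 2 * (Rabs K0 + 1)) : C). pose proof (Rabs_pos K0) as KP. pose proof (Rle_abs K0).
  assert (Iz : Im z <> 0) by (simpl; lra).
  set (u0 := green H0 z N). set (u1 := green H1 z N).
  destruct (green_spec H0 z N (NR0 z Iz)) as [D0 _]. destruct (green_spec H1 z N (NR1 z Iz)) as [D1 _].
  fold u0 in D0. fold u1 in D1.
  assert (U : u0 N <> 0).
  { intros X. specialize (A0 z N Iz). fold u0 in A0. rewrite delta_eq X in A0.
    replace (z * 0 + 1)%C with (RtoC 1) in A0 by ring. rewrite Cmod_1 in A0. simpl in A0.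
    rewrite (Rabs_pos_eq (2 * (Rabs K0 + 1))) in A0; [|lra].
    apply (Rmult_le_compat_r (2 * (Rabs K0 + 1))) in A0; [|lra].
    unfold Rdiv in A0. rewrite Rmult_assoc Rinv_l in A0; lra. }
  assert (S0 : solves_from (coef_a H0) (coef_b H0) z (N + 1) u0).
  { intros n Hn. unfold u0. rewrite green_tau; auto. rewrite delta_ne; [ring|lia]. }
  assert (S1 : solves_from (coef_a H0) (coef_b H0) z (N + 1) u1).
  { rewrite -Ea -Eb. intros n Hn. unfold u1. rewrite green_tau; auto. rewrite delta_ne; [ring|lia]. }
  assert (EU : forall n, (N <= n)%Z -> u1 n = u0 n).
  { intros n Hn. apply (solution_unique_up _ _ (coef_a_pos H0) z (N + 1) u1 u0 S1 S0); [| |lia].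
    - replace (N + 1 - 1)%Z with N by lia. now apply E2.
    - apply (Cmult_cancel_l (coef_a H0 N)); [apply RtoC_neq_0; pose proof (coef_a_pos H0 N); lra|].
      rewrite -{1}Ea'. now apply E5. }
  assert (U1 : bc_plus H0 u1) by (apply (bc_plus_tail H0 u0 u1 N); [intros; symmetry; auto|apply D0]).
  assert (V : exists n, (N + 1 - 1 <= n)%Z /\ u1 n <> 0) by (exists N; split; [lia|rewrite EU //; lia]).
  (* [u1] solves the equation only from [N + 1] on, so a nonzero value is needed there; two
     consecutive zeros would propagate back to [N]. *)
  assert (V' : exists n, (N + 1 <= n)%Z /\ u1 n <> 0).
  { destruct (classic (u1 (N + 1)%Z = 0)) as [Z1|Z1]; [|exists (N + 1)%Z; split; [lia|auto]].
    exists (N + 2)%Z. split; [lia|]. intros Z2. apply U. rewrite -EU; [|lia].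
    pose proof (S1 (N + 1)%Z ltac:(lia)) as T. unfold tau in T. replace (N + 1 + 1)%Z with (N + 2)%Z in T by lia.
    replace (N + 1 - 1)%Z with N in T by lia. rewrite Z1 Z2 in T.
    apply (Cmult_cancel_l (coef_a H0 N)); [apply RtoC_neq_0; pose proof (coef_a_pos H0 N); lra|].
    transitivity (coef_a H0 N * u1 N + coef_a H0 (N + 1)%Z * 0 + coef_b H0 (N + 1)%Z * 0)%C; [ring|].
    transitivity (coef_a H0 (N + 1)%Z * 0 + coef_a H0 N * u1 N + coef_b H0 (N + 1)%Z * 0)%C; [ring|]. rewrite T. ring. }
  assert (BP : forall f, sqsum_plus f -> sqsum_plus (jtau H0 f) -> (bc_plus H1 f <-> bc_plus H0 f)).
  { intros f F1 F2. split; intros B.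
    - apply (bc_plus_transfer H1 H0 u1 z (N + 1) f); auto; try apply D1; try (rewrite Ea Eb; exact S1). now rewrite Et.
    - apply (bc_plus_transfer H0 H1 u1 z (N + 1) f); auto; apply D1. }
  assert (BM : forall f, sqsum_minus f -> sqsum_minus (jtau H0 f) -> (bc_minus H1 f <-> bc_minus H0 f)).
  { intros f F1 F2. assert (X : limit_circle_minus (coef_a H0) (coef_b H0) -> (bc_minus H0 f <-> bc_minus H1 f)).
    { intros L. apply Hbc; auto; [now rewrite Ea Eb|now rewrite Et]. }
    rewrite !bc_minus_iff in X |- *. rewrite Ea Eb in X |- *. tauto. }
  split.
  - intros f. unfold domain. rewrite Et. split; intros [A [B [Cm Cp]]]; (split; [exact A|split; [exact B|split]]).
    + apply BM; auto; [apply A|apply B].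
    + apply BP; auto; [apply A|apply B].
    + apply BM; auto; [apply A|apply B].
    + apply BP; auto; [apply A|apply B].
  - intros f _ n. now rewrite Et.
Qed.

End Recover.

(** * Isospectral operators *)

Lemma Ccont_eq_off_real f g z : (forall w, Ccont f w) -> (forall w, Ccont g w) ->
  (forall w, Im w <> 0 -> f w = g w) -> f z = g z.
Proof.
  intros Hf Hg E. apply Ceq_of_minus. apply NNPP; intros N.
  destruct (Ccont_near_ne (fun w => f w - g w)%C z 0 (Ccont_minus _ _ _ (Hf z) (Hg z)) N) as [d [Hd K]].
  (* Of the two vertical displacements at most one can end on the real axis. *)
  set (t := if Req_EM_T (Im z + d / 2) 0 then d / 4 else d / 2).
  assert (T : 0 < t < d /\ Im z + t <> 0) by (unfold t; destruct (Req_EM_T _ _); lra).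
  assert (B : Cmod (z + (0, t) - z) < d).
  { replace (z + (0, t) - z)%C with ((0, t) : C)
      by (destruct z; unfold Cminus, Cplus, Copp; simpl; f_equal; ring). apply (Rle_lt_trans _ _ _ (Cmod_le_abs _)). simpl.
    rewrite Rabs_R0 Rabs_pos_eq; lra. }
  apply (K _ B). rewrite E; [ring|]. unfold Im in *. simpl. lra.
Qed.

Lemma expbound_solution_succ s a b phi n : 0 < s -> (forall n, 0 < a n) -> (forall z, solution a b z (phi z)) ->
  expbound s (fun z => phi z (n - 1)%Z) -> expbound s (fun z => phi z n) -> expbound s (fun z => phi z (n + 1)%Z).
Proof.
  intros Hs Ha Hp E1 E2.
  apply (expbound_ext s (fun z => (z * phi z n - b n * phi z n - a (n - 1)%Z * phi z (n - 1)%Z) * / a n)%C).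
  - intros z. rewrite -(solution_step a b z (phi z) n (Hp z)). field. apply RtoC_neq_0. specialize (Ha n). lra.
  - apply expbound_mult; [|now apply expbound_const].
    apply expbound_minus; auto; [apply expbound_minus; auto|]; apply expbound_mult; auto using expbound_const, expbound_id.
Qed.

Lemma expbound_solution_pred s a b phi n : 0 < s -> (forall n, 0 < a n) -> (forall z, solution a b z (phi z)) ->
  expbound s (fun z => phi z n) -> expbound s (fun z => phi z (n + 1)%Z) -> expbound s (fun z => phi z (n - 1)%Z).
Proof.
  intros Hs Ha Hp E1 E2.
  apply (expbound_ext s (fun z => (z * phi z n - b n * phi z n - a n * phi z (n + 1)%Z) * / a (n - 1)%Z)%C).
  - intros z. rewrite (solution_step a b z (phi z) n (Hp z)). field. apply RtoC_neq_0. specialize (Ha (n - 1)%Z). lra.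
  - apply expbound_mult; [|now apply expbound_const].
    apply expbound_minus; auto; [apply expbound_minus; auto|]; apply expbound_mult; auto using expbound_const, expbound_id.
Qed.

Lemma expbound_solution H s phi : 0 < s -> real_entire_solution H phi -> solution_order_at_most phi s ->
  forall n, expbound s (fun z => phi z n).
Proof.
  intros Hs [Hp He] [m [G1 G2]].
  assert (Hh : forall n z, holo (fun z => phi z n) z) by (intros n; apply entire_holo, (He n)).
  assert (E1 := growth_order_expbound _ s Hs (Hh m) G1). assert (E2 := growth_order_expbound _ s Hs (Hh (m + 1)%Z) G2).
  assert (K : forall k : nat, (expbound s (fun z => phi z (m + Z.of_nat k)%Z) /\ expbound s (fun z => phi z (m + Z.of_nat k + 1)%Z))
     /\ (expbound s (fun z => phi z (m - Z.of_nat k)%Z) /\ expbound s (fun z => phi z (m - Z.of_nat k + 1)%Z))).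
  { induction k as [|k [[A1 A2] [B1 B2]]].
    - rewrite Z.add_0_r Z.sub_0_r. auto.
    - replace (m + Z.of_nat (S k))%Z with (m + Z.of_nat k + 1)%Z by lia.
      replace (m - Z.of_nat (S k))%Z with (m - Z.of_nat k - 1)%Z by lia.
      split; split; auto.
      + apply (expbound_solution_succ s (coef_a H) (coef_b H)); auto; [apply coef_a_pos|].
        replace (m + Z.of_nat k + 1 - 1)%Z with (m + Z.of_nat k)%Z by lia. exact A1.
      + apply (expbound_solution_pred s (coef_a H) (coef_b H)); auto. apply coef_a_pos.
      + replace (m - Z.of_nat k - 1 + 1)%Z with (m - Z.of_nat k)%Z by lia. exact B1. }
  intros n. destruct (Z_le_gt_dec m n) as [L|L].
  - replace n with (m + Z.of_nat (Z.to_nat (n - m)))%Z by lia. apply K.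
  - replace n with (m - Z.of_nat (Z.to_nat (m - n)))%Z by lia. apply K.
Qed.

(* [W] vanishes at the poles of Green's function. *)
Lemma green_times_entire H0 H1 n W : purely_discrete_spectrum H0 ->
  (forall z, spectrum H1 z <-> spectrum H0 z) -> (forall z, holo W z) ->
  (forall z, spectrum H0 z -> W z = 0) ->
  exists E, (forall z, holo E z) /\ forall z, Im z <> 0 -> E z = (green H1 z n n * W z)%C.
Proof.
  intros PD Hsp HW W0.
  assert (R10 : forall z, resolvent_set H1 z <-> resolvent_set H0 z).
  { intros z. specialize (Hsp z). unfold spectrum in Hsp. split; intros X; apply NNPP; tauto. }
  assert (NR : forall z, Im z <> 0 -> resolvent_set H1 z) by (intros z Iz; now apply R10, discrete_nonreal_resolvent).
  assert (OP : forall z, resolvent_set H1 z -> near z (resolvent_set H1)).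
  { intros z Hz. eapply near_imp; [|exact (discrete_resolvent_open H0 z PD (proj1 (R10 z) Hz))]. intros w; apply R10. }
  assert (GH : forall z, resolvent_set H1 z -> holo (fun z => green H1 z n n) z) by (intros z Hz; apply green_holo; auto).
  destruct (holo_glue (fun z => green H1 z n n * W z)%C) as [E [HE [_ EE]]].
  - intros a. destruct (classic (resolvent_set H1 a)) as [Ra|Sa].
    + exists (fun z => green H1 z n n * W z)%C. split.
      * eapply near_imp; [|exact (OP a Ra)]. cbv beta; intros w Rw. apply holo_mult; auto.
      * apply near_all; auto.
    + assert (Sa0 : spectrum H0 a) by (intros X; apply Sa, R10, X).
      assert (Ra : a = RtoC (Re a)).
      { destruct (Req_dec (Im a) 0) as [E0|E0]; [destruct a as [x y]; unfold RtoC; simpl in *; now rewrite E0|].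
        exfalso. apply Sa, NR, E0. }
      assert (PN : near a (fun w => w <> a -> resolvent_set H1 w)).
      { destruct (proj1 (PD a Sa0)) as [_ [eps [He K]]]. exists eps. split; [exact He|]. intros w Hw Nw.
        apply R10. apply NNPP; intros X. specialize (K w X Nw). lra. }
      destruct (simple_pole (fun z => green H1 z n n) (Re a) 1 ltac:(lra)) as [P [HP EP]].
      * rewrite -Ra. eapply near_imp; [|exact PN]. cbv beta; intros w Hw Nw. auto.
      * intros w Iw. apply green_bound; auto.
      * destruct (holo_factor_near W a (near_all _ _ HW) (W0 a Sa0)) as [V [HV EV]]. rewrite -Ra in HP, EP.
        exists (fun z => P z * V z)%C. split.
        -- eapply near_imp; [|exact (near_and _ _ _ HP HV)]. cbv beta; intros w [A B]. now apply holo_mult.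
        -- eapply near_imp; [|exact (near_and _ _ _ EP EV)]. cbv beta; intros w [A B] N. rewrite A // B. ring.
  (* At points of the spectrum [green] is arbitrary, so [E] is identified with the product only off
     the real axis. *)
  - exists E. split; [exact HE|]. intros z Iz. apply EE. apply holo_cont, holo_mult; auto.
Qed.

(* [p1 / q1 ^ 2 = p2 / q2 ^ 2] where both are defined, so the common value is entire. *)
Lemma entire_common_quotient p1 q1 p2 q2 :
  (forall z, holo p1 z) -> (forall z, holo q1 z) -> (forall z, holo p2 z) -> (forall z, holo q2 z) ->
  (forall z, q1 z <> 0 \/ q2 z <> 0) ->
  (forall z, Im z <> 0 -> (p1 z * (q2 z * q2 z))%C = (p2 z * (q1 z * q1 z))%C) ->
  exists F, (forall z, holo F z) /\ forall z, (q1 z * q1 z * F z)%C = p1 z.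
Proof.
  intros Hp1 Hq1 Hp2 Hq2 NZ Eoff.
  assert (E : forall z, (p1 z * (q2 z * q2 z))%C = (p2 z * (q1 z * q1 z))%C).
  { intros z. apply (Ccont_eq_off_real (fun z => p1 z * (q2 z * q2 z))%C (fun z => p2 z * (q1 z * q1 z))%C); auto;
    intros w; apply holo_cont; repeat apply holo_mult; auto. }
  set (F := fun z => match excluded_middle_informative (q1 z = 0) with
     left _ => (p2 z / (q2 z * q2 z))%C | right _ => (p1 z / (q1 z * q1 z))%C end).
  assert (F1 : forall z, q1 z <> 0 -> F z = (p1 z / (q1 z * q1 z))%C).
  { intros z Hz. unfold F. destruct (excluded_middle_informative (q1 z = 0)); tauto. }
  assert (F2 : forall z, q2 z <> 0 -> F z = (p2 z / (q2 z * q2 z))%C).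
  { intros z Hz. unfold F. destruct (excluded_middle_informative (q1 z = 0)) as [_|N]; [reflexivity|].
    apply (Cmult_cancel_l (q1 z * q1 z * (q2 z * q2 z))); [repeat apply Cmult_neq_0; auto|].
    transitivity (p1 z * (q2 z * q2 z))%C; [field; auto|]. rewrite E. field; auto. }
  exists F. split.
  - intros z. destruct (NZ z) as [N|N].
    + apply (holo_ext (fun w => p1 w / (q1 w * q1 w))%C).
      * eapply near_imp; [|exact (Ccont_near_ne q1 z 0 (holo_cont _ _ (Hq1 z)) N)]. cbv beta; intros w Nw. now rewrite F1.
      * apply holo_div; [auto|now apply holo_mult|now apply Cmult_neq_0].
    + apply (holo_ext (fun w => p2 w / (q2 w * q2 w))%C).
      * eapply near_imp; [|exact (Ccont_near_ne q2 z 0 (holo_cont _ _ (Hq2 z)) N)]. cbv beta; intros w Nw. now rewrite F2.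
      * apply holo_div; [auto|now apply holo_mult|now apply Cmult_neq_0].
  - intros z. destruct (classic (q1 z = 0)) as [Z0|N].
    + destruct (NZ z) as [N|N]; [contradiction|]. specialize (E z). rewrite Z0 in E |- *.
      apply (Cmult_cancel_l (q2 z * q2 z)); [now apply Cmult_neq_0|]. 
      transitivity (p2 z * (0 * 0))%C; [ring|]. rewrite -E. ring.
    + rewrite F1 //. field; auto.
Qed.

Lemma ray_point_Im th r : Im (ray_point th r) = r * sin th.
Proof. unfold ray_point, Im; simpl. ring. Qed.

(* [z G] tends to [-1] along a non-real ray, hence quotients of diagonal Green's
   functions stay bounded. *)
Lemma green_quotient_bounded H0 H1 n th : (forall z, Im z <> 0 -> resolvent_set H0 z) ->
  (forall z, Im z <> 0 -> resolvent_set H1 z) -> sin th <> 0 ->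
  exists R0, 0 <= R0 /\ forall r, R0 < r -> let z := ray_point th r in
    green H0 z n n <> 0 /\ Cmod (green H1 z n n / green H0 z n n) <= 3.
Proof.
  intros NR0 NR1 Hs.
  destruct (green_asymptotic H0 n NR0) as [K0 A0]. destruct (green_asymptotic H1 n NR1) as [K1 A1].
  set (K := Rabs K0 + Rabs K1 + 1). pose proof (Rabs_pos K0). pose proof (Rabs_pos K1).
  pose proof (Rle_abs K0). pose proof (Rle_abs K1). assert (Sp : 0 < Rabs (sin th)) by now apply Rabs_pos_lt.
  exists (2 * K / Rabs (sin th)). split; [apply Rdiv_le_0_compat; unfold K; lra|]. intros r Hr z.
  assert (Hr' : 2 * K < r * Rabs (sin th)).
  { apply (Rmult_lt_compat_r (Rabs (sin th))) in Hr; [|exact Sp].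
    replace (2 * K / Rabs (sin th) * Rabs (sin th)) with (2 * K) in Hr by (field; lra). exact Hr. }
  assert (Rp : 0 < r) by (unfold K in Hr'; nra).
  assert (Iz : Im z <> 0) by (unfold z; rewrite ray_point_Im; apply Rmult_integral_contrapositive; lra).
  assert (EI : Rabs (Im z) = r * Rabs (sin th)) by (unfold z; rewrite ray_point_Im Rabs_mult (Rabs_pos_eq r); lra).
  assert (BK : forall k, k <= K -> 0 <= K -> k / Rabs (Im z) <= 1 / 2).
  { intros k Hk HK. rewrite EI. apply (Rmult_le_reg_r (r * Rabs (sin th))); [unfold K in Hr'; lra|].
    unfold Rdiv. rewrite Rmult_assoc Rinv_l; unfold K in *; lra. }
  specialize (A0 z n Iz). specialize (A1 z n Iz). rewrite delta_eq in A0. rewrite delta_eq in A1.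
  pose proof (BK K0 ltac:(unfold K; lra) ltac:(unfold K; lra)) as B0.
  pose proof (BK K1 ltac:(unfold K; lra) ltac:(unfold K; lra)) as B1.
  set (g0 := green H0 z n n) in *. set (g1 := green H1 z n n) in *.
  (* Both [z g0] and [z g1] are within 1/2 of [-1], so the quotient is at most
     [(3 / 2) / (1 / 2) = 3]. *)
  assert (L0 : 1 / 2 <= Cmod (z * g0)).
  { pose proof (Cmod_triangle (z * g0 + 1) (- (z * g0))) as T. replace (z * g0 + 1 + - (z * g0))%C with (RtoC 1) in T by ring.
    rewrite Cmod_1 Cmod_opp in T. lra. }
  assert (L1 : Cmod (z * g1) <= 3 / 2).
  { pose proof (Cmod_triangle (z * g1 + 1) (- (1))) as T. replace (z * g1 + 1 + - (1))%C with (z * g1)%C in T by ring.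
    rewrite Cmod_opp Cmod_1 in T. lra. }
  assert (N0 : (z * g0 <> 0)%C) by (apply (Cmod_pos_ne _ (1 / 2)); lra).
  assert (Ng : g0 <> 0) by (intros X; apply N0; rewrite X; ring).
  assert (Nz : z <> 0) by (intros X; apply N0; rewrite X; ring).
  split; [exact Ng|]. replace (g1 / g0)%C with (z * g1 / (z * g0))%C by (field; auto).
  rewrite Cmod_div //. apply (Rmult_le_reg_r (Cmod (z * g0))); [lra|].
  unfold Rdiv. rewrite Rmult_assoc Rinv_l; lra.
Qed.

Theorem theorem5p3 :
  forall (H0 : jacobi) (s : R) (phi0 chi0 : C -> Z -> C) (n0 : Z),
  (0 < s)%R ->
  purely_discrete_spectrum H0 ->
  convergence_exponent (spectrum H0) = Finite s ->
  real_entire_solution H0 phi0 ->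
  real_entire_solution H0 chi0 ->
  solution_order_at_most phi0 s ->
  solution_order_at_most chi0 s ->
  nontrivial_solution phi0 ->
  nontrivial_solution chi0 ->
  in_domain_near_minus H0 phi0 ->
  in_domain_near_plus H0 chi0 ->
  (exists (m : nat) (theta : nat -> R),
     nonreal_rays m theta (PI / s)
     /\ forall k, (k < m)%nat ->
          tends_to_0_along_ray (fun z => (chi0 z n0 / phi0 z n0)%C) (theta k)) ->
  forall H1 : jacobi,
  (forall z : C, spectrum H1 z <-> spectrum H0 z) ->
  (forall n : Z, (n < n0 - 1)%Z -> coef_a H1 n = coef_a H0 n) ->
  (forall n : Z, (n < n0)%Z -> coef_b H1 n = coef_b H0 n) ->
  same_bc_minus H0 H1 ->
  same_operator H1 H0.
Proof.
  intros H0 s phi0 chi0 N Hs PD _ RSp RSc Op Oc Np Nc Dp Dc [m [theta [Hth Hray]]] H1 Hsp Ea Eb Hbc.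
  assert (NR0 : forall z, Im z <> 0 -> resolvent_set H0 z) by (intros; now apply discrete_nonreal_resolvent).
  assert (NR1 : forall z, Im z <> 0 -> resolvent_set H1 z).
  { intros z Iz. apply NNPP; intros X. apply Hsp in X. apply X. auto. }
  assert (P0 : forall z, minus_solution H0 z (phi0 z)) by (intros z; split; [apply RSp|apply Dp]).
  assert (C0 : forall z, plus_solution H0 z (chi0 z)) by (intros z; split; [apply RSc|apply Dc]).
  assert (EX : forall z, exists psi, minus_solution H1 z psi /\ (forall n, (n <= N - 1)%Z -> psi n = phi0 z n) /\
    (RtoC (coef_a H1 (N - 1)%Z) * psi N)%C = (RtoC (coef_a H0 (N - 1)%Z) * phi0 z N)%C)
    by (intros z; now apply minus_solution_continuation).
  (* Chosen for each [z] separately, with no claim of analyticity: [phi1] serves only in identities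
     off the real axis. *)
  set (phi1 := fun z => proj1_sig (constructive_indefinite_description _ (EX z))).
  assert (HP1 : forall z, minus_solution H1 z (phi1 z) /\ (forall n, (n <= N - 1)%Z -> phi1 z n = phi0 z n) /\
    (RtoC (coef_a H1 (N - 1)%Z) * phi1 z N)%C = (RtoC (coef_a H0 (N - 1)%Z) * phi0 z N)%C)
    by (intros z; unfold phi1; now destruct (constructive_indefinite_description _ (EX z))).
  clearbody phi1. clear EX.
  set (a0 := coef_a H0 (N - 1)%Z) in *. set (a1 := coef_a H1 (N - 1)%Z) in *.
  assert (Pa0 : RtoC a0 <> 0) by (apply RtoC_neq_0; pose proof (coef_a_pos H0 (N - 1)%Z); unfold a0; lra).
  assert (Pa1 : RtoC a1 <> 0) by (apply RtoC_neq_0; pose proof (coef_a_pos H1 (N - 1)%Z); unfold a1; lra).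
  assert (Hphi : forall n z, holo (fun z => phi0 z n) z) by (intros n; apply entire_holo, (proj2 RSp n)).
  assert (Hchi : forall n z, holo (fun z => chi0 z n) z) by (intros n; apply entire_holo, (proj2 RSc n)).
  assert (Ephi := expbound_solution H0 s phi0 Hs RSp Op). assert (Echi := expbound_solution H0 s chi0 Hs RSc Oc).
  set (W := fun z => wronskian (coef_a H0) (phi0 z) (chi0 z) (N - 1)).
  assert (WE : forall z, W z = (a0 * (phi0 z (N - 1)%Z * chi0 z N - phi0 z N * chi0 z (N - 1)%Z))%C).
  { intros z. unfold W, wronskian. now replace (N - 1 + 1)%Z with N by lia. }
  assert (HW : forall z, holo W z).
  { intros z. eapply holo_ext; [apply near_all; intros w; symmetry; apply WE|].
    apply holo_mult; [apply holo_const|]. apply holo_minus; apply holo_mult; auto. }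
  assert (EW : expbound s W).
  { eapply expbound_ext; [intros w; symmetry; apply WE|]. apply expbound_mult; [now apply expbound_const|].
    apply expbound_minus; auto; apply expbound_mult; auto. }
  assert (W0 : forall z, spectrum H0 z -> W z = 0).
  { intros z Hz. destruct (PD z Hz) as [_ [[f [Ef Nf]] _]]. exact (wronskian_at_eigenvalue H0 z _ _ f _ (P0 z) (C0 z) Ef Nf). }
  assert (WN : forall z, Im z <> 0 -> W z <> 0).
  { intros z Iz. apply (wronskian_nonzero H0 z); auto. exists z; auto. }
  assert (PN : forall z n, Im z <> 0 -> phi0 z n <> 0).
  { intros z n Iz. apply (minus_solution_nonzero H0 z); auto. exists z; auto. }
  destruct (green_times_entire H0 H1 N W PD Hsp HW W0) as [EN [HEN EEN]].
  destruct (green_times_entire H0 H1 (N - 1) W PD Hsp HW W0) as [EM [HEM EEM]].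
  set (c := (RtoC a1 / RtoC a0)%C).
  set (hN := fun z => (c * c * EN z - chi0 z N * phi0 z N)%C).
  (* No factor [c^2] here: [phi1] and [phi0] agree at [N - 1] and differ by the factor [c] at
     [N]. *)
  set (hM := fun z => (EM z - chi0 z (N - 1)%Z * phi0 z (N - 1)%Z)%C).
  assert (HhN : forall z, holo hN z).
  { intros z. apply holo_minus; apply holo_mult; auto using holo_const. }
  assert (HhM : forall z, holo hM z).
  { intros z. apply holo_minus; auto. apply holo_mult; auto. }
  destruct (entire_common_quotient hN (fun z => phi0 z N) hM (fun z => phi0 z (N - 1)%Z)) as [F [HF EF]]; auto.
  (* A common zero would make [phi0 z] vanish identically, to the right by uniqueness and to the
     left by reflection. *)
  { intros z. destruct (classic (phi0 z N = 0)) as [Z1|]; [|auto]. destruct (classic (phi0 z (N - 1)%Z = 0)) as [Z2|]; [|auto].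
    exfalso. destruct (Np z) as [n Hn]. apply Hn.
    assert (Sp := proj1 RSp z).
    destruct (Z_le_gt_dec (N - 1) n) as [L|L]; [exact (solution_zero _ _ z _ N (coef_a_pos H0) Sp Z2 Z1 n L)|].
    assert (Sr := solution_refl _ _ _ _ Sp).
    assert (X := solution_zero _ _ z (refl (phi0 z)) (- (N - 1)) (fun k => coef_a_pos H0 (- k - 1)%Z) Sr).
    replace (phi0 z n) with (refl (phi0 z) (- n)%Z) by (unfold refl; f_equal; lia).
    apply X; [|unfold refl; rewrite Z.opp_involutive; exact Z2|lia].
    unfold refl. replace (- (- (N - 1) - 1))%Z with N by lia. exact Z1. }
  { intros z Iz. unfold hN, hM. rewrite EEN // EEM //.
    destruct (HP1 z) as [M1 [Q1 Q2]].
    pose proof (green_adjacent H1 z (phi1 z) N (NR1 z Iz) M1) as GA. fold a1 in GA. rewrite Q1 in GA; [|lia].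
    assert (Q3 : phi0 z N = (c * phi1 z N)%C).
    { apply (Cmult_cancel_l a0); [exact Pa0|]. rewrite -Q2. unfold c. field; auto. }
    rewrite Q3 WE Q3. set (p := phi1 z N) in *. set (q := phi0 z (N - 1)%Z) in *.
    set (gN := green H1 z N N) in *. set (gM := green H1 z (N - 1) (N - 1)%Z) in *.
    set (x := chi0 z N). set (y := chi0 z (N - 1)%Z).
    apply Ceq_of_minus.
    (* After [phi0 N = c phi1 N] both Green's functions carry the factor [c^2] and occur only in the
       combination of [green_adjacent]; the rest cancels because [c / a1 = 1 / a0]. *)
    transitivity (c * (a0 * (q * x - c * p * y)) * (c * (gN * (q * q) - gM * (p * p))) - (c * p) * q * (q * x - c * p * y))%C; [ring|].
    assert (GA2 : (c * (gN * (q * q) - gM * (p * p)))%C = (p * q / a0)%C).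
    { unfold c. transitivity (a1 * (gN * (q * q) - gM * (p * p)) / a0)%C; [field; auto|]. now rewrite GA. }
    rewrite GA2. field; auto. }
  assert (EhN : expbound s hN).
  { apply expbound_weighted; auto. intros rho Hr.
    destruct (expbound_mult s _ _ (expbound_const s (c * c) Hs) EW rho Hr) as [A [A0 HA]].
    (* Multiplication by [|Im z|] cancels the bound [1 / |Im z|] in the first term of [hN] and costs
       at most a factor [|z|] in the second, whence [expbound_id]. *)
    destruct (expbound_mult s _ _ (expbound_mult s _ _ (Echi N) (Ephi N)) (expbound_id s Hs) rho Hr) as [B [B0 HB]].
    exists (A + B + 1). split; [lra|]. intros z Iz. unfold hN. rewrite EEN //.
    assert (IP : 0 < Rabs (Im z)) by now apply Rabs_pos_lt.
    assert (G := green_bound H1 z N N (NR1 z Iz) Iz).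
    specialize (HA z). specialize (HB z). rewrite Cmod_mult in HA. rewrite Cmod_mult in HB.
    assert (T : Cmod (c * c * (green H1 z N N * W z) - chi0 z N * phi0 z N) <=
       1 / Rabs (Im z) * (Cmod (c * c) * Cmod (W z)) + Cmod (chi0 z N * phi0 z N)).
    { unfold Cminus. eapply Rle_trans; [apply Cmod_triangle|]. rewrite Cmod_opp. apply Rplus_le_compat_r.
      rewrite (Cmod_mult (c * c)) (Cmod_mult (green H1 z N N)).
      replace (Cmod (c * c) * (Cmod (green H1 z N N) * Cmod (W z))) with (Cmod (green H1 z N N) * (Cmod (c * c) * Cmod (W z))) by ring.
      apply Rmult_le_compat_r; [apply Rmult_le_pos; apply Cmod_ge_0|exact G]. }
    assert (T2 : Rabs (Im z) <= Cmod z) by apply snd_le_Cmod.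
    apply (Rmult_le_compat_r (Rabs (Im z))) in T; [|lra].
    replace ((1 / Rabs (Im z) * (Cmod (c * c) * Cmod (W z)) + Cmod (chi0 z N * phi0 z N)) * Rabs (Im z))
      with (Cmod (c * c) * Cmod (W z) + Cmod (chi0 z N * phi0 z N) * Rabs (Im z)) in T by (field; lra).
    assert (T3 : Cmod (chi0 z N * phi0 z N) * Rabs (Im z) <= Cmod (chi0 z N * phi0 z N) * Cmod z)
      by (apply Rmult_le_compat_l; [apply Cmod_ge_0|exact T2]).
    pose proof (scale_ge_1 rho z ltac:(lra)) as X. set (xx := scale rho z) in *.
    assert (exp (A * xx) <= exp ((A + B) * xx)) by (apply exp_le; nra).
    assert (exp (B * xx) <= exp ((A + B) * xx)) by (apply exp_le; nra).
    replace ((A + B + 1) * xx) with ((A + B) * xx + xx) by ring. rewrite exp_plus.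
    assert (2 <= exp xx) by (pose proof (exp_ineq1_le xx); lra).
    pose proof (exp_pos ((A + B) * xx)). nra. }
  assert (EFb : expbound s F).
  { apply (expbound_quotient s (fun z => phi0 z N * phi0 z N)%C F Ci Hs).
    - intros z. now apply holo_mult.
    - exact HF.
    - assert (Im Ci <> 0) by (simpl; lra). apply Cmult_neq_0; auto.
    - now apply expbound_mult.
    - apply (expbound_ext s hN); [intros z; symmetry; apply EF|exact EhN]. }
  assert (GD : forall z, Im z <> 0 -> (green H0 z N N * W z)%C = (phi0 z N * chi0 z N)%C)
    by (intros z Iz; now apply green_diagonal; auto).
  assert (F0 : forall z, F z = 0).
  { apply (vanishing_along_rays F s m theta Hs HF EFb Hth). intros k Hk.
    destruct Hth as [_ Hth]. destruct (Hth k Hk) as [_ [_ Hsin]].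
    destruct (green_quotient_bounded H0 H1 N (theta k) NR0 NR1 Hsin) as [R0 [R0p HR]].
    unfold tends_to_0_along_ray. apply filterlim_C0; [apply Rbar_locally_filter|]. intros eps He.
    set (Q := 3 * Cmod (c * c) + 1). assert (QP : 0 < Q) by (unfold Q; pose proof (Cmod_ge_0 (c * c)); lra).
    destruct (tends_along_ray _ _ (Hray k Hk) (eps / Q) ltac:(apply Rdiv_lt_0_compat; lra)) as [R1 HR1].
    exists (Rmax R0 R1). intros r Hr.
    assert (r0 : R0 < r) by (pose proof (Rmax_l R0 R1); lra). assert (r1 : R1 < r) by (pose proof (Rmax_r R0 R1); lra).
    destruct (HR r r0) as [Ng Bg]. specialize (HR1 r r1). set (z := ray_point (theta k) r) in *.
    assert (Iz : Im z <> 0) by (unfold z; rewrite ray_point_Im; apply Rmult_integral_contrapositive; lra).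
    assert (FE : F z = ((chi0 z N / phi0 z N) * (c * c * (green H1 z N N / green H0 z N N) - 1))%C).
    { specialize (EF z). unfold hN in EF. rewrite EEN // in EF. specialize (GD z Iz).
      assert (EW2 : W z = (phi0 z N * chi0 z N / green H0 z N N)%C) by (rewrite -GD; field; auto).
      rewrite EW2 in EF. pose proof (PN z N Iz) as PNz.
      apply (Cmult_cancel_l (phi0 z N * phi0 z N)); [now apply Cmult_neq_0|]. rewrite EF. field; auto. }
    rewrite FE Cmod_mult.
    assert (BQ : Cmod (c * c * (green H1 z N N / green H0 z N N) - 1) <= Q).
    { unfold Cminus. eapply Rle_trans; [apply Cmod_triangle|]. rewrite Cmod_opp Cmod_1 Cmod_mult. unfold Q.
      pose proof (Cmod_ge_0 (c * c)). nra. }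
    apply Rle_lt_trans with (Cmod (chi0 z N / phi0 z N) * Q).
    - apply Rmult_le_compat_l; [apply Cmod_ge_0|exact BQ].
    - apply (Rmult_lt_compat_r Q) in HR1; [|exact QP].
      replace (eps / Q * Q) with eps in HR1 by (field; lra). exact HR1. }
  apply (agree_same_operator H0 H1 phi0 phi1 NR0 NR1) with (N := N); auto.
  - intros z Iz; apply HP1.
  - split; [exact Ea|split; [exact Eb|split]].
    + intros z n Iz Hn. now apply HP1.
    + intros z Iz. fold a0 a1. specialize (EF z). rewrite F0 in EF. unfold hN in EF. rewrite EEN // in EF.
      specialize (GD z Iz).
      (* [F = 0] gives [c^2 G_1 W = phi_0 chi_0 = G_0 W], and [W] has no zeros off the real axis. *)
      apply (Cmult_cancel_l (W z)); [auto|]. unfold c in EF.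
      transitivity (a0 * a0 * (a1 / a0 * (a1 / a0) * (green H1 z N N * W z) - chi0 z N * phi0 z N) + a0 * a0 * (phi0 z N * chi0 z N))%C.
      { field; auto. }
      rewrite -EF -GD. ring.
Qed.
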